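(* Let $(\mathcal{Z}_{p_n,q_n},\varphi_n^m)$ and $(\mathcal{Z}_{p'_n,q'_n},\psi_n^m)$ be two sequences (indexed by $n\in\mathbb{N}$, $n\ge 1$) of prime dimension-drop algebras and diagonalizable unital $*$-embeddings, each of which satisfies the following two properties (stated for the first sequence): ($\dagger$) for every $m\ge n$, if $\Lambda^{\varphi_n^m}=\{\xi_1,\dots,\xi_k\}$, then $\xi_1(x)\le\xi_2(x)\le\dots\le\xi_k(x)$ for all $x\in[0,1]$, and the diameter of the image of each $\xi_i$ is not greater than $1/2^{m-n}$; ($\ddagger$) $p_mq_m$ is a multiple of $m$ for every natural number $m$. Then the inductive limits of the two sequences are $*$-isomorphic.
   Context: For positive integers $p,q$ the dimension-drop algebra is $\mathcal{Z}_{p,q}=\{f\in C([0,1],M_{pq}): f(0)\in M_p\otimes 1_q,\ f(1)\in 1_p\otimes M_q\}$, where $M_{pq}=M_p\otimes M_q$; it is prime if $p$ and $q$ are coprime. A unital $*$-embedding (injective unital $*$-homomorphism) $\varphi:\mathcal{Z}_{p,q}\to\mathcal{Z}_{p',q'}$ is diagonalizable if there are continuous maps $\xi_1,\dots,\xi_k:[0,1]\to[0,1]$ and a unitary $u\in C([0,1],M_{p'q'})$ such that $\varphi(f)=\mathrm{Ad}_u(\mathrm{diag}(f\circ\xi_1,\dots,f\circ\xi_k))$ for every $f\in\mathcal{Z}_{p,q}$ (here $\mathrm{Ad}_u(x)=u^*xu$, and $kpq=p'q'$); one then writes $\Lambda^{\varphi}=\{\xi_1,\dots,\xi_k\}$ for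 the (finite, indexed with repetitions) list of these maps. Compositions of diagonalizable $*$-embeddings are diagonalizable; a property of $\Lambda^{\varphi}$ is understood to hold for a suitable choice of such a representation of $\varphi$. A sequence $(\mathcal{A}_n,\varphi_n^m)$ consists of algebras $\mathcal{A}_n$ and maps $\varphi_n^{n+1}:\mathcal{A}_n\to\mathcal{A}_{n+1}$, with $\varphi_n^m=\varphi_{m-1}^m\circ\dots\circ\varphi_n^{n+1}$ for $m\ge n$ and $\varphi_n^n=\mathrm{id}$. *)

(* Defs.v *)
From HB Require Import structures.
From mathcomp Require Import all_boot all_order all_algebra.
From mathcomp Require Import complex mxtens spectral.
From mathcomp Require Import all_classical all_reals all_analysis.

Set Implicit Arguments.
Unset Strict Implicit.
Unset Printing Implicit Defensive.

Import Order.TTheory GRing.Theory Num.Theory.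
Import numFieldNormedType.Exports.

Local Open Scope classical_set_scope.
Local Open Scope sesquilinear_scope.
Local Open Scope ring_scope.

(* R[i], packed as a numClosedFieldType so that it carries the topology, the
   pseudometric and the norm of any numFieldType. *)
Definition complexes (R : realType) : numClosedFieldType :=
  Num.ClosedField.clone R[i] _.

(* Complex *-algebras, possibly without unit. The product is a field of its own
   because a structure which is both a ring and a normed module, without being a
   [numDomainType], cannot be joined to the hierarchy. *)
HB.mixin Record Lmodule_isStarAlgebra (C : numClosedFieldType) A
    of GRing.Lmodule C A := {
  smul : A -> A -> A;
  star : A -> A;
  smulA : associative smul;
  smulDl : left_distributive smul +%R;
  smulDr : right_distributive smul +%R;
  smulZl : forall (a : C) (x y : A), smul (a *: x) y = a *: smul x y;
  smulZr : forall (a : C) (x y : A), smul x (a *: y) = a *: smul x y;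
  starD : {morph star : x y / x + y};
  starZ : forall (a : C) (x : A), star (a *: x) = a^* *: star x;
  starM : forall x y : A, star (smul x y) = smul (star y) (star x);
  starK : involutive star
}.

#[short(type="starAlgType")]
HB.structure Definition StarAlgebra (C : numClosedFieldType) :=
  {A of Lmodule_isStarAlgebra C A & GRing.Lmodule C A}.

HB.mixin Record StarAlgebra_isCStar (C : numClosedFieldType) A
    of StarAlgebra C A & CompleteNormedModule C A := {
  cstar_normM : forall x y : A, `|smul x y| <= `|x| * `|y|;
  cstar_norm_starM : forall x : A, `|smul (star x) x| = `|x| ^+ 2
}.

#[short(type="cstarAlgType")]
HB.structure Definition CStarAlgebra (C : numClosedFieldType) :=
  {A of StarAlgebra_isCStar C A & StarAlgebra C A & CompleteNormedModule C A}.

Section StarHom.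
Variables (C : numClosedFieldType) (A B : starAlgType C).

Definition star_hom (f : A -> B) : Prop :=
  [/\ linear f, {morph f : x y / smul x y} & {morph f : x / star x}].

(* For C*-algebras, such a bijection is automatically isometric. *)
Definition star_isomorphic : Prop :=
  exists f : A -> B, star_hom f /\ bijective f.

End StarHom.

(* [connecting phi n k] is the map phi_n^m for m = k + n. *)
Fixpoint connecting (A : nat -> Type) (phi : forall n, A n -> A n.+1)
    (n k : nat) : A n -> A (k + n)%N :=
  match k with
  | 0 => id
  | k'.+1 => fun a => phi (k' + n)%N (connecting phi k' a)
  end.

(* Sequences are indexed by n >= 1: the term of index 0 is never used.
   [nrm n] is the C*-norm of [A n]. The C*-algebra [L], with the maps
   [mu n : A n -> L], is the completion of the algebraic direct limit for the
   C*-seminorm lim_m ||phi_n^m(a)||. *)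
Record is_inductive_limit (C : numClosedFieldType) (A : nat -> starAlgType C)
    (nrm : forall n, A n -> C) (phi : forall n, A n -> A n.+1)
    (L : cstarAlgType C) (mu : forall n, A n -> L) : Prop := {
  limit_hom : forall n, (0 < n)%N -> star_hom (mu n);
  limit_compat : forall n, (0 < n)%N -> mu n.+1 \o phi n =1 mu n;
  limit_norm : forall n, (0 < n)%N -> forall a : A n,
    nrm (k + n)%N (connecting phi k a) @[k --> \oo] --> (`|mu n a| : C);
  limit_dense : dense (\bigcup_(n in [set n | (0 < n)%N]) range (mu n))
}.

Section UnitInterval.
Variable R : realType.

Definition unit_interval := set_type (`[0, 1]%classic : set R).

Lemma unit_interval0_subproof : (0 : R) \in (`[0, 1]%classic : set R).
Proof. by rewrite inE /= in_itv /= lexx ler01. Qed.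

Lemma unit_interval1_subproof : (1 : R) \in (`[0, 1]%classic : set R).
Proof. by rewrite inE /= in_itv /= lexx ler01. Qed.

Definition ui0 : unit_interval := SigSub unit_interval0_subproof.
Definition ui1 : unit_interval := SigSub unit_interval1_subproof.

Definition diameter (A : set R) : R :=
  sup [set `|xy.1 - xy.2| | xy in A `*` A].

End UnitInterval.

Section MatrixNorm.
Variable R : realType.
Local Notation C := (complexes R).

(* [complex.Re `|z|] is the modulus of z as an element of R. *)
Definition l2norm n (v : 'cV[C]_n) : R :=
  Num.sqrt (\sum_(j < n) complex.Re `|v j 0| ^+ 2).

Definition opnorm n (M : 'M[C]_n) : R :=
  sup [set l2norm (M *m v) | v in [set v : 'cV[C]_n | l2norm v <= 1]].

End MatrixNorm.

Section MatrixContinuity.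
Variable T : topologicalType.

Lemma mx_continuousP (K : numFieldType) m n (f : T -> 'M[K]_(m, n)) :
  continuous f <-> forall i j, continuous (fun t => f t i j).
Proof.
split=> [cf i j t|cf t].
  exact: (continuous_comp (cf t) (@coord_continuous _ _ _ i j (f t))).
move=> B [P Pnbhs PB]; rewrite /= nbhs_filterE.
have := @filter_forall _ _
  (fun ij s => P ij.1 ij.2 (f s ij.1 ij.2)) (nbhs t) (nbhs_filter t).
move=> /(_ (fun ij => cf ij.1 ij.2 t _ (Pnbhs ij.1 ij.2))).
by apply: filterS => s Ps; apply: PB => i j; exact: (Ps (i, j)).
Qed.

Lemma mx_linear_continuous (K : numFieldType) m n (k : K)
    (f g : T -> 'M[K]_(m, n)) :
  continuous f -> continuous g -> continuous (fun t => k *: f t + g t).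
Proof.
move=> /mx_continuousP cf /mx_continuousP cg; apply/mx_continuousP => i j t.
have -> : (fun t => (k *: f t + g t) i j) = (fun t => k * f t i j + g t i j).
  by apply/funext => s; rewrite !mxE.
by apply: cvgD; [apply: cvgM; [exact: cvg_cst|exact: cf]|exact: cg].
Qed.

Lemma mulmx_continuous (K : numFieldType) m n r
    (f : T -> 'M[K]_(m, n)) (g : T -> 'M[K]_(n, r)) :
  continuous f -> continuous g -> continuous (fun t => f t *m g t).
Proof.
move=> /mx_continuousP cf /mx_continuousP cg; apply/mx_continuousP => i j t.
have -> : (fun t => (f t *m g t) i j) = (fun t => \sum_l f t i l * g t l j).
  by apply/funext => s; rewrite !mxE.
apply: continuous_big => [|l _ s]; first exact: add_continuous.
by apply: cvgM; [exact: cf|exact: cg].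
Qed.

Lemma adjmx_continuous (K : numClosedFieldType) m n (f : T -> 'M[K]_(m, n)) :
  continuous f -> continuous (fun t => (f t)^t*).
Proof.
move=> /mx_continuousP cf; apply/mx_continuousP => i j t.
have -> : (fun t => (f t)^t* i j) = (fun t => (f t j i)^*).
  by apply/funext => s; rewrite !mxE.
apply/cvgrPdist_lt => e e0; have /cvgrPdist_lt/(_ e e0) := cf j i t.
by apply: filterS => s; rewrite -rmorphB norm_conjC.
Qed.

End MatrixContinuity.

Section DimensionDrop.
Variables (R : realType) (p q : nat).
Local Notation C := (complexes R).
Local Notation path := (unit_interval R -> 'M[C]_(p * q)).

(* [*t] is the Kronecker product, which identifies M_p (x) M_q with M_pq. *)
Definition dimdrop_pred : {pred path} := mem [set f : path |
  [/\ continuous f,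
      exists a : 'M[C]_p, f (ui0 R) = a *t (1%:M : 'M[C]_q) &
      exists b : 'M[C]_q, f (ui1 R) = (1%:M : 'M[C]_p) *t b]].

Record dimdrop := DimDrop {
  dimdrop_fun :> path;
  dimdrop_mem : dimdrop_fun \in dimdrop_pred
}.

HB.instance Definition _ := [isSub for dimdrop_fun].
HB.instance Definition _ := [Choice of dimdrop by <:].

Lemma dimdrop_submod_closed : submod_closed dimdrop_pred.
Proof.
split=> [|k f g].
  rewrite inE; split; first exact: cst_continuous.
  - by exists 0; rewrite tens0mx.
  - by exists 0; rewrite tensmx0.
rewrite !inE => -[cf [a fa] [b fb]] [cg [a' ga] [b' gb]]; split.
- exact: (@mx_linear_continuous _ C _ _ k f g cf cg).
- exists (k *: a + a'); rewrite /= [LHS]/(k *: f _ + g _) fa ga.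
  by apply/matrixP => i j; rewrite !mxE mulrDl mulrA.
- exists (k *: b + b'); rewrite /= [LHS]/(k *: f _ + g _) fb gb.
  by apply/matrixP => i j; rewrite !mxE mulrDr mulrCA.
Qed.

HB.instance Definition _ := GRing.isSubmodClosed.Build C path dimdrop_pred
  (GRing.submod_closed_semi dimdrop_submod_closed).
HB.instance Definition _ := [SubChoice_isSubLmodule of dimdrop by <:].

Lemma dimdrop_mul_subproof (f g : dimdrop) :
  (fun t => f t *m g t) \in dimdrop_pred.
Proof.
have := dimdrop_mem f; have := dimdrop_mem g.
rewrite !inE => -[cg [a' ga] [b' gb]] [cf [a fa] [b fb]]; split.
- exact: (@mulmx_continuous _ C _ _ _ f g cf cg).
- by exists (a *m a'); rewrite fa ga tensmx_mul mulmx1.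
- by exists (b *m b'); rewrite fb gb tensmx_mul mulmx1.
Qed.

Definition dimdrop_mul (f g : dimdrop) := DimDrop (dimdrop_mul_subproof f g).

Lemma dimdrop_star_subproof (f : dimdrop) :
  (fun t => (f t)^t*) \in dimdrop_pred.
Proof.
have := dimdrop_mem f; rewrite !inE => -[cf [a fa] [b fb]]; split.
- exact: (@adjmx_continuous _ C _ _ f cf).
- by exists (a^t*); rewrite fa trmx_tens map_mxT trmx1 map_mx1.
- by exists (b^t*); rewrite fb trmx_tens map_mxT trmx1 map_mx1.
Qed.

Definition dimdrop_star (f : dimdrop) := DimDrop (dimdrop_star_subproof f).

Lemma dimdropP (f g : dimdrop) : (forall t, f t = g t) -> f = g.
Proof. by move=> fg; apply: val_inj; apply/funext. Qed.

Lemma dimdrop_mulA : associative dimdrop_mul.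
Proof. by move=> f g h; apply: dimdropP => t /=; rewrite mulmxA. Qed.

Lemma dimdrop_mulDl : left_distributive dimdrop_mul +%R.
Proof. by move=> f g h; apply: dimdropP => t; exact: mulmxDl. Qed.

Lemma dimdrop_mulDr : right_distributive dimdrop_mul +%R.
Proof. by move=> f g h; apply: dimdropP => t; exact: mulmxDr. Qed.

Lemma dimdrop_mulZl (a : C) (f g : dimdrop) :
  dimdrop_mul (a *: f) g = a *: dimdrop_mul f g.
Proof. by apply: dimdropP => t; exact/esym/scalemxAl. Qed.

Lemma dimdrop_mulZr (a : C) (f g : dimdrop) :
  dimdrop_mul f (a *: g) = a *: dimdrop_mul f g.
Proof. by apply: dimdropP => t; exact/esym/scalemxAr. Qed.

Lemma dimdrop_starD : {morph dimdrop_star : f g / f + g}.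
Proof.
by move=> f g; apply: dimdropP => t; apply/matrixP => i j; rewrite /= !mxE rmorphD.
Qed.

Lemma dimdrop_starZ (a : C) (f : dimdrop) :
  dimdrop_star (a *: f) = a^* *: dimdrop_star f.
Proof.
by apply: dimdropP => t; apply/matrixP => i j; rewrite /= !mxE rmorphM.
Qed.

Lemma dimdrop_starM (f g : dimdrop) :
  dimdrop_star (dimdrop_mul f g) = dimdrop_mul (dimdrop_star g) (dimdrop_star f).
Proof. by apply: dimdropP => t /=; rewrite trmx_mul map_mxM. Qed.

Lemma dimdrop_starK : involutive dimdrop_star.
Proof. by move=> f; apply: dimdropP => t /=; rewrite trmxCK. Qed.

HB.instance Definition _ := Lmodule_isStarAlgebra.Build C dimdrop
  dimdrop_mulA dimdrop_mulDl dimdrop_mulDr dimdrop_mulZl dimdrop_mulZr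
  dimdrop_starD dimdrop_starZ dimdrop_starM dimdrop_starK.

Lemma dimdrop_one_subproof : (fun=> 1%:M) \in dimdrop_pred.
Proof.
have t11 : 1%:M *t 1%:M = 1%:M :> 'M[C]_(p * q).
  apply/matrixP => i j; case: (mxtens_indexP i) => i1 i2.
  case: (mxtens_indexP j) => j1 j2.
  rewrite tensmxE !mxE (inj_eq (can_inj (@mxtens_indexK p q))) xpair_eqE.
  by rewrite -natrM mulnb.
by rewrite inE; split; [exact: cst_continuous|exists 1%:M|exists 1%:M].
Qed.

Definition dimdrop_one := DimDrop dimdrop_one_subproof.

(* The C*-norm, as an element of R[i]. *)
Definition dimdrop_norm (f : dimdrop) : C :=
  (sup (range (fun t => opnorm (f t))))%:C%C.

End DimensionDrop.

Section Diagonalizable.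
Variables (R : realType) (p q p' q' : nat).
Local Notation C := (complexes R).
Local Notation I := (unit_interval R).

(* phi = Ad_u (diag (f o xi_1, ..., f o xi_k)), where Ad_u (x) = u^* x u;
   the list xi_1, ..., xi_k is indexed by 'I_k. *)
Definition diagonalized_by (phi : dimdrop R p q -> dimdrop R p' q')
    (k : nat) (xi : 'I_k -> I -> I) : Prop :=
  (forall i, continuous (xi i)) /\
  exists (e : (\sum_(i < k) p * q = p' * q')%N) (u : I -> 'M[C]_(p' * q')),
    [/\ continuous u,
        forall t, u t \is unitarymx &
        forall (f : dimdrop R p q) (t : I),
          phi f t =
          (u t)^t* *m castmx (e, e) (\mxdiag_(i < k) f (xi i t)) *m u t].

Definition diagonalizable (phi : dimdrop R p q -> dimdrop R p' q') : Prop :=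
  exists (k : nat) (xi : 'I_k -> I -> I), diagonalized_by phi xi.

Definition unital_star_embedding (phi : dimdrop R p q -> dimdrop R p' q') :
    Prop :=
  [/\ star_hom phi, phi (dimdrop_one R p q) = dimdrop_one R p' q' &
      injective phi].

End Diagonalizable.

Section Sequences.
Variables (R : realType) (p q : nat -> nat).
Local Notation C := (complexes R).
Local Notation I := (unit_interval R).
Variable phi : forall n, dimdrop R (p n) (q n) -> dimdrop R (p n.+1) (q n.+1).

Definition prime_dimdrop_sequence : Prop :=
  forall n, (0 < n)%N ->
    [/\ (0 < p n)%N, (0 < q n)%N, coprime (p n) (q n),
        unital_star_embedding (@phi n) & diagonalizable (@phi n)].

(* Here m = k + n, so that m - n = k. *)
Definition dagger : Prop :=
  forall n k, (0 < n)%N ->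
    exists (r : nat) (xi : 'I_r -> I -> I),
      [/\ diagonalized_by
            (@connecting (fun n => dimdrop R (p n) (q n)) phi n k) xi,
          forall (i j : 'I_r) (x : I),
            (i <= j)%N -> set_val (xi i x) <= set_val (xi j x) &
          forall i : 'I_r,
            diameter (range (fun x => set_val (xi i x))) <= 1 / 2 ^+ k].

Definition double_dagger : Prop :=
  forall m, (0 < m)%N -> (m %| p m * q m)%N.

Definition is_dimdrop_limit (L : cstarAlgType C) : Prop :=
  exists mu : forall n, dimdrop R (p n) (q n) -> L,
    @is_inductive_limit C (fun n => dimdrop R (p n) (q n))
      (fun n => @dimdrop_norm R (p n) (q n)) phi L mu.

End Sequences.

(* Main.v *)
Require Import Defs.
From HB Require Import structures.
From mathcomp Require Import all_boot all_order all_algebra.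
From mathcomp Require Import complex mxtens spectral.
From mathcomp Require Import all_classical all_reals all_analysis.
From mathcomp Require Import ring lra zify.

Set Implicit Arguments.
Unset Strict Implicit.
Unset Printing Implicit Defensive.

Import Order.TTheory GRing.Theory Num.Theory.
Import numFieldNormedType.Exports.

Local Open Scope classical_set_scope.
Local Open Scope sesquilinear_scope.
Local Open Scope ring_scope.

(** An approximate intertwining in the sense of Elliott. By (dagger) the maps out of A_n
    far along the first sequence have lists which, up to a small d, repeat equally often
    the points of a grid 0 = c_0 <= ... <= c_S = 1 fixed in advance. The sizes p_m, q_m of
    the second sequence tend to infinity and (double dagger) makes p_m q_m divisible enough,
    so there is also a diagonal map A_n -> B_m whose list follows the same grid: its values
    at 0 and 1 only have to satisfy divisibility conditions on multiplicities, and are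
    joined linearly. Two diagonal maps with lists following one grid are almost unitarily
    equivalent on an equicontinuous set, because coprimality of p and q forces compatible
    multiplicities at the endpoints. Going back and forth along the two sequences, the round
    trips can thus be corrected to agree with connecting maps up to 2^-j, and the diagram
    converges to mutually inverse *-homomorphisms of the limits. *)

(** The obstacle sits at the ends of [0,1]. Two diagonal maps with nearby lists are compared through
    u^* D u and v^* D v with one matrix D, but v^* u need not lie in the target algebra: its value
    at 0 must be of the form X (x) 1_q', at 1 of the form 1_p' (x) X. What helps is that a map into
    this algebra takes at an end the form Phi(f) (x) 1_s, with s = q' or s = p'. Hence s divides the
    multiplicity of each interior point of the list, and the numbers a, b of zeros and ones modulo s
    solve a q = 0, b p = 0 and a + b = k modulo s, where k is the length of the list. For coprime p
    and q this system has exactly one solution. Uniqueness lets one permutation matrix bring both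
    lists into block form; existence, by Bezout, makes it possible to construct new maps. The
    corrections found at the two ends commute with D only approximately; they are spread over [0,1]
    along paths in their bicommutants, which keeps the commutators small. *)

(** * Unitaries, projections and matrix units *)

Section Adjoint.
Variable C : numClosedFieldType.

Lemma adjmxM m n k (A : 'M[C]_(m, n)) (B : 'M[C]_(n, k)) :
  (A *m B)^t* = B^t* *m A^t*.
Proof. by rewrite trmx_mul map_mxM. Qed.

Lemma adjmx_sum (I : finType) (P : pred I) m n (F : I -> 'M[C]_(m, n)) :
  (\sum_(i | P i) F i)^t* = \sum_(i | P i) (F i)^t*.
Proof. by rewrite raddf_sum /= raddf_sum. Qed.

Lemma unitarymxV n (u : 'M[C]_n) : u \is unitarymx -> u *m u^t* = 1%:M.
Proof. by move/unitarymxP. Qed.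

Lemma unitaryVmx n (u : 'M[C]_n) : u \is unitarymx -> u^t* *m u = 1%:M.
Proof. by move/unitarymxP/mulmx1C. Qed.

Lemma unitarymx_adj n (u : 'M[C]_n) : u \is unitarymx -> u^t* \is unitarymx.
Proof. by rewrite trmxC_unitary. Qed.

(** Gram-Schmidt on a row base of [Q] gives orthonormal rows [B] with the same row space; [B^* B] is
    the orthogonal projection onto it, that is [Q]. This also shows that the trace of a projection
    is a natural number. *)
Lemma projection_factor n (Q : 'M[C]_n) :
  Q^t* = Q -> Q *m Q = Q ->
  exists r (B : 'M[C]_(r, n)), B *m B^t* = 1%:M /\ B^t* *m B = Q.
Proof.
move=> Qs Qi; pose B := schmidt (row_base Q); exists (\rank Q), B.
have Bu : B \is unitarymx by apply: schmidt_unitarymx; exact: rank_leq_col.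
have BE : (B :=: Q)%MS.
  apply: eqmx_trans (eqmx_schmidt_free _) (eq_row_base _); exact: row_base_free.
split; first exact/unitarymxP.
have QB : Q *m (B^t* *m B) = Q.
  have [X QX] : exists X, Q = X *m B by apply/submxP; rewrite BE.
  by rewrite [LHS](congr1 (mulmx^~ _) QX) [RHS]QX -!mulmxA [B *m (_ *m _)]mulmxA (unitarymxP Bu) mul1mx.
have BQ : B *m Q = B.
  have [X BX] : exists X, B = X *m Q by apply/submxP; rewrite BE.
  by rewrite BX -mulmxA Qi.
have := congr1 (fun M => M^t*) QB; rewrite /= !adjmxM trmxCK Qs -mulmxA BQ.
by [].
Qed.

(** Equal traces mean equal ranks, so the two factorizations have the same inner size and compose to
    the partial isometry [B'^* B] of Murray-von Neumann equivalence. *)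
Lemma projection_equiv n (Q Q' : 'M[C]_n) :
  Q^t* = Q -> Q *m Q = Q -> Q'^t* = Q' -> Q' *m Q' = Q' -> \tr Q = \tr Q' ->
  exists w : 'M[C]_n, [/\ w^t* *m w = Q, w *m w^t* = Q' & w *m Q = w].
Proof.
move=> Qs Qi Qs' Qi' trQ.
have [r [B [Bu BQ]]] := projection_factor Qs Qi.
have [r' [B' [Bu' BQ']]] := projection_factor Qs' Qi'.
have rk : r = r'.
  apply/eqP; rewrite -(eqr_nat C) -(mxtrace1 C r) -(mxtrace1 C r') -Bu -Bu'.
  by rewrite mxtrace_mulC BQ [eqbRHS]mxtrace_mulC BQ' trQ.
case: _ / rk B' Bu' BQ' => B' Bu' BQ'.
exists (B'^t* *m B); rewrite !adjmxM !trmxCK; split.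
- by rewrite -mulmxA [B' *m _]mulmxA Bu' mul1mx.
- by rewrite mulmxA -(mulmxA _ B) Bu mulmx1.
- by rewrite -BQ mulmxA -(mulmxA _ B) Bu mulmx1.
Qed.

(* E_j is the matrix unit e_{rho j, j}: the index set J is partitioned by rho
   into the blocks of a sum of matrix algebras. *)
Lemma matrix_units_equiv (J : finType) (X : Type)
  (a : pred J) (rho : J -> X) n (E E' : J -> 'M[C]_n) (Q Q' : X -> 'M[C]_n) :
  (forall j k, a j -> a k -> E j *m (E k)^t* = if j == k then Q (rho j) else 0) ->
  (forall j k, a j -> a k ->
     E' j *m (E' k)^t* = if j == k then Q' (rho j) else 0) ->
  (forall j, a j -> Q (rho j) *m E j = E j) ->
  (forall j, a j -> Q' (rho j) *m E' j = E' j) ->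
  \sum_(j | a j) (E j)^t* *m E j = 1%:M ->
  \sum_(j | a j) (E' j)^t* *m E' j = 1%:M ->
  (forall j, a j -> \tr (Q (rho j)) = \tr (Q' (rho j))) ->
  exists W : 'M[C]_n, W \is unitarymx /\
    forall j k, a j -> a k -> rho j = rho k ->
      W *m ((E j)^t* *m E k) = (E' j)^t* *m E' k *m W.
Proof.
move=> EE EE' QE QE' E1 E1' trQ.
have /choice [w wP] : forall x, exists w : 'M[C]_n,
    (exists2 j, a j & rho j = x) ->
    [/\ w^t* *m w = Q x, w *m w^t* = Q' x & w *m Q x = w].
  move=> x; have [[j aj <-]|nx] := pselect (exists2 j, a j & rho j = x); last first.
    by exists 0.
  have QQ : Q (rho j) = E j *m (E j)^t* by rewrite EE // eqxx.
  have QQ' : Q' (rho j) = E' j *m (E' j)^t* by rewrite EE' // eqxx.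
  have [|||||w] := @projection_equiv n (Q (rho j)) (Q' (rho j)).
  - by rewrite QQ adjmxM trmxCK.
  - by rewrite {2}QQ mulmxA QE.
  - by rewrite QQ' adjmxM trmxCK.
  - by rewrite {2}QQ' mulmxA QE'.
  - exact: trQ.
  by move=> ww; exists w.
have {}wP j : a j -> [/\ (w (rho j))^t* *m w (rho j) = Q (rho j),
    w (rho j) *m (w (rho j))^t* = Q' (rho j) & w (rho j) *m Q (rho j) = w (rho j)].
  by move=> aj; apply: wP; exists j.
(* Each summand carries the j-th copy of [Q] onto the j-th copy of [Q']; one [w] serves all j of a
   block, which is what makes [W] intertwine the matrix units. *)
pose W := \sum_(j | a j) (E' j)^t* *m w (rho j) *m E j.
have WE k : a k -> W *m (E k)^t* = (E' k)^t* *m w (rho k).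
  move=> ak; rewrite mulmx_suml (bigD1 k) //= big1 => [|j /andP[aj jk]].
    by rewrite addr0 -mulmxA EE // eqxx -mulmxA; have [_ _ ->] := wP k ak.
  by rewrite -mulmxA EE // (negPf jk) mulmx0.
have EW k : a k -> E' k *m W = w (rho k) *m E k.
  move=> ak; rewrite mulmx_sumr (bigD1 k) //= big1 => [|j /andP[aj jk]].
    rewrite addr0 !mulmxA EE' // eqxx; have [w1 w2 w3] := wP k ak.
    by rewrite -w2 -(mulmxA _ _ (w _)) w1 w3.
  by rewrite !mulmxA EE' // eq_sym (negPf jk) !mul0mx.
exists W; split.
  apply/unitarymxP; rewrite {2}/W adjmx_sum mulmx_sumr -E1'.
  apply: eq_bigr => j aj; have [w1 w2 w3] := wP j aj.
  by rewrite !adjmxM trmxCK !mulmxA WE // -(mulmxA _ (w _)) w2 -mulmxA QE'.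
move=> j k aj ak jk; rewrite mulmxA WE // -!mulmxA EW // jk.
by [].
Qed.
End Adjoint.

Lemma perm_conj (C : numClosedFieldType) N (f : 'I_N -> 'I_N) : injective f ->
  exists P : 'M[C]_N, P \is unitarymx /\
    forall A : 'M[C]_N, P *m A *m P^t* = \matrix_(i, j) A (f i) (f j).
Proof.
move=> fi; pose P : 'M[C]_N := \matrix_(i, j) (f i == j)%:R.
have PA m (A : 'M[C]_(N, m)) : P *m A = \matrix_(i, j) A (f i) j.
  apply/matrixP => i j; rewrite !mxE (bigD1 (f i)) //= big1 => [|l li].
    by rewrite !mxE eqxx mul1r addr0.
  by rewrite !mxE eq_sym (negPf li) mul0r.
have PAP (A : 'M[C]_N) : P *m A *m P^t* = \matrix_(i, j) A (f i) (f j).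
  rewrite PA; apply: (@can_inj _ _ _ (fun M => M^t*)) => [M|].
    exact: trmxCK.
  rewrite /= adjmxM trmxCK PA; apply/matrixP => i j.
  by rewrite ?mxE.
exists P; split => //; apply/unitarymxP.
have := PAP 1%:M; rewrite mulmx1 => ->.
by apply/matrixP => i j; rewrite !mxE (inj_eq fi).
Qed.

(** * Block-diagonal matrices *)

Section BlockDiagonal.
Variable C : numClosedFieldType.

(* The index set of the blocks is any finite type T; sigma tells in which block,
   and where in this block, an index lies. *)
Definition dg (T : finType) N d (sigma : 'I_N -> T * 'I_d) (A : T -> 'M[C]_d) :
    'M[C]_N :=
  \matrix_(i, j) if (sigma i).1 == (sigma j).1
                 then A (sigma i).1 (sigma i).2 (sigma j).2 else 0.

Section Sigma.
Variables (T : finType) (N d : nat) (sigma : 'I_N -> T * 'I_d).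

Lemma eq_dg A B : A =1 B -> dg sigma A = dg sigma B.
Proof. by move=> AB; apply/matrixP => i j; rewrite !mxE AB. Qed.

Lemma dg_adj A : (dg sigma A)^t* = dg sigma (fun t => (A t)^t*).
Proof.
apply/matrixP => i j; rewrite !mxE eq_sym; case: eqP => [<-|_].
  by rewrite ?mxE.
by rewrite rmorph0.
Qed.

Lemma dg_linear (a : C) A B :
  dg sigma (fun t => a *: A t + B t) = a *: dg sigma A + dg sigma B.
Proof.
apply/matrixP => i j; rewrite !mxE; case: eqP => _; first by rewrite ?mxE.
by rewrite mulr0 addr0.
Qed.

Lemma dgB A B : dg sigma (fun t => A t - B t) = dg sigma A - dg sigma B.
Proof.
apply/matrixP => i j; rewrite !mxE; case: eqP => _; first by rewrite ?mxE.
by rewrite subr0.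
Qed.

Hypothesis bs : bijective sigma.

Lemma reindex_dg (V : nmodType) (F : 'I_N -> V) (G : T -> 'I_d -> V) :
  (forall i, F i = G (sigma i).1 (sigma i).2) ->
  \sum_i F i = \sum_t \sum_(a < d) G t a.
Proof.
move=> FG; rewrite pair_big /= (reindex sigma) /=; last exact: onW_bij.
by apply: eq_bigr => i _; rewrite FG.
Qed.

Lemma dgM A B : dg sigma A *m dg sigma B = dg sigma (fun t => A t *m B t).
Proof.
apply/matrixP => i j; rewrite !mxE.
rewrite (@reindex_dg _ _ (fun t a =>
  (if (sigma i).1 == t then A (sigma i).1 (sigma i).2 a else 0) *
  (if t == (sigma j).1 then B t a (sigma j).2 else 0))); last first.
  by move=> l; rewrite !mxE.
rewrite (bigD1 (sigma i).1) //= [X in _ + X]big1 => [|t ti]; last first.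
  by apply: big1 => a _; rewrite eq_sym (negPf ti) mul0r.
rewrite addr0 eqxx; case: eqP => ij; first by rewrite ?mxE.
by apply: big1 => a _; rewrite mulr0.
Qed.

Lemma dg1 : dg sigma (fun=> 1%:M) = 1%:M.
Proof.
apply/matrixP => i j; rewrite !mxE -(inj_eq (bij_inj bs)).
by rewrite -[in RHS]pair_eqE /= /pair_eq; case: eqP.
Qed.

Lemma mxtrace_dg A : \tr (dg sigma A) = \sum_t \tr (A t).
Proof.
by rewrite /mxtrace (@reindex_dg _ _ (fun t a => A t a a)) // => i; rewrite !mxE eqxx.
Qed.

Lemma dg_unitary A : (forall t, A t \is unitarymx) -> dg sigma A \is unitarymx.
Proof.
move=> Au; apply/unitarymxP; rewrite dg_adj dgM -dg1; apply: eq_dg => t.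
exact/unitarymxP.
Qed.

Lemma dg_inj A B : dg sigma A = dg sigma B -> A =1 B.
Proof.
move=> AB t; apply/matrixP => a b; have [g sg gs] := bs.
have /matrixP/(_ (g (t, a)) (g (t, b))) := AB.
by rewrite !mxE !gs /= eqxx.
Qed.

End Sigma.

(** [P] depends on the three bijections and not on the blocks, so one constant unitary serves all
    points of a path and all elements of the algebra. *)
Lemma dg_reindex (T T' : finType) N d (sigma : 'I_N -> T * 'I_d)
    (sigma' : 'I_N -> T' * 'I_d) (h : T -> T') :
  bijective sigma -> bijective sigma' -> bijective h ->
  exists P : 'M[C]_N, P \is unitarymx /\
    forall A, dg sigma (A \o h) = P *m dg sigma' A *m P^t*.
Proof.
move=> bs [g' sg' gs'] bh.
have [|P [Pu PE]] := @perm_conj C N (fun i => g' (h (sigma i).1, (sigma i).2)).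
  move=> i j /(can_inj gs') [/(bij_inj bh) e1 e2]; apply: (bij_inj bs).
  by case: (sigma i) (sigma j) e1 e2 => ? ? [? ?] /= -> ->.
exists P; split=> // A; rewrite PE; apply/matrixP => i j.
by rewrite !mxE !gs' /= (inj_eq (bij_inj bh)).
Qed.

Lemma dg_dg (T1 T2 : finType) N M d (s1 : 'I_N -> T1 * 'I_M) (s2 : 'I_M -> T2 * 'I_d)
    (A : T1 -> T2 -> 'M[C]_d) :
  dg s1 (fun t => dg s2 (A t)) =
  dg (fun i => (((s1 i).1, (s2 (s1 i).2).1), (s2 (s1 i).2).2)) (fun t => A t.1 t.2).
Proof.
apply/matrixP => i j; rewrite !mxE /= -[in RHS]pair_eqE /=.
by case: eqP; rewrite ?mxE.
Qed.

Lemma dg_dg_bij (T1 T2 : finType) N M d (s1 : 'I_N -> T1 * 'I_M)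
    (s2 : 'I_M -> T2 * 'I_d) :
  bijective s1 -> bijective s2 -> bijective (fun i : 'I_N =>
    (((s1 i).1, (s2 (s1 i).2).1), (s2 (s1 i).2).2)).
Proof.
move=> [g1 sg1 gs1] [g2 sg2 gs2].
exists (fun x => g1 (x.1.1, g2 (x.1.2, x.2))) => [i|[[t1 t2] a]] /=.
  by rewrite -(sg1 i); congr (g1 _); rewrite sg1 -surjective_pairing sg2 -surjective_pairing.
by rewrite !gs1 /= !gs2.
Qed.

(** Trades the dependent block sizes and the cast of [diagonalized_by] for an indexing by a
    product. *)
Lemma mxdiag_dg k d N (e : (\sum_(i < k) d = N)%N) :
  exists sigma : 'I_N -> 'I_k * 'I_d, bijective sigma /\
    forall A : 'I_k -> 'M[C]_d, castmx (e, e) (\mxdiag_(i < k) A i) = dg sigma A.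
Proof.
case: _ / e; exists (fun i => (tagnat.sig1 i, tagnat.sig2 i)); split.
  exists (fun x : 'I_k * 'I_d => @tagnat.Rank k (fun=> d) x.1 x.2) => [i|[i a]] /=.
    exact: tagnat.sig2K.
  by congr pair; [exact: tagnat.Rank1K|apply: val_inj; rewrite /= tagnat.Rank2K].
move=> A; rewrite castmx_id; apply/matrixP => i j; rewrite !mxE /=.
by case: eqP => // e; rewrite ?mxE // conform_mx_id.
Qed.

(** With [tens1mx_dg], both endpoint conditions become: the value is block diagonal with s equal
    blocks. The two ends can then share one argument. *)
Lemma tensmx1_dg m n (A : 'M[C]_m) : A *t (1%:M : 'M[C]_n) =
  dg (fun i => ((mxtens_unindex i).2, (mxtens_unindex i).1)) (fun=> A).
Proof.
apply/matrixP => i j; rewrite [LHS]mxE [RHS]mxE /= mxE.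
by case: eqP => _; rewrite ?mulr1 ?mulr0.
Qed.

Lemma tens1mx_dg m n (B : 'M[C]_n) : (1%:M : 'M[C]_m) *t B =
  dg (@mxtens_unindex m n) (fun=> B).
Proof.
apply/matrixP => i j; rewrite [LHS]mxE [RHS]mxE /= mxE.
by case: eqP => _; rewrite ?mul1r ?mul0r.
Qed.

End BlockDiagonal.

Lemma mxtens_unindex_bij m n : bijective (@mxtens_unindex m n).
Proof. exists (@mxtens_index m n); [exact: mxtens_unindexK|exact: mxtens_indexK]. Qed.

Lemma mxtens_swap_bij m n : bijective (fun i : 'I_(m * n) =>
  ((mxtens_unindex i).2, (mxtens_unindex i).1)).
Proof.
exists (fun x => mxtens_index (x.2, x.1)) => [i|[x y]].
  by rewrite -[RHS]mxtens_unindexK.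
by rewrite mxtens_indexK.
Qed.

(** * The real-valued modulus *)

Section Modulus.
Variable R : realType.
Local Notation C := (complexes R).

Definition modulus (z : C) : R := complex.Re `|z|.

Lemma modulusE (z : C) : (modulus z)%:C%C = `|z| :> C.
Proof. by rewrite /modulus RRe_real // normr_real. Qed.

Lemma modulus_ge0 z : 0 <= modulus z.
Proof. by rewrite -lecR modulusE; exact: (normr_ge0 z). Qed.

Lemma modulusD x y : modulus (x + y) <= modulus x + modulus y.
Proof. by rewrite -lecR rmorphD /= !modulusE ler_normD. Qed.

Lemma modulusM x y : modulus (x * y) = modulus x * modulus y.
Proof. by apply: complexI; rewrite rmorphM /= !modulusE normrM. Qed.

Lemma modulusR (x : R) : modulus x%:C%C = `|x|.
Proof. by apply: complexI; rewrite modulusE normc_def /= expr0n addr0 sqrtr_sqr. Qed.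

Lemma modulus0 : modulus 0 = 0.
Proof. by rewrite (modulusR 0) normr0. Qed.

Lemma modulus1 : modulus 1 = 1.
Proof. by rewrite (modulusR 1) normr1. Qed.

Lemma modulusN z : modulus (- z) = modulus z.
Proof. by apply: complexI; rewrite !modulusE normrN. Qed.

Lemma modulus_eq0 z : modulus z = 0 -> z = 0.
Proof.
by move=> z0; apply/eqP; rewrite -normr_eq0 -modulusE z0.
Qed.

Lemma modulus_sqr z : ((modulus z ^+ 2)%:C%C : C) = z * z^*.
Proof. by rewrite rmorphXn /= modulusE normCK. Qed.

Lemma modulus_sum (I : finType) (F : I -> C) :
  modulus (\sum_i F i) <= \sum_i modulus (F i).
Proof.
elim/big_rec2: _ => [|i x y _ h]; first by rewrite modulus0.
by apply: le_trans (modulusD _ _) _; rewrite lerD2l.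
Qed.

End Modulus.

(** * Cauchy-Schwarz and Minkowski inequalities *)

Section Minkowski.
Variables (R : realType) (I : finType).
Implicit Types a b : I -> R.

Let sqr_sqrt_sum a : Num.sqrt (\sum_i a i ^+ 2) ^+ 2 = \sum_i a i ^+ 2.
Proof. by rewrite sqr_sqrtr // sumr_ge0 // => i _; exact: sqr_ge0. Qed.

Lemma cauchy_schwarz a b :
  \sum_i a i * b i <= Num.sqrt (\sum_i a i ^+ 2) * Num.sqrt (\sum_i b i ^+ 2).
Proof.
set A := Num.sqrt _; set B := Num.sqrt _.
have [sA sB] := (sqr_sqrt_sum a, sqr_sqrt_sum b); rewrite -/A -/B in sA sB.
have z (c : I -> R) : \sum_i c i ^+ 2 = 0 -> forall i, c i = 0.
  move=> c0 i; apply/eqP; rewrite -sqrf_eq0; apply/eqP.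
  have /psumr_eq0P : forall i, true -> 0 <= c i ^+ 2 by move=> *; exact: sqr_ge0.
  by move=> /(_ c0 i isT).
have [A0|A0] := eqVneq A 0.
  by rewrite A0 mul0r big1 // => i _; rewrite (z a) ?mul0r // -sA A0 expr0n.
have [B0|B0] := eqVneq B 0.
  by rewrite B0 mulr0 big1 // => i _; rewrite (z b) ?mulr0 // -sB B0 expr0n.
have AB : 0 < A * B by rewrite mulr_gt0 // lt0r ?A0 ?B0 sqrtr_ge0.
(* Expanded, this sum is 2 A B times the difference of the two sides of the claim, and A B > 0. *)
have : 0 <= \sum_i (B * a i - A * b i) ^+ 2 by apply: sumr_ge0 => i _; exact: sqr_ge0.
have -> : \sum_i (B * a i - A * b i) ^+ 2 =
    B ^+ 2 * A ^+ 2 + A ^+ 2 * B ^+ 2 - 2 * (A * B) * \sum_i a i * b i.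
  transitivity (\sum_i (B ^+ 2 * a i ^+ 2 + A ^+ 2 * b i ^+ 2
                        - 2 * (A * B) * (a i * b i))).
    by apply: eq_bigr => i _; ring.
  by rewrite sumrB big_split /= -!mulr_sumr -sA -sB.
move=> h; rewrite -(ler_pM2l AB); nra.
Qed.

Lemma minkowski a b : Num.sqrt (\sum_i (a i + b i) ^+ 2) <=
  Num.sqrt (\sum_i a i ^+ 2) + Num.sqrt (\sum_i b i ^+ 2).
Proof.
set A := Num.sqrt (\sum_i a i ^+ 2); set B := Num.sqrt (\sum_i b i ^+ 2).
have A0 : 0 <= A by exact: sqrtr_ge0.
have B0 : 0 <= B by exact: sqrtr_ge0.
rewrite -(@ler_pXn2r _ 2) ?nnegrE ?addr_ge0 ?sqrtr_ge0 //.
rewrite sqr_sqrtr; last by apply: sumr_ge0 => i _; exact: sqr_ge0.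
have [sA sB] := (sqr_sqrt_sum a, sqr_sqrt_sum b); rewrite -/A -/B in sA sB.
have -> : \sum_i (a i + b i) ^+ 2 = A ^+ 2 + B ^+ 2 + (\sum_i a i * b i) *+ 2.
  rewrite sA sB -sumrMnl -!big_split /=; apply: eq_bigr => i _.
  by rewrite sqrrD addrAC.
by have : \sum_i a i * b i <= A * B := cauchy_schwarz a b; rewrite sqrrD; lra.
Qed.

End Minkowski.

(** * The operator norm, its unitary invariance and its value on block-diagonal matrices *)

Section OperatorNorm.
Variable R : realType.
Local Notation C := (complexes R).

Lemma l2norm_ge0 n (v : 'cV[C]_n) : 0 <= l2norm v.
Proof. exact: sqrtr_ge0. Qed.

Lemma l2norm_sqr n (v : 'cV[C]_n) : l2norm v ^+ 2 = \sum_j modulus (v j 0) ^+ 2.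
Proof. by rewrite sqr_sqrtr // sumr_ge0 // => j _; exact: sqr_ge0. Qed.

Lemma l2normD n (u v : 'cV[C]_n) : l2norm (u + v) <= l2norm u + l2norm v.
Proof.
apply: le_trans (minkowski (fun j => modulus (u j 0)) (fun j => modulus (v j 0))).
rewrite ler_wsqrtr // ler_sum // => j _.
by rewrite mxE ler_pXn2r ?nnegrE ?modulus_ge0 ?addr_ge0 ?modulus_ge0 ?modulusD.
Qed.

Lemma l2normZ n (a : C) (v : 'cV[C]_n) : l2norm (a *: v) = modulus a * l2norm v.
Proof.
apply/eqP; rewrite -(@eqrXn2 _ 2) ?mulr_ge0 ?l2norm_ge0 ?modulus_ge0 //.
rewrite exprMn !l2norm_sqr mulr_sumr; apply/eqP; apply: eq_bigr => j _.
by rewrite mxE modulusM exprMn.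
Qed.

Lemma l2norm0 n : l2norm (0 : 'cV[C]_n) = 0.
Proof. by rewrite -(scale0r (0 : 'cV[C]_n)) l2normZ modulus0 mul0r. Qed.

Lemma l2norm_eq0 n (v : 'cV[C]_n) : l2norm v = 0 -> v = 0.
Proof.
move=> v0; apply/matrixP => i j; rewrite (ord1 j) mxE; apply: modulus_eq0.
apply/eqP; rewrite -sqrf_eq0; apply/eqP.
have /psumr_eq0P : forall i, true -> 0 <= modulus (v i 0) ^+ 2.
  by move=> *; exact: sqr_ge0.
by move=> /(_ _ i isT) -> //; rewrite -l2norm_sqr v0 expr0n.
Qed.

Lemma modulus_le_l2norm n (v : 'cV[C]_n) i : modulus (v i 0) <= l2norm v.
Proof.
rewrite -(@ler_pXn2r _ 2) ?nnegrE ?l2norm_ge0 ?modulus_ge0 // l2norm_sqr.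
by rewrite (bigD1 i) //= lerDl sumr_ge0 // => j _; exact: sqr_ge0.
Qed.

Lemma l2norm_le_sum n (v : 'cV[C]_n) : l2norm v <= \sum_i modulus (v i 0).
Proof.
have s0 : 0 <= \sum_i modulus (v i 0) by apply: sumr_ge0 => i _; exact: modulus_ge0.
rewrite -(@ler_pXn2r _ 2) ?nnegrE ?l2norm_ge0 // l2norm_sqr [leRHS]expr2 mulr_suml.
apply: ler_sum => i _; rewrite expr2 ler_wpM2l ?modulus_ge0 //.
by rewrite (bigD1 i) //= lerDl sumr_ge0 // => j _; exact: modulus_ge0.
Qed.

Lemma l2norm_mulmx_le n (M : 'M[C]_n) (v : 'cV[C]_n) :
  l2norm (M *m v) <= (\sum_i \sum_j modulus (M i j)) * l2norm v.
Proof.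
apply: le_trans (l2norm_le_sum _) _; rewrite mulr_suml; apply: ler_sum => i _.
rewrite mxE; apply: le_trans (modulus_sum _) _; rewrite mulr_suml.
apply: ler_sum => j _; rewrite modulusM ler_wpM2l ?modulus_ge0 //.
exact: modulus_le_l2norm.
Qed.

Lemma opnorm_le n (M : 'M[C]_n) (e : R) : 0 <= e ->
  (forall v, l2norm (M *m v) <= e * l2norm v) -> opnorm M <= e.
Proof.
move=> e0 Me; apply: ge_sup.
  by exists 0, 0 => //=; rewrite ?mulmx0 l2norm0.
move=> _ [v /= v1 <-]; apply: le_trans (Me v) _.
by rewrite -[leRHS]mulr1 ler_wpM2l.
Qed.

Lemma opnorm_has_ub n (M : 'M[C]_n) :
  has_ubound [set l2norm (M *m v) | v in [set v : 'cV[C]_n | l2norm v <= 1]].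
Proof.
exists (\sum_i \sum_j modulus (M i j)) => _ [x /= x1 <-].
apply: le_trans (l2norm_mulmx_le _ _) _; rewrite -[leRHS]mulr1 ler_wpM2l //.
by apply: sumr_ge0 => i _; apply: sumr_ge0 => j _; exact: modulus_ge0.
Qed.

Lemma opnorm_ub n (M : 'M[C]_n) v : l2norm (M *m v) <= opnorm M * l2norm v.
Proof.
have sub w : l2norm w <= 1 -> l2norm (M *m w) <= opnorm M.
  by move=> w1; apply: ub_le_sup; [exact: opnorm_has_ub|exists w].
have [/l2norm_eq0 ->|v0] := eqVneq (l2norm v) 0.
  by rewrite mulmx0 l2norm0 mulr0.
have vp : 0 < l2norm v by rewrite lt0r v0 l2norm_ge0.
rewrite -ler_pdivrMr // mulrC.
have mV : modulus ((l2norm v)^-1)%:C%C = (l2norm v)^-1.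
  by rewrite modulusR ger0_norm // invr_ge0 l2norm_ge0.
rewrite -{1}mV -l2normZ scalemxAr; apply: sub.
by rewrite l2normZ mV mulVf.
Qed.

Lemma opnorm_ge0 n (M : 'M[C]_n) : 0 <= opnorm M.
Proof.
apply: ub_le_sup; first exact: opnorm_has_ub.
by exists 0; rewrite /= ?mulmx0 l2norm0.
Qed.

#[global] Opaque opnorm l2norm modulus.

Lemma opnormD n (A B : 'M[C]_n) : opnorm (A + B) <= opnorm A + opnorm B.
Proof.
apply: opnorm_le => [|v]; first by rewrite addr_ge0 ?opnorm_ge0.
rewrite mulmxDl mulrDl; apply: le_trans (l2normD _ _) _.
by rewrite lerD ?opnorm_ub.
Qed.

Lemma opnormM n (A B : 'M[C]_n) : opnorm (A *m B) <= opnorm A * opnorm B.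
Proof.
apply: opnorm_le => [|v]; first by rewrite mulr_ge0 ?opnorm_ge0.
rewrite -mulmxA -mulrA; apply: le_trans (opnorm_ub _ _) _.
by rewrite ler_wpM2l ?opnorm_ge0 ?opnorm_ub.
Qed.

Lemma opnormZ n (a : C) (A : 'M[C]_n) : opnorm (a *: A) <= modulus a * opnorm A.
Proof.
apply: opnorm_le => [|v]; first by rewrite mulr_ge0 ?opnorm_ge0 ?modulus_ge0.
by rewrite -scalemxAl l2normZ -mulrA ler_wpM2l ?modulus_ge0 ?opnorm_ub.
Qed.

Lemma opnormN n (A : 'M[C]_n) : opnorm (- A) = opnorm A.
Proof.
have h (B : 'M[C]_n) : opnorm (- B) <= opnorm B.
  by rewrite -scaleN1r; apply: le_trans (opnormZ _ _) _; rewrite modulusN modulus1 mul1r.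
apply: le_anti; apply/andP; split; first exact: h.
have hA := h (- A); rewrite opprK in hA; exact: hA.
Qed.

Lemma opnormBC n (A B : 'M[C]_n) : opnorm (A - B) = opnorm (B - A).
Proof. by rewrite -opnormN opprB. Qed.

Lemma opnorm0 n : opnorm (0 : 'M[C]_n) = 0.
Proof.
by apply/eqP; rewrite eq_le opnorm_ge0 andbT opnorm_le // => v; rewrite mul0mx l2norm0 mul0r.
Qed.

Lemma opnorm_dist n (A B D : 'M[C]_n) :
  opnorm (A - B) <= opnorm (A - D) + opnorm (D - B).
Proof. by rewrite -(subrK D A) -addrA; apply: le_trans (opnormD _ _) _; rewrite addrK. Qed.

Lemma opnorm_le_sum n (M : 'M[C]_n) : opnorm M <= \sum_i \sum_j modulus (M i j).
Proof.
apply: opnorm_le => [|v]; last exact: l2norm_mulmx_le.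
by apply: sumr_ge0 => i _; apply: sumr_ge0 => j _; exact: modulus_ge0.
Qed.

Lemma modulus_le_opnorm n (M : 'M[C]_n) i j : modulus (M i j) <= opnorm M.
Proof.
have -> : M i j = (M *m delta_mx j 0 : 'cV_n) i 0.
  rewrite mxE (bigD1 j) //= big1 => [|l lj]; first by rewrite mxE !eqxx mulr1 addr0.
  by rewrite mxE (negPf lj) mulr0.
apply: le_trans (modulus_le_l2norm _ _) _; apply: le_trans (opnorm_ub _ _) _.
rewrite -[leRHS]mulr1 ler_wpM2l ?opnorm_ge0 //.
have E : \sum_i modulus ((delta_mx j 0 : 'cV[C]_n) i 0) = 1.
  rewrite (bigD1 j) //= big1 => [|l lj]; first by rewrite mxE !eqxx modulus1 addr0.
  by rewrite mxE (negPf lj) modulus0.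
by rewrite -[leRHS]E; exact: l2norm_le_sum.
Qed.

Lemma l2norm_unitary n (u : 'M[C]_n) v : u \is unitarymx -> l2norm (u *m v) = l2norm v.
Proof.
move=> uu; apply/eqP; rewrite -(@eqrXn2 _ 2) ?l2norm_ge0 //; apply/eqP.
have sq (w : 'cV[C]_n) : ((l2norm w ^+ 2)%:C%C : C) = (w^t* *m w) 0 0.
  rewrite l2norm_sqr raddf_sum /= mxE; apply: eq_bigr => j _.
  by rewrite modulus_sqr !mxE mulrC.
apply: complexI; rewrite [LHS]sq [RHS]sq adjmxM -mulmxA [u^t* *m _]mulmxA.
by rewrite unitaryVmx // mul1mx.
Qed.

Lemma opnorm_unitaryM n (u A : 'M[C]_n) : u \is unitarymx -> opnorm (u *m A) = opnorm A.
Proof.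
move=> uu; have h (w B : 'M[C]_n) : w \is unitarymx -> opnorm (w *m B) <= opnorm B.
  move=> wu; apply: opnorm_le => [|v]; first exact: opnorm_ge0.
  by rewrite -mulmxA l2norm_unitary // opnorm_ub.
apply: le_anti; apply/andP; split; first exact: (h _ _ uu).
have hA := h _ (u *m A) (unitarymx_adj uu).
by rewrite mulmxA (unitaryVmx uu) mul1mx in hA; exact: hA.
Qed.

Lemma opnormM_unitary n (u A : 'M[C]_n) : u \is unitarymx -> opnorm (A *m u) = opnorm A.
Proof.
move=> uu; have h (w B : 'M[C]_n) : w \is unitarymx -> opnorm (B *m w) <= opnorm B.
  move=> wu; apply: opnorm_le => [|v]; first exact: opnorm_ge0.
  by rewrite -mulmxA; apply: le_trans (opnorm_ub _ _) _; rewrite l2norm_unitary.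
apply: le_anti; apply/andP; split; first exact: (h _ _ uu).
have hA := h _ (A *m u) (unitarymx_adj uu).
by rewrite -mulmxA (unitarymxV uu) mulmx1 in hA; exact: hA.
Qed.

Lemma opnorm_conj n (u A : 'M[C]_n) : u \is unitarymx ->
  opnorm (u^t* *m A *m u) = opnorm A.
Proof. by move=> uu; rewrite (opnormM_unitary _ uu) (opnorm_unitaryM _ (unitarymx_adj uu)). Qed.

Section Blocks.
Variables (T : finType) (N d : nat) (sigma : 'I_N -> T * 'I_d).
Hypothesis bs : bijective sigma.

Let blk (v : 'cV[C]_N) (g : T * 'I_d -> 'I_N) t : 'cV[C]_d := \col_a v (g (t, a)) 0.

Lemma opnorm_dg (A : T -> 'M[C]_d) e : 0 <= e -> (forall t, opnorm (A t) <= e) ->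
  opnorm (dg sigma A) <= e.
Proof.
move=> e0 Ae; have [g sg gs] := bs.
have blkE v : l2norm v ^+ 2 = \sum_t l2norm (blk v g t) ^+ 2.
  rewrite l2norm_sqr (reindex_dg bs (G := fun t a => modulus (v (g (t, a)) 0) ^+ 2)).
    by apply: eq_bigr => t _; rewrite l2norm_sqr; apply: eq_bigr => a _; rewrite mxE.
  by move=> i; rewrite -surjective_pairing sg.
have blkA v t : blk (dg sigma A *m v) g t = A t *m blk v g t.
  apply/matrixP => a j; rewrite (ord1 j) !mxE.
  rewrite (reindex_dg bs (G := fun s b =>
     (if t == s then A t a b else 0) * v (g (s, b)) 0)); last first.
    by move=> i; rewrite !mxE gs /= -surjective_pairing sg.
  rewrite (bigD1 t) //= [X in _ + X]big1 => [|s st]; last first.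
    by apply: big1 => b _; rewrite eq_sym (negPf st) mul0r.
  by rewrite addr0; apply: eq_bigr => b _; rewrite eqxx mxE.
apply: opnorm_le => // v; rewrite -(@ler_pXn2r _ 2) ?nnegrE ?mulr_ge0 ?l2norm_ge0 //.
rewrite exprMn blkE (blkE v) mulr_sumr; apply: ler_sum => t _.
rewrite blkA -exprMn ler_pXn2r ?nnegrE ?mulr_ge0 ?l2norm_ge0 //.
by apply: le_trans (opnorm_ub _ _) _; rewrite ler_wpM2r ?l2norm_ge0.
Qed.

Lemma opnorm_dg_ge (A : T -> 'M[C]_d) t : opnorm (A t) <= opnorm (dg sigma A).
Proof.
have [g sg gs] := bs; apply: opnorm_le => [|w]; first exact: opnorm_ge0.
pose v : 'cV[C]_N := \col_i (if (sigma i).1 == t then w (sigma i).2 0 else 0).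
have nv : l2norm v = l2norm w.
  apply/eqP; rewrite -(@eqrXn2 _ 2) ?l2norm_ge0 //; apply/eqP; rewrite !l2norm_sqr.
  rewrite (reindex_dg bs (G := fun s b => modulus (if s == t then w b 0 else 0) ^+ 2)).
    rewrite (bigD1 t) //= [X in _ + X]big1 => [|s st].
      by rewrite addr0 eqxx.
    by apply: big1 => b _; rewrite (negPf st) modulus0 expr0n.
  by move=> i; rewrite mxE.
rewrite -nv; apply: le_trans (opnorm_ub _ _).
rewrite -(@ler_pXn2r _ 2) ?nnegrE ?l2norm_ge0 // !l2norm_sqr.
have E a : (A t *m w) a 0 = (dg sigma A *m v) (g (t, a)) 0.
  rewrite !mxE [RHS](reindex_dg bs (G := fun s b =>
     (if t == s then A t a b else 0) * (if s == t then w b 0 else 0))); last first.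
    by move=> i; rewrite !mxE gs.
  rewrite (bigD1 t) //= [X in _ + X]big1 => [|s st]; last first.
    by apply: big1 => b _; rewrite (negPf st) mulr0.
  by rewrite addr0; apply: eq_bigr => b _; rewrite eqxx.
under eq_bigr do rewrite E.
rewrite [leRHS](reindex_dg bs (G := fun s a => modulus ((dg sigma A *m v) (g (s, a)) 0) ^+ 2)).
  rewrite [leRHS](bigD1 t) //= lerDl sumr_ge0 // => s _; apply: sumr_ge0 => a _.
  exact: sqr_ge0.
by move=> i; rewrite -surjective_pairing sg.
Qed.

End Blocks.

End OperatorNorm.

(** * Continuity and uniform continuity on the unit interval *)

Section IntervalTopology.
Variable R : realType.
Local Notation C := (complexes R).
Local Notation I := (unit_interval R).

Lemma ui_itv (x : I) : 0 <= set_val x <= 1.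
Proof. by have := set_valP x; rewrite /= in_itv. Qed.

Lemma ui_exists (x : R) : 0 <= x <= 1 -> exists y : I, set_val y = x.
Proof.
move=> x01; have xI : x \in (`[0, 1]%classic : set R) by rewrite inE /= in_itv.
by exists (SigSub xI).
Qed.

Lemma ui_inj : injective (set_val : I -> R).
Proof. exact: val_inj. Qed.

(** Heine-Cantor with an abstract [D x y] in place of the distance of two values; one compactness
    argument then serves matrix-valued paths and self-maps of the interval. *)
Lemma ui_unif (D : I -> I -> R) :
  (forall (a : I) (e : R), 0 < e -> exists2 d : R, 0 < d &
     forall y : I, `|set_val a - set_val y| < d -> D a y < e) ->
  (forall a x y, D x y <= D a x + D a y) ->
  forall e : R, 0 < e -> exists2 d : R, 0 < d &
    forall x y : I, `|set_val x - set_val y| < d -> D x y < e.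
Proof.
move=> Dc Dt e e0.
have := @segment_compact R 0 1; rewrite compact_near_coveringP.
move=> /(_ R (at_right 0) (fun d x => forall a b : I, set_val a = x ->
  `|set_val a - set_val b| < d -> D a b < e)) H.
have {H}/(H _) : forall x : R, `[0, 1]%classic x ->
    \forall x' \near x & i \near 0^'+, forall a b : I, set_val a = x' ->
      `|set_val a - set_val b| < i -> D a b < e.
  move=> x /=; rewrite in_itv /= => /ui_exists[a <-].
  have [d d0 Dd] := Dc a (e / 2) (divr_gt0 e0 (ltr0Sn R 1)).
  exists ([set y | `|set_val a - y| < d / 2], [set i | i < d / 2]).
    split => /=; first by exists (d / 2) => //=; rewrite divr_gt0.
    by apply: nbhs_right_lt; rewrite divr_gt0.
  move=> [y i] /= [ya id] u v uy uv.
  apply: le_lt_trans (Dt a _ _) _; rewrite [e]splitr; apply: ltrD; apply: Dd.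
    by rewrite uy; lra.
  have := ler_distD (set_val u) (set_val a) (set_val v); rewrite uy in uv *; lra.
move=> H; have [d [/= d0 Hd]] := filter_ex (filterI (nbhs_right_gt (0 : R)) H).
exists d => // x y xy; apply: (Hd (set_val x)) xy => //=.
by rewrite in_itv /= ui_itv.
Qed.

Lemma ui_nbhs (a : I) (P : set I) : nbhs a P <->
  exists2 d : R, 0 < d & forall y : I, `|set_val a - set_val y| < d -> P y.
Proof.
split=> [/nbhs_ballP[d d0 dP]|[d d0 dP]].
  by exists d => // y ya; apply: dP.
by apply/nbhs_ballP; exists d => // y ya; apply: dP.
Qed.

(** The operator norm lies between the modulus of each entry and the sum of all these moduli, so it
    induces the entrywise topology. *)
Lemma mx_contP n (f : I -> 'M[C]_n) : continuous f <->
  forall (a : I) (e : R), 0 < e -> exists2 d : R, 0 < d &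
     forall y : I, `|set_val a - set_val y| < d -> opnorm (f a - f y) < e.
Proof.
split=> [/mx_continuousP cf a e e0|cf].
  (* The successor covers n = 0 and leaves room for a strict inequality. *)
  pose e' : R := e / (n * n).+1%:R.
  have e'0 : 0 < e' by rewrite divr_gt0.
  have : \forall y \near a, forall ij : 'I_n * 'I_n,
      modulus (f a ij.1 ij.2 - f y ij.1 ij.2) < e'.
    apply: (@filter_forall _ _ (fun (ij : 'I_n * 'I_n) y =>
      modulus (f a ij.1 ij.2 - f y ij.1 ij.2) < e') (nbhs a) (nbhs_filter a)).
    move=> -[i j] /=.
    have /cvgrPdist_lt/(_ (e'%:C)%C) := cf i j a.
    rewrite ltcR => /(_ e'0); apply: filterS => y /=.
    by rewrite -modulusE ltcR.
  move=> /ui_nbhs[d d0 dP]; exists d => // y /dP yP.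
  apply: le_lt_trans (opnorm_le_sum _) _.
  apply: (@le_lt_trans _ _ (\sum_(i < n) \sum_(j < n) e')).
    apply: ler_sum => i _; apply: ler_sum => j _; rewrite !mxE.
    exact: ltW (yP (i, j)).
  rewrite !sumr_const !card_ord -mulrnA -[X in X < _]mulr_natr /e'.
  by rewrite mulrAC ltr_pdivrMr // ltr_pM2l // ltr_nat.
apply/mx_continuousP => i j a; apply/(cvgrPdist_lt (FF := nbhs_filter a)) => e e0.
have eR : e = ((complex.Re e)%:C)%C.
  by rewrite RRe_real // ger0_real // ltW.
have : 0 < complex.Re e by rewrite -ltcR -eR.
move=> /(cf a)[d d0 dP]; apply/ui_nbhs; exists d => // y /dP yP.
rewrite eR -modulusE ltcR; apply: le_lt_trans yP.
by have := modulus_le_opnorm (f a - f y) i j; rewrite !mxE.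
Qed.

Lemma mx_cont_unif n (f : I -> 'M[C]_n) : continuous f -> forall e : R, 0 < e ->
  exists2 d : R, 0 < d &
    forall x y : I, `|set_val x - set_val y| < d -> opnorm (f x - f y) < e.
Proof.
move=> /mx_contP cf; apply: ui_unif => // a x y.
by rewrite (opnormBC (f a) (f x)) opnorm_dist.
Qed.

Lemma ui_contP (f : I -> I) : continuous f <->
  forall (a : I) (e : R), 0 < e -> exists2 d : R, 0 < d &
     forall y : I, `|set_val a - set_val y| < d -> `|set_val (f a) - set_val (f y)| < e.
Proof.
split=> [cf a e e0|cf a].
  have /ui_nbhs[d d0 dP] : \forall y \near a, ball (f a) e (f y).
    by apply: cf; apply: nbhsx_ballx.
  by exists d.
move=> P /ui_nbhs[e e0 eP]; have [d d0 dP] := cf a e e0.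
by apply/ui_nbhs; exists d => // y /dP/eP.
Qed.

Lemma ui_cont_unif (f : I -> I) : continuous f -> forall e : R, 0 < e ->
  exists2 d : R, 0 < d &
    forall x y : I, `|set_val x - set_val y| < d -> `|set_val (f x) - set_val (f y)| < e.
Proof.
move=> /ui_contP cf; apply: ui_unif => // a x y.
by rewrite (distrC (set_val (f a))) ler_distD.
Qed.

(** Going from 0 in steps on which f varies by less than 1, the norm grows by at most 1 at each
    step. *)
Lemma mx_cont_bounded n (f : I -> 'M[C]_n) : continuous f ->
  exists M, forall t, opnorm (f t) <= M.
Proof.
move=> /mx_cont_unif /(_ 1 ltr01)[d d0 dP].
have [m dm] : exists m : nat, d^-1 < m.+1%:R.
  exists (Num.truncn d^-1); have := truncn_itv (ltW (_ : 0 < d^-1)).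
  by rewrite invr_gt0 => /(_ d0)/andP[].
have H k : forall t : I, set_val t * m.+1%:R <= k%:R ->
    opnorm (f t) <= opnorm (f (ui0 R)) + k%:R.
  elim: k => [|k IH] t tk.
    have -> : t = ui0 R.
      apply: ui_inj => /=; apply/eqP; rewrite eq_le.
      have /andP[-> _] := ui_itv t; rewrite andbT.
      by rewrite -(@ler_pM2r _ m.+1%:R) ?mul0r.
    by rewrite addr0.
  have [tk'|tk'] := leP (set_val t * m.+1%:R) k%:R.
    by apply: le_trans (IH t tk') _; rewrite lerD2l ler_nat.
  have [s sE] : exists s : I, set_val s = k%:R / m.+1%:R.
    apply: ui_exists; rewrite divr_ge0 //= ler_pdivrMr // mul1r.
    have /andP[_ t1] := ui_itv t.
    have : set_val t * m.+1%:R <= 1 * m.+1%:R by rewrite ler_wpM2r.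
    by rewrite mul1r; lra.
  have := IH s; rewrite sE divfK ?pnatr_eq0 // lexx => /(_ isT) fs.
  have st : `|set_val t - set_val s| < d.
    rewrite sE ger0_norm ?subr_ge0 ?ler_pdivrMr ?ltW //.
    rewrite -(@ltr_pM2r _ m.+1%:R) // mulrBl divfK ?pnatr_eq0 //.
    have : 1 < d * m.+1%:R by rewrite -ltr_pdivrMl // mulr1.
    by apply: le_lt_trans; rewrite lerBlDl natr1.
  have h1 := dP t s st; have h2 := opnormD (f t - f s) (f s).
  rewrite subrK in h2; move: h1 h2 fs; rewrite -natr1; clear.
  move: (opnorm (f t - f s)) (opnorm (f t)) (opnorm (f s)) (opnorm (f (ui0 R))) k%:R.
  by move=> *; lra.
exists (opnorm (f (ui0 R)) + m.+1%:R) => t; apply: H.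
by have /andP[_ t1] := ui_itv t; rewrite -[leRHS]mul1r ler_wpM2r.
Qed.

End IntervalTopology.

(** * Paths of unitaries *)

Section UnitaryPath.
Variable R : realType.
Local Notation C := (complexes R).

Lemma unimodular_angle (z : C) : modulus z = 1 ->
  exists a : R, z = (cos a +i* sin a)%C.
Proof.
case: z => x y z1.
have xy : x ^+ 2 + y ^+ 2 = 1.
  have := modulus_sqr (x +i* y)%C; rewrite z1 expr1n => /(congr1 (@complex.Re R)).
  by rewrite /= => ->; rewrite mulrN opprK !expr2.
have x1 : -1 <= x <= 1 by apply/andP; split; nra.
have sx : sin (acos x) = `|y|.
  by rewrite sin_acos // -sqrtr_sqr; congr Num.sqrt; lra.
have [y0|y0] := leP 0 y.
  by exists (acos x); rewrite acosK ?in_itv //= sx ger0_norm.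
by exists (- acos x); rewrite cosN sinN acosK ?in_itv //= sx ltr0_norm // opprK.
Qed.

Lemma modulus_cis (a : R) : modulus (cos a +i* sin a)%C = 1.
Proof.
apply/eqP; rewrite -(@eqrXn2 _ 2) ?modulus_ge0 ?ler01 // expr1n; apply/eqP.
apply: complexI; rewrite [LHS]modulus_sqr; apply/eqP; rewrite eq_complex /=.
rewrite !mulrN opprK -!expr2 cos2Dsin2 eqxx /=.
by rewrite (mulrC (sin a)) addNr.
Qed.

(* By the spectral theorem; the angles depend on the eigenvalues only, hence the
   path stays in the bicommutant of s. *)
Lemma unitary_path n (s : 'M[C]_n) : s \is unitarymx ->
  exists h : R -> 'M[C]_n, [/\ h 0 = 1%:M, h 1 = s,
    forall t, h t \is unitarymx,
    forall a e : R, 0 < e -> exists2 d : R, 0 < d &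
      forall y : R, `|a - y| < d -> opnorm (h a - h y) < e &
    forall X t, X *m s = s *m X -> X *m h t = h t *m X].
Proof.
move=> su; pose P := spectralmx s; pose l := spectral_diag s.
have Pu : P \is unitarymx by exact: spectral_unitarymx.
have PK (A B : 'M[C]_n) : (P^t* *m A *m P) *m (P^t* *m B *m P) = P^t* *m (A *m B) *m P.
  by rewrite -!mulmxA [P *m (P^t* *m _)]mulmxA (unitarymxV Pu) mul1mx.
have sE : s = P^t* *m diag_mx l *m P.
  rewrite /P -invmx_unitary //; apply/orthomx_spectralP/normalmxP.
  by rewrite (unitarymxV su) (unitaryVmx su).
have dE : P *m s *m P^t* = diag_mx l.
  by rewrite sE !mulmxA (unitarymxV Pu) mul1mx -mulmxA (unitarymxV Pu) mulmx1.
have l1 i : modulus (l 0 i) = 1.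
  have : diag_mx l *m (diag_mx l)^t* = 1%:M.
    rewrite -dE !adjmxM trmxCK !mulmxA -(mulmxA _ _ P) (unitaryVmx Pu) mulmx1.
    by rewrite -(mulmxA P) (unitarymxV su) mulmx1 (unitarymxV Pu).
  move=> /matrixP/(_ i i); rewrite mul_diag_mx !mxE !eqxx !mulr1n => e.
  apply/eqP; rewrite -(@eqrXn2 _ 2) ?modulus_ge0 ?ler01 // expr1n; apply/eqP.
  by apply: complexI; rewrite [LHS]modulus_sqr.
have /choice[th thE] : forall z : C, exists a : R, modulus z = 1 -> z = (cos a +i* sin a)%C.
  move=> z; have [/unimodular_angle[a za]|nz] := pselect (modulus z = 1); first by exists a.
  by exists 0.
pose g t (z : C) : C := (cos (t * th z) +i* sin (t * th z))%C.
pose D t : 'M[C]_n := diag_mx (\row_i g t (l 0 i)).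
exists (fun t => P^t* *m D t *m P); split.
- have -> : D 0 = 1%:M.
    apply/matrixP => i j; rewrite !mxE; case: eqP => // _.
    by rewrite !mulr1n /g mul0r cos0 sin0.
  by rewrite mulmx1 (unitaryVmx Pu).
- have -> : D 1 = diag_mx l; last by rewrite -sE.
  congr diag_mx; apply/rowP => i; by rewrite mxE /g mul1r -thE.
- move=> t; have Du : D t \is unitarymx.
    apply/unitarymxP/matrixP => i j; rewrite mul_diag_mx !mxE.
    case: (eqVneq j i) => [->|ij]; last by rewrite !mulr0n rmorph0 mulr0.
    by rewrite !mulr1n -modulus_sqr /g modulus_cis expr1n.
  exact: mul_unitarymx (mul_unitarymx (unitarymx_adj Pu) Du) Pu.
- move=> a e e0.
  pose e' : R := e / (n.*2).+1%:R.
  have e'0 : 0 < e' by rewrite divr_gt0.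
  have : \forall y \near a, forall i : 'I_n,
      `|cos (a * th (l 0 i)) - cos (y * th (l 0 i))| < e' /\
      `|sin (a * th (l 0 i)) - sin (y * th (l 0 i))| < e'.
    apply: (@filter_forall _ _ (fun (i : 'I_n) y =>
      `|cos (a * th (l 0 i)) - cos (y * th (l 0 i))| < e' /\
      `|sin (a * th (l 0 i)) - sin (y * th (l 0 i))| < e') (nbhs a) (nbhs_filter a)) => i.
    have cm : {for a, continuous (fun y : R => y * th (l 0 i))} by exact: mulrr_continuous.
    have cc : {for a, continuous (fun y : R => cos (y * th (l 0 i)))}.
      by apply: continuous_comp => //; exact: continuous_cos.
    have cs : {for a, continuous (fun y : R => sin (y * th (l 0 i)))}.
      by apply: continuous_comp => //; exact: continuous_sin.
    by apply: filterI; [move/cvgrPdist_lt: cc; apply|move/cvgrPdist_lt: cs; apply].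
  move=> /nbhs_ballP[d /= d0 dP]; exists d => // y /dP yP.
  rewrite -mulmxBl -mulmxBr (opnorm_conj _ Pu).
  apply: le_lt_trans (opnorm_le_sum _) _.
  apply: (@le_lt_trans _ _ (\sum_(i < n) (e' + e'))).
    apply: ler_sum => i _; rewrite (bigD1 i) //= big1 => [|j ji]; last first.
      by rewrite !mxE eq_sym (negPf ji) !mulr0n subrr modulus0.
    rewrite addr0 !mxE eqxx !mulr1n /g.
    set c := (X in X - _); set c' := (X in _ - X).
    have -> : c - c' = ((cos (a * th (l 0 i)) - cos (y * th (l 0 i)))%:C)%C +
       'i%C * ((sin (a * th (l 0 i)) - sin (y * th (l 0 i)))%:C)%C.
      apply/eqP; rewrite eq_complex /= !mul0r !mul1r !add0r ?addr0 ?subr0 ?oppr0 ?addr0.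
      by rewrite ?eqxx.
    apply: le_trans (modulusD _ _) _; rewrite modulusM !modulusR.
    have -> : modulus 'i%C = 1 :> R.
      have := modulus_cis (pi / 2); rewrite cos_pihalf sin_pihalf.
      by [].
    have [y1 y2] := yP i; rewrite mul1r; apply: lerD; exact: ltW.
  rewrite sumr_const card_ord -mulr2n -mulrnA mul2n -[X in X < _]mulr_natr /e'.
  by rewrite mulrAC ltr_pdivrMr // ltr_pM2l // ltr_nat.
- move=> X t Xs.
  have [X' XE] : exists X', X = P^t* *m X' *m P.
    exists (P *m X *m P^t*).
    by rewrite !mulmxA (unitaryVmx Pu) mul1mx -mulmxA (unitaryVmx Pu) mulmx1.
  have PKV (A : 'M[C]_n) : P *m (P^t* *m A *m P) *m P^t* = A.
    by rewrite !mulmxA (unitarymxV Pu) mul1mx -mulmxA (unitarymxV Pu) mulmx1.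
  suff X'D : X' *m D t = D t *m X' by rewrite XE !PK X'D.
  have X'd : X' *m diag_mx l = diag_mx l *m X'.
    by rewrite -[LHS]PKV -[RHS]PKV -!PK -sE -XE Xs.
  (* A nonzero entry of [X'] links two equal eigenvalues, and equal eigenvalues have equal
     angles. *)
  apply/matrixP => i j; have /matrixP/(_ i j) := X'd.
  rewrite !mul_diag_mx !mul_mx_diag !mxE => e.
  have [->|x0] := eqVneq (X' i j) 0; first by rewrite mul0r mulr0.
  have -> : l 0 i = l 0 j; last by rewrite mulrC.
  by apply: (mulIf x0); rewrite -e mulrC.
Qed.

End UnitaryPath.

(** * The values of a dimension-drop algebra at a point *)

Section FactorFrame.
Variable C : numClosedFieldType.

(* Matrix units e_{i0,i} of M_n when [full], and of its scalars otherwise. *)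
Definition funit n (i0 : 'I_n) (full : bool) (i : 'I_n) : 'M[C]_n :=
  if full then delta_mx i0 i else 1%:M.
Definition fdom n (i0 : 'I_n) (full : bool) : pred 'I_n := fun i => full || (i == i0).

Variables (n : nat) (i0 : 'I_n).

Lemma delta_adj m k (i : 'I_m) (j : 'I_k) : (delta_mx i j : 'M[C]_(m, k))^t* = delta_mx j i.
Proof.
apply/matrixP => a b; rewrite !mxE andbC.
by case: (_ && _); rewrite ?rmorph1 ?rmorph0.
Qed.

Lemma funitM b i k : fdom i0 b i -> fdom i0 b k ->
  funit i0 b i *m (funit i0 b k)^t* = if i == k then funit i0 b i0 else 0.
Proof.
case: b => /=; rewrite /fdom /funit /=.
  by move=> _ _; rewrite delta_adj mul_delta_mx_cond; case: eqP.
move=> /eqP -> /eqP ->.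
by rewrite trmx1 map_mx1 mulmx1 eqxx.
Qed.

Lemma funitQ b i : fdom i0 b i -> funit i0 b i0 *m funit i0 b i = funit i0 b i.
Proof.
by case: b => _; rewrite /funit ?mul1mx // mul_delta_mx.
Qed.

Lemma funit_sum b : \sum_(i | fdom i0 b i) (funit i0 b i)^t* *m funit i0 b i = 1%:M.
Proof.
case: b; rewrite /fdom /funit /=.
  rewrite [RHS](matrix_sum_delta 1%:M); apply: eq_bigr => i _.
  rewrite (bigD1 i) //= big1 => [|j ji]; last by rewrite mxE eq_sym (negPf ji) scale0r.
  by rewrite mxE eqxx scale1r addr0 delta_adj mul_delta_mx.
by rewrite big_pred1_eq trmx1 map_mx1 mulmx1.
Qed.

Lemma mxtrace_funit b : \tr (funit i0 b i0) = (if b then 1 else n%:R).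
Proof.
case: b; rewrite /funit ?mxtrace1 // /mxtrace (bigD1 i0) //= big1 => [|j ji].
  by rewrite mxE eqxx addr0.
by rewrite mxE (negPf ji).
Qed.

Lemma funitV b i k : (funit i0 b i)^t* *m funit i0 b k =
  if b then delta_mx i k else 1%:M.
Proof.
by case: b; rewrite /funit ?delta_adj ?mul_delta_mx // trmx1 map_mx1 mulmx1.
Qed.

End FactorFrame.

Section TensorFacts.
Variable C : numClosedFieldType.

Lemma tensmx_adj m n (A : 'M[C]_m) (B : 'M[C]_n) : (A *t B)^t* = A^t* *t B^t*.
Proof. by rewrite trmx_tens map_mxT. Qed.

Lemma tensmx11 m n : (1%:M : 'M[C]_m) *t (1%:M : 'M[C]_n) = 1%:M.
Proof. by rewrite tens1mx_dg dg1 //; exact: mxtens_unindex_bij. Qed.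

Lemma mxtrace_tens m n (A : 'M[C]_m) (B : 'M[C]_n) : \tr (A *t B) = \tr A * \tr B.
Proof.
rewrite /mxtrace mulr_sum; apply: eq_bigr => i _.
by rewrite mxE.
Qed.

Lemma tensmx_suml (I : finType) (P : pred I) m n (A : I -> 'M[C]_m) (B : 'M[C]_n) :
  (\sum_(i | P i) A i) *t B = \sum_(i | P i) A i *t B.
Proof.
apply/matrixP => a b; rewrite mxE summxE mulr_suml summxE.
by apply: eq_bigr => i _; rewrite mxE.
Qed.

Lemma tensmx_sumr (I : finType) (P : pred I) m n (A : 'M[C]_m) (B : I -> 'M[C]_n) :
  A *t (\sum_(i | P i) B i) = \sum_(i | P i) A *t B i.
Proof.
apply/matrixP => a b; rewrite mxE summxE mulr_sumr summxE.
by apply: eq_bigr => i _; rewrite mxE.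
Qed.

Lemma tensmxZl m n (c : C) (A : 'M[C]_m) (B : 'M[C]_n) : (c *: A) *t B = c *: (A *t B).
Proof. by apply/matrixP => a b; rewrite !mxE mulrA. Qed.

Lemma tensmxZr m n (c : C) (A : 'M[C]_m) (B : 'M[C]_n) : A *t (c *: B) = c *: (A *t B).
Proof. by apply/matrixP => a b; rewrite !mxE mulrCA. Qed.

Lemma tens_delta m n (i k : 'I_m) (j l : 'I_n) :
  (delta_mx i k : 'M[C]_m) *t (delta_mx j l : 'M[C]_n) =
  delta_mx (mxtens_index (i, j)) (mxtens_index (k, l)).
Proof.
apply/matrixP => a b; case: (mxtens_indexP a) => a1 a2; case: (mxtens_indexP b) => b1 b2.
rewrite tensmxE !mxE !(inj_eq (can_inj (@mxtens_indexK _ _))) !xpair_eqE -natrM mulnb.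
by rewrite andbACA.
Qed.

End TensorFacts.

Lemma big_pair_depP (V : nmodType) (A B : finType) (P : pred A) (Q : A -> pred B)
    (F : A * B -> V) :
  \sum_(l | P l.1 && Q l.1 l.2) F l = \sum_(i | P i) \sum_(j | Q i j) F (i, j).
Proof.
rewrite (pair_big_dep P Q (fun i j => F (i, j))) /=.
by apply: eq_bigr => -[].
Qed.

Section PointFrame.
Variables (R : realType) (p q : nat).
Local Notation C := (complexes R).
Local Notation I := (unit_interval R).

(** The algebra of values at x, as two implications: both are vacuous at interior points, so the
    three kinds of points have one description. *)
Definition admissible (x : I) (B : 'M[C]_(p * q)) : Prop :=
  (x = ui0 R -> exists a : 'M[C]_p, B = a *t (1%:M : 'M[C]_q)) /\
  (x = ui1 R -> exists b : 'M[C]_q, B = (1%:M : 'M[C]_p) *t b).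

Lemma dimdrop_admissible (f : dimdrop R p q) x : admissible x (f x).
Proof.
have := dimdrop_mem f; rewrite inE => -[_ [a fa] [b fb]].
by split=> ->; [exists a|exists b].
Qed.

Lemma dimdrop_continuous (f : dimdrop R p q) : continuous f.
Proof. by have := dimdrop_mem f; rewrite inE => -[]. Qed.

Lemma dimdrop_exists (F : I -> 'M[C]_(p * q)) : continuous F ->
  (forall x, admissible x (F x)) -> exists f : dimdrop R p q, forall x, f x = F x.
Proof.
move=> cF aF; have Fi : F \in @dimdrop_pred R p q.
  rewrite inE; split => //; [exact: (aF (ui0 R)).1|exact: (aF (ui1 R)).2].
by exists (DimDrop Fi).
Qed.

Lemma ui01 : ui0 R <> ui1 R.
Proof. by move=> /(congr1 set_val) /= /eqP; rewrite eq_sym oner_eq0. Qed.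

(* The multiplicity in M_pq of the irreducible representation of Z_{p,q} at x. *)
Definition endpoint_weight (x : I) : nat :=
  if x == ui0 R then q else if x == ui1 R then p else 1.

(** The algebra of values at x is a tensor product, with first factor M_p except at 1 and second
    factor M_q except at 0, where they shrink to the scalars. [M l] is the product of matrix units
    of the factors, with row label (i0, j0) and column label l; [A] keeps a single label for a
    scalar factor. The trace of the first projection is the size of the scalar factor, hence the
    weight. *)
Lemma point_frame (i0 : 'I_p) (j0 : 'I_q) (x : I) :
  exists (A : pred ('I_p * 'I_q)) (M : 'I_p * 'I_q -> 'M[C]_(p * q)),
  [/\ [/\ A (i0, j0),
      forall l k, A l -> A k -> M l *m (M k)^t* = if l == k then M (i0, j0) else 0,
      forall l, A l -> M (i0, j0) *m M l = M l &
      \sum_(l | A l) (M l)^t* *m M l = 1%:M],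
      \tr (M (i0, j0)) = (endpoint_weight x)%:R,
      forall l, admissible x (M l) &
      forall B, admissible x B -> exists co : 'I_p * 'I_q -> 'I_p * 'I_q -> C,
        B = \sum_(l | A l) \sum_(k | A k) co l k *: ((M l)^t* *m M k)].
Proof.
pose b := x != ui1 R; pose c := x != ui0 R.
exists (fun l => fdom i0 b l.1 && fdom j0 c l.2).
exists (fun l => funit C i0 b l.1 *t funit C j0 c l.2); split.
- split.
  + by rewrite /= /fdom !eqxx !orbT.
  + move=> [l1 l2] [k1 k2] /= /andP[Al1 Al2] /andP[Ak1 Ak2].
    rewrite tensmx_adj tensmx_mul !funitM // xpair_eqE.
    by case: (l1 == k1); case: (l2 == k2); rewrite /= ?tens0mx ?tensmx0.
  + by move=> [l1 l2] /= /andP[Al1 Al2]; rewrite tensmx_mul !funitQ.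
  + rewrite -(@tensmx11 C p q) -(funit_sum C i0 b) tensmx_suml.
    rewrite -(funit_sum C j0 c) (big_pair_depP _ (fun=> fdom j0 c)).
    apply: eq_bigr => i _; rewrite tensmx_sumr; apply: eq_bigr => j _.
    by rewrite tensmx_adj tensmx_mul.
- rewrite mxtrace_tens !mxtrace_funit /endpoint_weight /b /c.
  case: (eqVneq x (ui0 R)) => [->|x0] /=.
    by case: eqP => [/ui01//|_]; rewrite mul1r.
  by case: eqP => _ /=; rewrite ?mulr1.
- move=> l; split=> [x0|x1].
    exists (funit C i0 b l.1); congr (_ *t _).
    by rewrite /c x0 eqxx /funit.
  exists (funit C j0 c l.2); congr (_ *t _).
  by rewrite /b x1 eqxx /funit.
move=> B [B0 B1].
have [x0|x0] := eqVneq x (ui0 R).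
  have [a ->] := B0 x0; have c0 : c = false by rewrite /c x0 eqxx.
  have b1 : b = true by rewrite /b x0; apply/eqP; exact: ui01.
  exists (fun l k => a l.1 k.1); rewrite c0 b1 /fdom /=.
  rewrite {1}(matrix_sum_delta a) tensmx_suml.
  rewrite (big_pair_depP xpredT (fun _ j => j == j0)); apply: eq_bigr => i _.
  rewrite big_pred1_eq tensmx_suml (big_pair_depP xpredT (fun _ j => j == j0)) /=.
  apply: eq_bigr => k _; rewrite big_pred1_eq tensmx_adj tensmx_mul ?funitV ?trmx1 ?map_mx1 ?mulmx1 ?delta_adj ?mul_delta_mx.
  by rewrite tensmxZl.
have c1 : c = true by rewrite /c x0.
have [x1|x1] := eqVneq x (ui1 R).
  have [a ->] := B1 x1; have b0 : b = false by rewrite /b x1 eqxx.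
  exists (fun l k => a l.2 k.2); rewrite c1 b0 /fdom /=.
  rewrite {1}(matrix_sum_delta a) tensmx_sumr.
  have E (F : 'I_p * 'I_q -> 'M[C]_(p * q)) :
      \sum_(l : 'I_p * 'I_q | (l.1 == i0) && true) F l = \sum_j F (i0, j).
    by rewrite (big_pair_depP (fun i => i == i0) (fun=> xpredT)) big_pred1_eq.
  rewrite E; apply: eq_bigr => i _; rewrite tensmx_sumr E /=.
  apply: eq_bigr => k _; rewrite tensmx_adj tensmx_mul ?funitV ?trmx1 ?map_mx1 ?mulmx1 ?delta_adj ?mul_delta_mx.
  by rewrite tensmxZr.
have b1 : b = true by rewrite /b x1.
exists (fun l k => B (mxtens_index l) (mxtens_index k)); rewrite c1 b1 /fdom /=.
rewrite [LHS](matrix_sum_delta B) (reindex (@mxtens_index p q)) /=; last first.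
  by apply: onW_bij; exists (@mxtens_unindex p q); [exact: mxtens_indexK|exact: mxtens_unindexK].
apply: eq_bigr => -[l1 l2] _; rewrite (reindex (@mxtens_index p q)) /=; last first.
  by apply: onW_bij; exists (@mxtens_unindex p q); [exact: mxtens_indexK|exact: mxtens_unindexK].
apply: eq_bigr => -[k1 k2] _; rewrite tensmx_adj tensmx_mul ?funitV ?trmx1 ?map_mx1 ?mulmx1 ?delta_adj ?mul_delta_mx.
by rewrite tens_delta.
Qed.

End PointFrame.

(** * Representations that factor through finitely many points *)

Section PointRep.
Variables (R : realType) (p q : nat).
Local Notation C := (complexes R).
Local Notation I := (unit_interval R).
Local Notation Z := (dimdrop R p q).

Lemma dimdropDE (f g : Z) t : (f + g) t = f t + g t. Proof. by []. Qed.
Lemma dimdropZE (a : C) (f : Z) t : (a *: f) t = a *: f t. Proof. by []. Qed.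
Lemma dimdropBE (f g : Z) t : (f - g) t = f t - g t. Proof. by []. Qed.
Lemma dimdrop0E t : (0 : Z) t = 0. Proof. by []. Qed.

Lemma dimdrop_sumE (J : finType) (P : pred J) (F : J -> Z) t :
  (\sum_(j | P j) F j) t = \sum_(j | P j) F j t.
Proof. by elim/big_rec2: _ => // j a b _ <-. Qed.

(** Lagrange interpolation: the product of the (x - z) / (a - z) over the nodes z other than a. *)
Lemma bump_exists (a : R) (s : seq R) : exists b : R -> R,
  [/\ continuous b, b a = 1 & forall z, z \in s -> z != a -> b z = 0].
Proof.
elim: s => [|z s [b [cb ba bs]]]; first by exists (fun=> 1); split => // x; exact: cvg_cst.
have [->|za] := eqVneq z a.
  exists b; split => // w; rewrite inE => /orP[/eqP ->|ws wa]; first by rewrite eqxx.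
  exact: bs.
exists (fun x => b x * ((x - z) / (a - z))); split.
- move=> x; apply: cvgM; first exact: cb.
  by apply: cvgM; [apply: cvgB; [exact: cvg_id|exact: cvg_cst]|exact: cvg_cst].
- by rewrite ba mul1r divff // subr_eq0 eq_sym.
- move=> w; rewrite inE => /orP[/eqP -> _|ws wa]; first by rewrite subrr mul0r mulr0.
  by rewrite bs ?mul0r.
Qed.

Lemma scalar_path_continuous (b : R -> R) (M : 'M[C]_(p * q)) : continuous b ->
  continuous (fun x : I => (((b (set_val x))%:C)%C : C) *: M).
Proof.
move=> cb; apply/mx_contP => a e e0.
have e1 : 0 < e / (opnorm M + 1) by rewrite divr_gt0 // ltr_wpDl ?opnorm_ge0.
have /cvgrPdist_lt/(_ _ e1) /nbhs_ballP[d /= d0 dP] := cb (set_val a).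
exists d => // y /dP yP; rewrite -scalerBl.
apply: le_lt_trans (opnormZ _ _) _; rewrite -rmorphB modulusR.
apply: (@le_lt_trans _ _ (`|b (set_val a) - b (set_val y)| * (opnorm M + 1))).
  by rewrite ler_wpM2l // lerDl.
by rewrite -ltr_pdivlMr // ltr_wpDl ?opnorm_ge0.
Qed.

Variable T : finType.
Variable y : T -> I.

(** The ends 0 and 1 are added to the nodes: an end other than [y t] gets the value 0, which meets
    its endpoint condition. *)
Lemma point_unit t (M : 'M[C]_(p * q)) : admissible (y t) M ->
  exists F : Z, forall t', F (y t') = if y t' == y t then M else 0.
Proof.
move=> [M0 M1].
have [b [cb bt bz]] := bump_exists (set_val (y t))
  [:: 0, 1 & [seq set_val (y t') | t' : T]].
have bz' (x : I) : set_val x \in [:: 0, 1 & [seq set_val (y t') | t' : T]] ->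
    b (set_val x) = (x == y t)%:R.
  move=> xs; case: eqP => [->//|xt].
  by apply: bz => //; apply/eqP => /ui_inj.
have [|x|F FE] := @dimdrop_exists R p q (fun x => (((b (set_val x))%:C)%C : C) *: M).
- exact: scalar_path_continuous.
- split=> xE; rewrite xE bz' /= ?inE ?eqxx ?orbT //; case: eqP => [e|_] /=.
  + by have [a ->] := M0 (esym e); exists a; rewrite scale1r.
  + by exists 0; rewrite scale0r tens0mx.
  + by have [a ->] := M1 (esym e); exists a; rewrite scale1r.
  + by exists 0; rewrite scale0r tensmx0.
exists F => t'; rewrite FE bz'; last first.
  by rewrite !inE; apply/orP; right; apply/orP; right; apply/mapP; exists t'; rewrite ?mem_enum.
by case: eqP => _; rewrite ?scale1r ?scale0r.
Qed.

(** The first clause replaces the passage to the finite-dimensional quotient of Z given by the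
    values at the points [y t]; the others make [Phi] a unital *-representation of it. *)
Definition point_rep r (Phi : Z -> 'M[C]_r) : Prop :=
  [/\ forall f g : Z, (forall t, f (y t) = g (y t)) -> Phi f = Phi g,
      forall (a : C) (f g : Z), Phi (a *: f + g) = a *: Phi f + Phi g,
      forall f g : Z, Phi (dimdrop_mul f g) = Phi f *m Phi g,
      forall f : Z, Phi (dimdrop_star f) = (Phi f)^t* &
      Phi (dimdrop_one R p q) = 1%:M].

(** The s blocks on the right are equal and the left-hand side is a *-homomorphism in f, so a single
    block inherits its properties; the trace sees this block s times. *)
Lemma point_rep_descend N s r (sigma : 'I_N -> T * 'I_(p * q))
    (tau : 'I_N -> 'I_s * 'I_r) (U : 'M[C]_N) (Phi : Z -> 'M[C]_r) :
  (0 < s)%N -> bijective sigma -> bijective tau -> U \is unitarymx ->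
  (forall f : Z, U^t* *m dg sigma (f \o y) *m U = dg tau (fun=> Phi f)) ->
  point_rep Phi /\
  forall f : Z, s%:R * \tr (Phi f) = \sum_t \tr (f (y t)).
Proof.
case: s tau => // s tau _ bs bt uU h.
have UU (A B : 'M[C]_N) : (U^t* *m A *m U) *m (U^t* *m B *m U) = U^t* *m (A *m B) *m U.
  by rewrite -!mulmxA [U *m (U^t* *m _)]mulmxA (unitarymxV uU) mul1mx.
have inj (A B : 'M[C]_r) : dg tau (fun=> A) = dg tau (fun=> B) -> A = B.
  by move=> AB; exact: (dg_inj bt AB ord0).
split; last first.
  move=> f; have := congr1 mxtrace (h f); rewrite (mxtrace_dg bt) sumr_const card_ord.
  rewrite mulr_natl => <-.
  by rewrite mxtrace_mulC mulmxA (unitarymxV uU) mul1mx (mxtrace_dg bs).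
split.
- move=> f g fg; apply: inj; rewrite -!h; congr (_ *m _ *m _).
  by apply: eq_dg => t /=; rewrite fg.
- move=> a f g; apply: inj; rewrite dg_linear -!h.
  have -> : dg sigma ((a *: f + g) \o y) = a *: dg sigma (f \o y) + dg sigma (g \o y).
    by rewrite -dg_linear.
  by rewrite mulmxDr mulmxDl -scalemxAr -scalemxAl.
- move=> f g; apply: inj; rewrite -(dgM bt) -!h UU (dgM bs).
  by [].
- move=> f; apply: inj; rewrite -dg_adj -!h !adjmxM trmxCK mulmxA dg_adj.
  by [].
- apply: inj; rewrite (dg1 C bt) -h.
  have -> : dg sigma (dimdrop_one R p q \o y) = 1%:M by rewrite -(dg1 C bs).
  by rewrite mulmx1 (unitaryVmx uU).
Qed.

Section Rep.
Variables (r : nat) (Phi : Z -> 'M[C]_r).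
Hypothesis rPhi : point_rep Phi.

Lemma point_rep0 : Phi 0 = 0.
Proof.
have [_ lin _ _ _] := rPhi.
have := lin (-1) 0 0; rewrite scaler0 addr0 => e.
by rewrite e scaleN1r addNr.
Qed.

Lemma point_repZ a f : Phi (a *: f) = a *: Phi f.
Proof. by have [_ lin _ _ _] := rPhi; rewrite -[a *: f]addr0 lin point_rep0 addr0. Qed.

Lemma point_rep_sum (J : finType) (P : pred J) (F : J -> Z) :
  Phi (\sum_(j | P j) F j) = \sum_(j | P j) Phi (F j).
Proof.
have [_ lin _ _ _] := rPhi.
elim/big_rec2: _ => [|j a b _ <-]; first exact: point_rep0.
by rewrite -[F j]scale1r lin !scale1r.
Qed.

End Rep.

Variables (i0 : 'I_p) (j0 : 'I_q).
Local Notation L := ('I_p * 'I_q)%type.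

(* A system of matrix units for the finite-dimensional quotient of Z on the
   points y_t, indexed by T x I_p x I_q; [a] selects one representative t for
   each point and the labels in use at this point. *)
Lemma point_units : exists (a : pred (T * L)) (Q : T -> Z) (F : T * L -> Z),
  [/\ forall t, exists2 l, a l & y l.1 = y t,
      forall l k, a l -> a k -> forall t, dimdrop_mul (F l) (dimdrop_star (F k)) (y t) =
        (if l == k then Q l.1 else 0) (y t),
      forall l, a l -> forall t, dimdrop_mul (Q l.1) (F l) (y t) = F l (y t),
      forall t, (\sum_(l | a l) dimdrop_mul (dimdrop_star (F l)) (F l)) (y t) = 1%:M &
      (forall t t', \tr (Q t (y t')) = if y t' == y t then (endpoint_weight p q (y t))%:R else 0)
      /\ forall f : Z, exists co : T * L -> T * L -> C, forall t, f (y t) =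
        (\sum_(l | a l) \sum_(k | a k && (k.1 == l.1))
           co l k *: dimdrop_mul (dimdrop_star (F l)) (F k)) (y t)].
Proof.
(* One representative index for each point: [pick] depends on t only through [y t]. *)
pose c t := odflt t [pick t' | y t' == y t].
have cy t : y (c t) = y t.
  by rewrite /c; case: pickP => [t' /eqP //|/(_ t)]; rewrite eqxx.
have cc t t' : y t = y t' -> c t = c t'.
  move=> tt; rewrite /c; have -> : [pick x | y x == y t] = [pick x | y x == y t'].
    by apply: eq_pick => x; rewrite tt.
  by case: pickP => // /(_ t'); rewrite eqxx.
have /choice[A /choice[M AM]] := fun t => point_frame i0 j0 (y t).
have /choice[F FE] : forall l : T * L, exists F : Z,
    forall t', F (y t') = if y t' == y l.1 then M l.1 l.2 else 0.
  by move=> l; apply: point_unit; have [_ _ + _] := AM l.1; apply.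
pose a : pred (T * L) := fun l => (c l.1 == l.1) && A l.1 l.2.
have sumA (V : nmodType) (G : T * L -> V) t : (forall l, y l.1 != y t -> G l = 0) ->
    \sum_(l | a l) G l = \sum_(l | A (c t) l) G (c t, l).
  move=> G0; rewrite /a (big_pair_depP (fun s => c s == s) A).
  rewrite (bigD1 (c t)) /=; last by rewrite (cc _ _ (cy t)).
  rewrite [X in _ + X]big1 ?addr0 // => s /andP[/eqP cs st].
  apply: big1 => l _; apply: G0 => /=; apply: contra st => /eqP yst.
  by rewrite -cs (cc _ _ yst).
have aP l : a l -> c l.1 = l.1 /\ A l.1 l.2 by move=> /andP[/eqP].
exists a, (fun t => F (t, (i0, j0))), F; split.
- move=> t; exists (c t, (i0, j0)) => //=; rewrite /a /= (cc _ _ (cy t)) eqxx /=.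
  by have [[]] := AM (c t).
- move=> [s l] [s' k] /aP[/= cs Al] /aP[/= cs' Ak] t.
  transitivity (F (s, l) (y t) *m (F (s', k) (y t))^t*); first by [].
  rewrite !FE /=; have [[_ MM _ _] _ _ _] := AM s.
  case: (eqVneq (y t) (y s)) => [ts|ts]; last first.
    by rewrite mul0mx; case: eqP => // _; rewrite FE /= (negPf ts).
  case: (eqVneq (y t) (y s')) => [ts'|ts'].
    have ss' : s = s' by rewrite -cs -cs' -(cc _ _ ts) -(cc _ _ ts').
    rewrite -ss' in Ak *; rewrite MM // xpair_eqE eqxx /=.
    by case: eqP => // _; rewrite FE /= ts eqxx.
  rewrite trmx0 map_mx0 mulmx0; case: eqP => // -[ss' _].
  by move: ts'; rewrite -ss' ts eqxx.
- move=> [s l] /aP[/= cs Al] t.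
  transitivity (F (s, (i0, j0)) (y t) *m F (s, l) (y t)); first by [].
  rewrite !FE /=; have [[_ _ QM _] _ _ _] := AM s.
  by case: eqP => _; rewrite ?mul0mx // QM.
- move=> t; rewrite dimdrop_sumE (sumA _ _ t) => [|l lt].
    have [[_ _ _ <-] _ _ _] := AM (c t); apply: eq_bigr => l _.
    transitivity ((F (c t, l) (y t))^t* *m F (c t, l) (y t)); first by [].
    by rewrite FE /= cy eqxx.
  transitivity ((F l (y t))^t* *m F l (y t)); first by [].
  by rewrite FE eq_sym (negPf lt) mulmx0.
split.
  move=> t t'; rewrite FE /=; case: eqP => _; last by rewrite mxtrace0.
  by have [_ -> _ _] := AM t.
move=> f.
have /choice[co coE] : forall t, exists co : L -> L -> C, f (y t) =
    \sum_(l | A t l) \sum_(k | A t k) co l k *: ((M t l)^t* *m M t k).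
  by move=> t; have [_ _ _] := AM t; apply; exact: dimdrop_admissible.
exists (fun l k => co l.1 l.2 k.2) => t.
rewrite dimdrop_sumE (sumA _ _ t) => [|l lt].
  rewrite -(cy t) coE; apply: eq_bigr => l Al; rewrite dimdrop_sumE.
  rewrite (eq_bigl (fun k : T * L => (k.1 == c t) && A k.1 k.2)); last first.
    move=> k; rewrite /a /=; case: (eqVneq k.1 (c t)) => [->|_]; rewrite ?andbF //.
    by rewrite (cc _ _ (cy t)) eqxx andbT.
  rewrite (big_pair_depP (fun s => s == c t) A) big_pred1_eq.
  apply: eq_bigr => k Ak; rewrite dimdropZE; congr (_ *: _).
  transitivity ((F (c t, l) (y (c t)))^t* *m F (c t, k) (y (c t))); last by [].
  by rewrite !FE /= eqxx.
rewrite dimdrop_sumE big1 // => k _; rewrite dimdropZE.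
have -> : dimdrop_mul (dimdrop_star (F l)) (F k) (y t) =
  (F l (y t))^t* *m F k (y t) by [].
by rewrite FE eq_sym (negPf lt) trmx0 map_mx0 mul0mx scaler0.
Qed.

(** Representations of a finite-dimensional algebra with the same character are equivalent: they
    turn one system of matrix units into two whose first projections have equal traces. *)
Lemma point_rep_equiv r (Phi D : Z -> 'M[C]_r) : point_rep Phi -> point_rep D ->
  (forall f, \tr (Phi f) = \tr (D f)) ->
  exists X : 'M[C]_r, X \is unitarymx /\ forall f, X *m Phi f = D f *m X.
Proof.
move=> rPhi rD trE; have [a [Q [F [_ FF QF F1 [_ Fsp]]]]] := point_units.
have facts (E : Z -> 'M[C]_r) : point_rep E ->
    [/\ forall l k, a l -> a k ->
          E (F l) *m (E (F k))^t* = if l == k then E (Q l.1) else 0,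
        forall l, a l -> E (Q l.1) *m E (F l) = E (F l) &
        \sum_(l | a l) (E (F l))^t* *m E (F l) = 1%:M].
  move=> rE; have [ext lin mul adj one] := rE; split.
  - move=> l k al ak; rewrite -adj -mul (ext _ _ (FF l k al ak)).
    by case: eqP => // _; exact: point_rep0.
  - by move=> l al; rewrite -mul; apply: ext; exact: QF.
  - rewrite -one -(ext _ (dimdrop_one R p q) F1) (point_rep_sum rE); apply: eq_bigr => l _.
    by rewrite mul adj.
have [f1 f2 f3] := facts _ rPhi; have [g1 g2 g3] := facts _ rD.
have [W [Wu WE]] := @matrix_units_equiv C _ _ a fst _ _ _
  (fun t => Phi (Q t)) (fun t => D (Q t)) f1 g1 f2 g2 f3 g3 (fun l _ => trE _).
exists W; split=> // f; have [co coE] := Fsp f.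
have [ext _ mul adj _] := rPhi; have [ext' _ mul' adj' _] := rD.
rewrite (ext _ _ coE) (ext' _ _ coE) !point_rep_sum // mulmx_sumr mulmx_suml.
apply: eq_bigr => l al; rewrite !point_rep_sum // mulmx_sumr mulmx_suml.
apply: eq_bigr => k /andP[ak /eqP kl].
by rewrite !point_repZ // mul adj mul' adj' -scalemxAr -scalemxAl WE.
Qed.

(** A minimal projection over x goes to a projection of some rank n, and the trace identity becomes:
    s n is the multiplicity of x times its weight. *)
Lemma point_rep_multiplicity r s (Phi : Z -> 'M[C]_r) : point_rep Phi ->
  (forall f : Z, s%:R * \tr (Phi f) = \sum_t \tr (f (y t))) ->
  forall x : I, (s %| #|[pred t | y t == x]| * endpoint_weight p q x)%N.
Proof.
move=> rPhi trE x; have [a [Q [F [ax FF QF F1 [Qt Fsp]]]]] := point_units.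
have [ext lin mul adj one] := rPhi.
have [[t /= /eqP tx]|nx] := pselect (exists t, y t == x); last first.
  have -> : #|[pred t | y t == x]| = 0%N; last by rewrite mul0n.
  by apply: eq_card0 => t; apply/negP => tx; apply: nx; exists t.
have [l al lt] := ax t.
have QQ : Phi (Q l.1) = Phi (F l) *m (Phi (F l))^t*.
  by rewrite -adj -mul (ext _ _ (FF l l al al)) eqxx.
have Qs : (Phi (Q l.1))^t* = Phi (Q l.1) by rewrite QQ adjmxM trmxCK.
have Qi : Phi (Q l.1) *m Phi (Q l.1) = Phi (Q l.1).
  by rewrite {2}QQ mulmxA -mul (ext _ _ (QF l al)) -QQ.
have [n [B [BB BQ]]] := projection_factor Qs Qi.
have := trE (Q l.1); rewrite -BQ mxtrace_mulC BB mxtrace1 -natrM.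
rewrite (eq_bigr (fun t' => if y t' == x then (endpoint_weight p q x)%:R else 0)); last first.
  by move=> t' _; rewrite Qt lt tx.
rewrite -big_mkcond sumr_const -mulrnA => /eqP; rewrite eqr_nat => /eqP e.
by rewrite mulnC -[X in (_ %| X)%N]e dvdn_mulr.
Qed.

End PointRep.

(** * Counting *)

Section Counting.

Lemma card_ord_lt k m : (m <= k)%N -> #|[pred j : 'I_k | (j < m)%N]| = m.
Proof.
move=> mk; rewrite -[RHS](card_ord m) -(card_codom (f := widen_ord mk)); last first.
  by move=> i j /(congr1 val) /= /val_inj.
apply: eq_card => j; rewrite !inE; apply/idP/codomP => [jm|[i ->]] /=; last exact: ltn_ord.
by exists (Ordinal jm); apply: val_inj.
Qed.

Lemma card_ord_ge k m : (m <= k)%N -> #|[pred j : 'I_k | (m <= j)%N]| = (k - m)%N.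
Proof.
move=> mk; apply: (@addnI m); rewrite subnKC //.
have := cardC [pred j : 'I_k | (j < m)%N].
rewrite card_ord card_ord_lt // => e; apply: etrans e; congr addn.
by apply: eq_card => j; rewrite !inE -leqNgt.
Qed.

Lemma downset_card k (P : pred 'I_k) : (forall i j : 'I_k, (i <= j)%N -> P j -> P i) ->
  forall i, P i = (i < #|P|)%N.
Proof.
move=> dP i; apply/idP/idP => [Pi|].
  rewrite -[X in (X <= _)%N](@card_ord_lt k i.+1) //; apply: subset_leq_card.
  by apply/fintype.subsetP => j; rewrite !inE ltnS => ji; exact: dP Pi.
apply: contraLR => nPi; rewrite -leqNgt -[leqRHS](card_ord_lt (ltnW (ltn_ord i))).
apply: subset_leq_card; apply/fintype.subsetP => j Pj; rewrite !inE ltnNge.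
by apply: contra nPi => ij; exact: dP Pj.
Qed.

Lemma dvdn_card_fibers (T : finType) (V : eqType) (y : T -> V) (P : pred V) s :
  (forall x, P x -> s %| #|[pred t | y t == x]|)%N -> (s %| #|[pred t | P (y t)]|)%N.
Proof.
move: {2}#|_| (leqnn #|[pred t | P (y t)]|) => n; elim: n P => [|n IH] P nP sP.
  by move: nP; rewrite leqn0 => /eqP ->; exact: dvdn0.
have [t Pt|P0] := pickP [pred t | P (y t)]; last by rewrite eq_card0.
rewrite -(cardID [pred t' | y t' == y t]) /=.
have -> : #|[predI [pred t' | P (y t')] & [pred t' | y t' == y t]]| = #|[pred t' | y t' == y t]|.
  by apply: eq_card => t'; rewrite !inE /=; case: eqP => [->|_]; rewrite ?andbF ?andbT.
have E : #|[predD [pred t' | P (y t')] & [pred t' | y t' == y t]]| =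
    #|[pred t' | [pred x | (x != y t) && P x] (y t')]| by apply: eq_card => t'; rewrite !inE.
rewrite dvdn_addr ?sP // E; apply: IH => [|x /andP[_ Px]]; last exact: sP.
rewrite -E -ltnS; apply: leq_trans nP; apply: proper_card; apply/properP; split.
  by apply/fintype.subsetP => t'; rewrite !inE => /andP[].
by exists t; rewrite !inE // eqxx.
Qed.

(* The numbers of zeros and ones in a list at an endpoint are determined modulo the
   size of the fibre by the length of the list. *)
Lemma coprime_residue p q s a b a' b' : coprime p q ->
  (a < s -> b < s -> a' < s -> b' < s ->
  s %| a * q -> s %| b * p -> s %| a' * q -> s %| b' * p ->
  a + b = a' + b' %[mod s] -> a = a' /\ b = b')%N.
Proof.
move=> pq; have key x y x' y' : (x <= x')%N -> (x' < s)%N -> (s %| x * q)%N ->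
    (s %| x' * q)%N -> (s %| y * p)%N -> (s %| y' * p)%N ->
    (x + y = x' + y' %[mod s])%N -> x = x'.
  move=> xx xs xq xq' yp yp' /eqP e.
  (* s divides q times the difference of x and x', and by the congruence of the sums also p times
     it; by coprimality it divides the difference, which is smaller than s. *)
  have e1 : (s %| (x' - x) * q)%N by rewrite mulnBl dvdn_sub.
  have e2 : (s %| (x' - x) * p)%N.
    have : (x * p + y * p == x' * p + y' * p %[mod s])%N.
      by rewrite -!mulnDl; apply/eqP; rewrite -modnMml (eqP e) modnMml.
    rewrite -(modnDmr _ (y * p)) -(modnDmr _ (y' * p)) (eqP yp) (eqP yp') !addn0.
    by rewrite eq_sym eqn_mod_dvd ?leq_mul2r ?xx ?orbT // mulnBl.
  have : (s %| gcdn ((x' - x) * p) ((x' - x) * q))%N by rewrite dvdn_gcd e1 e2.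
  rewrite -muln_gcdr (eqP pq) muln1 => /dvdnP[[|c] cE].
    by apply/eqP; rewrite eqn_leq xx -subn_eq0 cE.
  have : (s <= x' - x)%N by rewrite cE mulSn leq_addr.
  by move=> /leq_trans/(_ (leq_subr _ _)); rewrite leqNgt xs.
move=> as_ bs as' bs' aq bp aq' bp' e.
have aa : a = a'.
  case/orP: (leq_total a a') => l; first exact: (key a b a' b').
  by apply/esym; apply: (key a' b' a b).
split=> //; move: e; rewrite aa => /eqP; rewrite eqn_modDl !modn_small //.
by move/eqP.
Qed.

End Counting.

(** * Lists cut into equal groups *)

Section Blocks.
Variables (R : realType) (p q : nat).
Local Notation C := (complexes R).
Local Notation I := (unit_interval R).

(* Up to a zeros and b ones, the list consists of groups of s equal points; with the
   divisibilities of [block_params], diag(f o y) is then conjugate to D (x) 1_s by a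
   unitary which depends neither on f nor on the values of y. *)
Definition block_list s k a b (y : 'I_k -> I) : Prop :=
  [/\ forall l : 'I_k, (l < a)%N -> y l = ui0 R,
      forall l : 'I_k, (k - b <= l)%N -> y l = ui1 R &
      forall l l' : 'I_k, (a <= l < k - b)%N -> (a <= l' < k - b)%N ->
        ((l - a) %/ s = (l' - a) %/ s)%N -> y l = y l'].

(** The value of f at 0 is one matrix of M_p repeated q times, so a zeros contribute [a * q] copies
    of it; b ones contribute [b * p] copies of a matrix of M_q. These copies, and the entries of the
    middle of the list, must be dealt evenly among s parts. *)
Definition block_params s k a b : Prop :=
  [/\ (a + b <= k)%N, (s %| a * q)%N, (s %| b * p)%N & (s %| k - (a + b))%N].

(** Only the zeros and ones left over modulo s are split off. The other zeros fill whole groups, and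
    s divides the multiplicity of each interior point, so in the middle of the sorted list the value
    changes only between groups. *)
Lemma sorted_blocks s k (y : 'I_k -> I) : (0 < s)%N ->
  (forall i j : 'I_k, (i <= j)%N -> set_val (y i) <= set_val (y j)) ->
  (forall x, (s %| #|[pred t | y t == x]| * endpoint_weight p q x)%N) ->
  exists a b, [/\ (a < s)%N, (b < s)%N, block_params s k a b & block_list s a b y].
Proof.
move=> s0 ys ysx.
pose n0 := #|[pred t | y t == ui0 R]|; pose n1 := #|[pred t | y t == ui1 R]|.
have v0 : set_val (ui0 R) = 0 by [].
have v1 : set_val (ui1 R) = 1 by [].
have n0E (l : 'I_k) : (y l == ui0 R) = (l < n0)%N.
  apply: (@downset_card k (fun l => y l == ui0 R)) => i j ij /eqP yj.
  apply/eqP/ui_inj/le_anti; rewrite v0; have /andP[-> _] := ui_itv (y i).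
  by rewrite andbT; have := ys _ _ ij; rewrite yj v0.
have n1E (l : 'I_k) : (y l != ui1 R) = (l < k - n1)%N.
  have -> : (k - n1 = #|[pred t | y t != ui1 R]|)%N.
    by rewrite -[in LHS](card_ord k) -(cardC [pred t | y t == ui1 R]) addKn; apply: eq_card.
  apply: (@downset_card k (fun l => y l != ui1 R)) => i j ij; apply: contra => /eqP yi.
  apply/eqP/ui_inj/le_anti; rewrite v1; have /andP[_ ->] := ui_itv (y j).
  by have := ys _ _ ij; rewrite yi v1.
have inner (P : pred I) : (forall x, P x -> x != ui0 R /\ x != ui1 R) ->
    (s %| #|[pred t | P (y t)]|)%N.
  move=> Pi; apply: dvdn_card_fibers => x /Pi[x0 x1].
  by have := ysx x; rewrite /endpoint_weight (negPf x0) (negPf x1) muln1.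
have kE : exists c, (k = n0 + n1 + c * s)%N.
  have /dvdnP[c cE] : (s %| #|[pred t | [pred x | (x != ui0 R) && (x != ui1 R)] (y t)]|)%N.
    by apply: inner => x /andP[].
  exists c; rewrite -cE -[LHS](card_ord k) -(cardC [pred t | y t == ui0 R]) -addnA; congr addn.
  rewrite -(cardID [pred t | y t == ui1 R]); congr addn; apply: eq_card => t.
    rewrite !inE /=; have [->|] := eqVneq (y t) (ui1 R); rewrite ?andbF ?andbT //=.
    by have -> : (ui1 R == ui0 R) = false by apply/eqP => /esym/ui01.
  by rewrite !inE /= andbC.
have [c ck] := kE.
have n0k : (n0 + n1 <= k)%N by rewrite ck leq_addr.
have an0 : (n0 %% s <= n0)%N by exact: leq_mod.
have bn1 : (n1 %% s <= n1)%N by exact: leq_mod.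
exists (n0 %% s)%N, (n1 %% s)%N; split.
- by rewrite ltn_mod.
- by rewrite ltn_mod.
- split.
  + by apply: leq_trans n0k; exact: leq_add.
  + have := ysx (ui0 R); rewrite /endpoint_weight eqxx => /eqP h.
    by apply/eqP; rewrite modnMml.
  + have := ysx (ui1 R); rewrite /endpoint_weight.
    case: eqP => [/esym/ui01//|_]; rewrite eqxx => /eqP h.
    by apply/eqP; rewrite modnMml.
  + have -> : (k - (n0 %% s + n1 %% s) = (n0 %/ s + n1 %/ s + c) * s)%N.
      rewrite ck {1}(divn_eq n0 s) {1}(divn_eq n1 s) !mulnDl.
      move: (n0 %/ s * s)%N (n1 %/ s * s)%N (n0 %% s)%N (n1 %% s)%N (c * s)%N.
      by clear; lia.
    exact: dvdn_mull.
split.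
- by move=> l la; apply/eqP; rewrite n0E; exact: leq_trans an0.
- move=> l lb; apply/eqP; rewrite -[_ == _]negbK n1E -leqNgt.
  by apply: leq_trans lb; exact: leq_sub2l.
(* If the entries differed, the number [cv] of entries below [y l'] would separate l from l'; minus
   the split-off zeros it is a multiple of s, so l and l' would lie in different groups. *)
have main (l l' : 'I_k) : (l < l')%N -> (n0 %% s <= l)%N ->
    ((l - n0 %% s) %/ s = (l' - n0 %% s) %/ s)%N -> y l = y l'.
  move=> ll al e; apply: contrapT => yll.
  have yy : set_val (y l) < set_val (y l').
    rewrite lt_neqAle ys 1?ltnW // andbT; apply/eqP => /ui_inj; exact: yll.
  pose v := set_val (y l').
  pose cv := #|[pred t | set_val (y t) < v]|.
  have cvE (t : 'I_k) : (set_val (y t) < v) = (t < cv)%N.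
    apply: (@downset_card k (fun t => set_val (y t) < v)) => i j ij.
    by apply: le_lt_trans; exact: ys.
  have l1 : (l < cv)%N by rewrite -cvE.
  have l2 : (cv <= l')%N by rewrite leqNgt -cvE ltxx.
  have v_gt0 : 0 < v.
    by apply: le_lt_trans yy; have /andP[] := ui_itv (y l).
  have v_le1 : v <= 1 by have /andP[] := ui_itv (y l').
  have [d dE] : exists d, (cv = n0 + d * s)%N.
    have /dvdnP[d dE] : (s %| #|[pred t | [pred x : I | (x != ui0 R) && (set_val x < v)%R] (y t)]|)%N.
      apply: inner => x /= /andP[x0 xv]; split => //; apply/eqP => x1.
      by move: xv; rewrite x1 v1 ltNge v_le1.
    exists d; rewrite -dE /cv -(cardID [pred t | y t == ui0 R]); congr addn.
      apply: eq_card => t; rewrite !inE /=; case: eqP => [->|]; rewrite ?andbF //.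
      by rewrite v0 v_gt0.
  have : ((l - n0 %% s) %/ s < (l' - n0 %% s) %/ s)%N; last by rewrite e ltnn.
  have cE : (cv - n0 %% s = (n0 %/ s + d) * s)%N.
    by rewrite dE {1}(divn_eq n0 s) mulnDl; move: (n0 %/ s * s)%N (n0 %% s)%N (d * s)%N; clear; lia.
  apply: (@leq_trans ((cv - n0 %% s) %/ s)).
    rewrite ltn_divLR // cE mulnK // -cE.
    by rewrite ltn_sub2r // (leq_ltn_trans al l1).
  by apply: leq_div2r; apply: leq_sub2r.
move=> l l' /andP[al _] /andP[al' _] e.
case: (ltngtP l l') => [ll|ll|/val_inj->//]; first exact: main.
by apply/esym; apply: main.
Qed.

(** The copies of each kind of block are numbered and the numbers divided by s: the quotient names a
    block of [D], the remainder one of the s copies of [D]. The numbering sees neither f nor the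
    values of y, hence neither does the permutation matrix [P]. *)
Lemma block_frame N k s r a b
    (sigma : 'I_N -> 'I_k * 'I_(p * q)) (tau : 'I_N -> 'I_s * 'I_r) :
  bijective sigma -> bijective tau -> (0 < s)%N -> block_params s k a b ->
  exists P : 'M[C]_N, P \is unitarymx /\
    forall y, block_list s a b y -> forall f : dimdrop R p q, exists D : 'M[C]_r,
      P^t* *m dg sigma (f \o y) *m P = dg tau (fun=> D).
Proof.
move=> bsig [tau' tauK tau'K] s0 [abk aq bp kab].
pose A0 := (a * q %/ s)%N; pose B0 := ((k - (a + b)) %/ s)%N; pose C0 := (b * p %/ s)%N.
(* The indices of [D]: A0 blocks of size p from the zeros, B0 blocks of size p q from the middle of
   the list, C0 blocks of size q from the ones. *)
pose W := (('I_A0 * 'I_p) + ('I_B0 * 'I_(p * q)) + ('I_C0 * 'I_q))%type.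
(* The zero at position l carries q copies, the j-th with number l q + j, while the first tensor
   index i stays inside the block. For the ones the two tensor indices exchange roles. *)
pose spec (e : 'I_k * 'I_(p * q)) (zw : 'I_s * W) : Prop :=
  let i := (mxtens_unindex e.2).1 in let j := (mxtens_unindex e.2).2 in
  match zw.2 with
  | inl (inl xi) => [/\ (e.1 < a)%N, (e.1 * q + j = xi.1 * s + zw.1)%N & xi.2 = i]
  | inl (inr xu) => [/\ (a <= e.1 < k - b)%N, (e.1 - a = xu.1 * s + zw.1)%N & xu.2 = e.2]
  | inr xj => [/\ (k - b <= e.1)%N, ((e.1 - (k - b)) * p + i = xj.1 * s + zw.1)%N & xj.2 = j]
  end.
have euclid n m x y x' y' : (y < m)%N -> (y' < m)%N ->
    (n = x * m + y)%N -> (n = x' * m + y')%N -> x = x' /\ y = y'.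
  move=> ym ym' -> e; have m0 : (0 < m)%N by apply: leq_ltn_trans ym.
  have := congr1 (fun z => z %/ m)%N e; rewrite !divnMDl // !divn_small // !addn0 => xx.
  by split=> //; move: e; rewrite xx => /addnI.
have /choice[th thP] : forall e, exists zw, spec e zw.
  move=> [l u]; pose i := (mxtens_unindex u).1; pose j := (mxtens_unindex u).2.
  have [la|la] := ltnP l a.
    have xb : ((l * q + j) %/ s < A0)%N.
      rewrite /A0 ltn_divLR // divnK //.
      apply: (@leq_trans (l.+1 * q)%N); last by rewrite leq_mul2r la orbT.
      by rewrite mulSn addnC ltn_add2r.
    have zb : ((l * q + j) %% s < s)%N by rewrite ltn_mod.
    exists (Ordinal zb, inl (inl (Ordinal xb, i))); rewrite /spec /=; split => //.
    exact: divn_eq.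
  have [lb|lb] := ltnP l (k - b).
    have xb : ((l - a) %/ s < B0)%N.
      by rewrite /B0 ltn_divLR // divnK // subnDA subnAC ltn_sub2r //; apply: leq_ltn_trans lb.
    have zb : ((l - a) %% s < s)%N by rewrite ltn_mod.
    exists (Ordinal zb, inl (inr (Ordinal xb, u))); rewrite /spec /=; split => //.
      by rewrite la lb.
    exact: divn_eq.
  have xb : (((l - (k - b)) * p + i) %/ s < C0)%N.
    rewrite /C0 ltn_divLR // divnK //.
    apply: (@leq_trans ((l - (k - b)).+1 * p)%N).
      by rewrite mulSn addnC ltn_add2r.
    by rewrite leq_mul2r; apply/orP; right; move: (nat_of_ord l) (ltn_ord l) abk lb; clear; lia.
  have zb : (((l - (k - b)) * p + i) %% s < s)%N by rewrite ltn_mod.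
  exists (Ordinal zb, inr (Ordinal xb, j)); rewrite /spec /=; split => //.
  exact: divn_eq.
have unindex_inj (u u' : 'I_(p * q)) : (mxtens_unindex u).1 = (mxtens_unindex u').1 ->
    (mxtens_unindex u).2 = (mxtens_unindex u').2 -> u = u'.
  move=> e1 e2; apply: (can_inj (@mxtens_unindexK p q)).
  by rewrite [LHS]surjective_pairing e1 e2 -surjective_pairing.
have thI : injective th.
  move=> [l u] [l' u'] e; have := thP (l, u); have := thP (l', u'); rewrite -e /spec /=.
  case: (th (l, u)) => z [[[x i]|[x v]]|[x j]] /=.
  - move=> [la e1 i1] [la' e2 i2].
    have [ll jj] := euclid _ q _ _ _ _ (mxtens_index_proof2 u')
      (mxtens_index_proof2 u) erefl (etrans e1 (esym e2)).
    congr pair; first exact/esym/val_inj.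
    by apply: unindex_inj; [exact: etrans (esym i2) i1|apply: val_inj; exact: esym jj].
  - by move=> [/andP[la _] e1 <-] [/andP[la' _] e2 <-]; congr pair; apply: val_inj;
    rewrite /= -(subnK la') -(subnK la) e1 e2.
  - move=> [la e1 i1] [la' e2 i2].
    have [ll jj] := euclid _ p _ _ _ _ (mxtens_index_proof1 u')
      (mxtens_index_proof1 u) erefl (etrans e1 (esym e2)).
    congr pair; first by apply: val_inj; rewrite /= -(subnK la') -(subnK la) ll.
    by apply: unindex_inj; [apply: val_inj; exact: esym jj|exact: etrans (esym i2) i1].
have NE : (k * (p * q) = N)%N.
  by have /bij_eq_card := bsig; rewrite card_prod !card_ord => ->.
have Ns : (s * r = N)%N.
  have : bijective tau by exists tau'.
  by move/bij_eq_card; rewrite card_prod !card_ord => ->.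
have Wr : #|{: W}| = r.
  apply/eqP; rewrite -(eqn_pmul2l s0) Ns !card_sum !card_prod !card_ord.
  have sA : (s * A0 = a * q)%N by rewrite mulnC divnK.
  have sB : (s * B0 = k - (a + b))%N by rewrite mulnC divnK.
  have sC : (s * C0 = b * p)%N by rewrite mulnC divnK.
  rewrite !mulnDr !mulnA sA sB sC -NE; apply/eqP.
  have {2}-> : (k = a + (k - (a + b)) + b)%N by move: abk; clear; lia.
  by move: (k - (a + b))%N => m; ring.
have [rk bij_rk] : exists rk : W -> 'I_r, bijective rk.
  rewrite -Wr; exists enum_rank; exact: enum_rank_bij.
pose h (i : 'I_N) := tau' ((th (sigma i)).1, rk (th (sigma i)).2).
have hI : injective h.
  move=> i i' /(can_inj tau'K) [e1 /(bij_inj bij_rk) e2].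
  apply: (bij_inj bsig); apply: thI.
  by rewrite [LHS]surjective_pairing e1 e2 -surjective_pairing.
have [P [Pu PE]] := perm_conj C hI.
exists P; split=> // y [y0 y1 yb] f.
have [rk' rkK rk'K] := bij_rk.
have [a0 f0] := (dimdrop_admissible f (ui0 R)).1 erefl.
have [b1 f1] := (dimdrop_admissible f (ui1 R)).2 erefl.
have xk (x : 'I_B0) : (a + x * s < k)%N.
  have := ltn_ord x; rewrite /B0 => xB.
  have : (x.+1 * s <= k - (a + b))%N by rewrite -(divnK kab) leq_mul2r xB orbT.
  by rewrite mulSn; move: (x * s)%N s0 abk; clear; lia.
(* The entries of [D]; the middle block x is read at the first position a + x s of its group. *)
pose G (w w' : W) : C := match w, w' with
  | inl (inl xi), inl (inl xi') => if xi.1 == xi'.1 then a0 xi.2 xi'.2 else 0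
  | inl (inr xu), inl (inr xu') =>
      if xu.1 == xu'.1 then f (y (Ordinal (xk xu.1))) xu.2 xu'.2 else 0
  | inr xj, inr xj' => if xj.1 == xj'.1 then b1 xj.2 xj'.2 else 0
  | _, _ => 0
  end.
exists (\matrix_(c, c') G (rk' c) (rk' c')).
have E : dg sigma (f \o y) =
    P *m dg tau (fun=> \matrix_(c, c') G (rk' c) (rk' c')) *m P^t*.
  rewrite PE; apply/matrixP => i i'; rewrite !mxE !tau'K /= !rkK.
  move: (sigma i) (sigma i') => [l u] [l' u'] /=.
  have := thP (l, u); have := thP (l', u'); rewrite /spec /=.
  case: (th (l, u)) => z [[[x i1]|[x v]]|[x j1]] /=;
    case: (th (l', u')) => z' [[[x' i1']|[x' v']]|[x' j1']] /=.
  - move=> [la' e' ->] [la e ->].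
    case: (eqVneq l l') => [ll|ll].
      rewrite (y0 _ la) f0 mxE mxE -ll in e' *.
      case: (eqVneq (mxtens_unindex u).2 (mxtens_unindex u').2) => [jj|jj].
        have [xx zz] := euclid _ s _ _ _ _ (ltn_ord z) (ltn_ord z') e (etrans (congr1 (fun j : 'I_q => (l * q + j)%N) jj) e').
        by rewrite (val_inj xx) (val_inj zz) !eqxx mulr1.
      rewrite mulr0; case: eqP => // zz; case: eqP => // xx; exfalso.
      rewrite zz xx -e' in e; move: jj; have -> : (mxtens_unindex u).2 =
        (mxtens_unindex u').2 by apply: val_inj; exact: (addnI e).
      by rewrite eqxx.
    case: eqP => // zz; case: eqP => // xx; exfalso; rewrite zz xx -e' in e.
    have [/val_inj ll' _] := euclid _ q _ _ _ _ (mxtens_index_proof2 u) (mxtens_index_proof2 u') erefl e.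
    by move: ll; rewrite ll' eqxx.
  - move=> [/andP[la' _] _ _] [la _ _]; case: eqP => [ll|_]; last by case: eqP.
    by move: la; rewrite ll ltnNge la'.
  - move=> [lb' _ _] [la _ _]; case: eqP => [ll|_]; last by case: eqP.
    by move: lb' la abk; rewrite ll; move: (nat_of_ord l'); clear; lia.
  - move=> [la' _ _] [/andP[la _] _ _]; case: eqP => [ll|_]; last by case: eqP.
    by move: la'; rewrite -ll ltnNge la.
  - move=> [la' e' ->] [la e ->].
    case: (eqVneq l l') => [ll|ll].
      rewrite -ll in e'.
      have [xx zz] := euclid _ s _ _ _ _ (ltn_ord z) (ltn_ord z') e e'.
      rewrite (val_inj xx) (val_inj zz) !eqxx; congr (f _ _ _); apply: yb => //=.
        have := xk x'; have := ltn_ord x'; rewrite {1}/B0 => xB _.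
        have : (x'.+1 * s <= k - (a + b))%N by rewrite -(divnK kab) leq_mul2r xB orbT.
        by rewrite mulSn; move: (nat_of_ord x' * s)%N s0 abk; clear; lia.
      by rewrite addKn mulnK // e' divnMDl // divn_small // addn0.
    case: eqP => // zz; case: eqP => // xx; exfalso; rewrite zz xx -e' in e.
    move: la la' => /andP[la _] /andP[la' _].
    have lE : l = l' by apply: val_inj; rewrite /= -(subnK la) -(subnK la') e.
    by move: ll; rewrite lE eqxx.
  - move=> [lb' _ _] [/andP[_ lb] _ _]; case: eqP => [ll|_]; last by case: eqP.
    by move: lb'; rewrite -ll leqNgt lb.
  - move=> [la' _ _] [lb _ _]; case: eqP => [ll|_]; last by case: eqP.
    by move: la' lb abk; rewrite -ll; move: (nat_of_ord l); clear; lia.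
  - move=> [/andP[_ lb'] _ _] [lb _ _]; case: eqP => [ll|_]; last by case: eqP.
    by move: lb; rewrite ll leqNgt lb'.
  - move=> [la' e' ->] [la e ->].
    case: (eqVneq l l') => [ll|ll].
      rewrite (y1 _ la) f1 mxE mxE -ll in e' *.
      case: (eqVneq (mxtens_unindex u).1 (mxtens_unindex u').1) => [jj|jj].
        have [xx zz] := euclid _ s _ _ _ _ (ltn_ord z) (ltn_ord z') e (etrans (congr1 (fun j : 'I_p => ((l - (k - b)) * p + j)%N) jj) e').
        by rewrite (val_inj xx) (val_inj zz) !eqxx mul1r.
      rewrite mul0r; case: eqP => // zz; case: eqP => // xx; exfalso.
      rewrite zz xx -e' in e; move: jj; have -> : (mxtens_unindex u).1 =
        (mxtens_unindex u').1 by apply: val_inj; exact: (addnI e).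
      by rewrite eqxx.
    case: eqP => // zz; case: eqP => // xx; exfalso; rewrite zz xx -e' in e.
    have [ll' _] := euclid _ p _ _ _ _ (mxtens_index_proof1 u) (mxtens_index_proof1 u') erefl e.
    have lE : l = l' by apply: val_inj; rewrite /= -(subnK la) -(subnK la') ll'.
    by move: ll; rewrite lE eqxx.
by rewrite E !mulmxA (unitaryVmx Pu) mul1mx -mulmxA (unitaryVmx Pu) mulmx1.
Qed.

End Blocks.

(** * Alignment of two diagonal maps at an endpoint *)

Section EndpointAlign.
Variables (R : realType) (p q : nat) (i0 : 'I_p) (j0 : 'I_q).
Local Notation C := (complexes R).
Local Notation I := (unit_interval R).
Local Notation Z := (dimdrop R p q).
Hypothesis pq : coprime p q.

Definition sorted_family k (y : 'I_k -> I) : Prop :=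
  forall i j : 'I_k, (i <= j)%N -> set_val (y i) <= set_val (y j).

Lemma endpoint_blocks N k s r (sigma : 'I_N -> 'I_k * 'I_(p * q))
    (tau : 'I_N -> 'I_s * 'I_r) (y : 'I_k -> I) (U : 'M[C]_N) (Phi : Z -> 'M[C]_r) :
  bijective sigma -> bijective tau -> (0 < s)%N -> sorted_family y -> U \is unitarymx ->
  (forall f : Z, U^t* *m dg sigma (f \o y) *m U = dg tau (fun=> Phi f)) ->
  exists a b, [/\ (a < s)%N, (b < s)%N, block_params p q s k a b & block_list s a b y].
Proof.
move=> bs bt s0 ys uU h; have [rep tr] := point_rep_descend s0 bs bt uU h.
by apply: sorted_blocks => // x; exact: (point_rep_multiplicity i0 j0 rep tr).
Qed.

(** U and P bring the same list into block form, so the two representations have equal traces and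
    are conjugate by some X. For S = P (X (x) 1_s) U^* the conjugacy turns into commutation with the
    list. *)
Lemma frame_align N k s r (sigma : 'I_N -> 'I_k * 'I_(p * q))
    (tau : 'I_N -> 'I_s * 'I_r) (y : 'I_k -> I) (U P : 'M[C]_N) (Phi D : Z -> 'M[C]_r) :
  bijective sigma -> bijective tau -> (0 < s)%N ->
  U \is unitarymx -> P \is unitarymx ->
  (forall f : Z, U^t* *m dg sigma (f \o y) *m U = dg tau (fun=> Phi f)) ->
  (forall f : Z, P^t* *m dg sigma (f \o y) *m P = dg tau (fun=> D f)) ->
  exists X : 'M[C]_r, X \is unitarymx /\ exists S : 'M[C]_N,
    [/\ S \is unitarymx, S *m U = P *m dg tau (fun=> X) &
        forall f : Z, S *m dg sigma (f \o y) = dg sigma (f \o y) *m S].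
Proof.
move=> bs bt s0 uU uP hU hP.
have [repU trU] := point_rep_descend s0 bs bt uU hU.
have [repP trP] := point_rep_descend s0 bs bt uP hP.
have [f|X [uX XE]] := point_rep_equiv i0 j0 repU repP.
  by apply: (@mulfI _ (s%:R : C)); rewrite ?pnatr_eq0 -?lt0n // trU trP.
exists X; split => //; exists (P *m dg tau (fun=> X) *m U^t*).
have uJ : dg tau (fun=> X) \is unitarymx by exact: dg_unitary.
split.
- exact: mul_unitarymx (mul_unitarymx uP uJ) (unitarymx_adj uU).
- by rewrite -mulmxA (unitaryVmx uU) mulmx1.
move=> f.
have e1 : U^t* *m dg sigma (f \o y) = dg tau (fun=> Phi f) *m U^t*.
  by rewrite -hU -mulmxA (unitarymxV uU) mulmx1.
have e2 : P *m dg tau (fun=> D f) = dg sigma (f \o y) *m P.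
  by rewrite -hP !mulmxA (unitarymxV uP) mul1mx.
have e3 : dg tau (fun=> X) *m dg tau (fun=> Phi f) = dg tau (fun=> D f) *m dg tau (fun=> X).
  by rewrite !dgM //; apply: eq_dg => _; exact: XE.
by rewrite -mulmxA e1 !mulmxA -(mulmxA P) e3 mulmxA e2.
Qed.

(** By [coprime_residue] both lists leave over the same numbers of zeros and ones, so one P serves
    both. After alignment with P the transition unitary has s equal blocks, as a value at the
    endpoint must have. *)
Lemma endpoint_align N k s r (sigma : 'I_N -> 'I_k * 'I_(p * q))
    (tau : 'I_N -> 'I_s * 'I_r) (y y' : 'I_k -> I) (U V : 'M[C]_N)
    (Phi Psi : Z -> 'M[C]_r) :
  bijective sigma -> bijective tau -> (0 < s)%N -> sorted_family y -> sorted_family y' ->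
  U \is unitarymx -> V \is unitarymx ->
  (forall f : Z, U^t* *m dg sigma (f \o y) *m U = dg tau (fun=> Phi f)) ->
  (forall f : Z, V^t* *m dg sigma (f \o y') *m V = dg tau (fun=> Psi f)) ->
  exists S S' : 'M[C]_N, [/\ S \is unitarymx, S' \is unitarymx,
    forall f : Z, S *m dg sigma (f \o y) = dg sigma (f \o y) *m S,
    forall f : Z, S' *m dg sigma (f \o y') = dg sigma (f \o y') *m S' &
    exists W, (S' *m V)^t* *m (S *m U) = dg tau (fun=> W)].
Proof.
move=> bs bt s0 ys ys' uU uV hU hV.
have [a [b [a_s b_s par bl]]] := endpoint_blocks bs bt s0 ys uU hU.
have [a' [b' [a_s' b_s' par' bl']]] := endpoint_blocks bs bt s0 ys' uV hV.
have [aa bb] : a = a' /\ b = b'.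
  have [ab aq bp kab] := par; have [ab' aq' bp' kab'] := par'.
  apply: (coprime_residue pq a_s b_s a_s' b_s') => //.
  (* The numbers left over add up to the length k modulo s, and both lists have this length. *)
  have h c d : (c + d <= k)%N -> (s %| k - (c + d))%N -> (c + d = k %[mod s])%N.
    by move=> cd /eqP sk; rewrite -[in RHS](subnK cd) -[RHS]modnDml sk.
  by rewrite !h.
rewrite -{}aa -{}bb in bl'; have [P [uP PE]] := block_frame R bs bt s0 par.
have /choice[D DE] := PE y bl; have /choice[D' DE'] := PE y' bl'.
have [X [uX [S [uS SU Sc]]]] := frame_align bs bt s0 uU uP hU DE.
have [X' [uX' [S' [uS' SU' Sc']]]] := frame_align bs bt s0 uV uP hV DE'.
exists S, S'; split => //; exists (X'^t* *m X).
rewrite SU SU' adjmxM -mulmxA (mulmxA (P^t*)) (unitaryVmx uP) mul1mx dg_adj.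
by rewrite dgM.
Qed.

End EndpointAlign.

(** * Commutator estimates *)

Section Commutators.
Variable R : realType.
Local Notation C := (complexes R).

Lemma comm_mulmx n (A B D : 'M[C]_n) d d' : A \is unitarymx -> B \is unitarymx ->
  opnorm (A *m D - D *m A) <= d -> opnorm (B *m D - D *m B) <= d' ->
  opnorm (A *m B *m D - D *m (A *m B)) <= d + d'.
Proof.
move=> uA uB hA hB.
have -> : A *m B *m D - D *m (A *m B) = (A *m D - D *m A) *m B + A *m (B *m D - D *m B).
  by rewrite mulmxBl mulmxBr !mulmxA [RHS]addrC addrA subrK.
apply: le_trans (opnormD _ _) _; rewrite (opnormM_unitary _ uB) (opnorm_unitaryM _ uA).
exact: lerD hA hB.
Qed.

Lemma comm_near n (A X D : 'M[C]_n) e : A \is unitarymx -> A *m X = X *m A ->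
  opnorm (X - D) <= e -> opnorm (A *m D - D *m A) <= 2 * e.
Proof.
move=> uA AX XD.
have -> : A *m D - D *m A = (X - D) *m A - A *m (X - D).
  by rewrite mulmxBl mulmxBr AX opprB [RHS]addrC addrA subrK.
apply: le_trans (opnormD _ _) _.
rewrite opnormN (opnormM_unitary _ uA) (opnorm_unitaryM _ uA) mulr_natl mulr2n.
by apply: lerD; exact: XD.
Qed.

Lemma comm_conj n (A D : 'M[C]_n) d : A \is unitarymx ->
  opnorm (A *m D - D *m A) <= d -> opnorm (A^t* *m D *m A - D) <= d.
Proof.
move=> uA AD; have -> : A^t* *m D *m A - D = A^t* *m (D *m A - A *m D).
  by rewrite mulmxBr !mulmxA (unitaryVmx uA) mul1mx.
by rewrite (opnorm_unitaryM _ (unitarymx_adj uA)) opnormBC.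
Qed.

Lemma comm_conjV n (A D : 'M[C]_n) d : A \is unitarymx ->
  opnorm (A *m D - D *m A) <= d -> opnorm (A *m D *m A^t* - D) <= d.
Proof.
move=> uA AD; have -> : A *m D *m A^t* - D = (A *m D - D *m A) *m A^t*.
  by rewrite mulmxBl -!mulmxA (unitarymxV uA) mulmx1.
by rewrite (opnormM_unitary _ (unitarymx_adj uA)).
Qed.

Lemma ui_path_continuous n (h : R -> 'M[C]_n) (g : R -> R) :
  (forall a e : R, 0 < e -> exists2 d : R, 0 < d &
      forall y : R, `|a - y| < d -> opnorm (h a - h y) < e) ->
  (forall a y, `|g a - g y| = `|a - y|) ->
  continuous (fun x : unit_interval R => h (g (set_val x))).
Proof.
move=> hc gi; apply/mx_contP => a e /(hc (g (set_val a)))[d d0 dP].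
by exists d => // y ya; apply: dP; rewrite gi.
Qed.

End Commutators.

(** The chain Psi, v^* D v, (T u)^* D (T u), u^* D u, Phi, the first two terms being conjugated by
    W; its steps cost e, d', d and e. *)
Lemma conj_estimate (R : realType) n (u v T T' D Phi Psi : 'M[complexes R]_n) e d d' :
  u \is unitarymx -> v \is unitarymx -> T \is unitarymx -> T' \is unitarymx ->
  opnorm (u^t* *m D *m u - Phi) <= e -> opnorm (Psi - v^t* *m D *m v) <= e ->
  opnorm (T *m D - D *m T) <= d -> opnorm (T' *m D - D *m T') <= d' ->
  opnorm (((T' *m v)^t* *m (T *m u))^t* *m Psi *m ((T' *m v)^t* *m (T *m u)) - Phi)
    <= e + d' + (d + e).
Proof.
move=> uu uv uT uT' n1 n2 c1 c2.
have [W WE] : exists W, W = (T' *m v)^t* *m (T *m u) by eexists.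
rewrite -WE.
have uTu : T *m u \is unitarymx := mul_unitarymx uT uu.
have uW : W \is unitarymx.
  by rewrite WE; exact: mul_unitarymx (unitarymx_adj (mul_unitarymx uT' uv)) uTu.
have vW : v *m W = T'^t* *m (T *m u).
  by rewrite WE adjmxM !mulmxA (unitarymxV uv) mul1mx.
have Wv : W^t* *m v^t* = (T *m u)^t* *m T'.
  by rewrite -adjmxM vW adjmxM trmxCK.
have d1 : opnorm (W^t* *m Psi *m W - W^t* *m (v^t* *m D *m v) *m W) <= e.
  by rewrite -mulmxBl -mulmxBr (opnorm_conj _ uW).
have d2 : opnorm (W^t* *m (v^t* *m D *m v) *m W - (T *m u)^t* *m D *m (T *m u)) <= d'.
  have -> : W^t* *m (v^t* *m D *m v) *m W =
      (T *m u)^t* *m (T' *m D *m T'^t*) *m (T *m u).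
    by rewrite !mulmxA Wv -(mulmxA _ v W) vW !mulmxA.
  by rewrite -mulmxBl -mulmxBr (opnorm_conj _ uTu); exact: comm_conjV uT' c2.
have d3 : opnorm ((T *m u)^t* *m D *m (T *m u) - u^t* *m D *m u) <= d.
  have -> : (T *m u)^t* *m D *m (T *m u) = u^t* *m (T^t* *m D *m T) *m u.
    by rewrite adjmxM !mulmxA.
  by rewrite -mulmxBl -mulmxBr (opnorm_conj _ uu); exact: comm_conj uT c1.
apply: le_trans (opnorm_dist _ _ ((T *m u)^t* *m D *m (T *m u))) _; apply: lerD.
  by apply: le_trans (opnorm_dist _ _ (W^t* *m (v^t* *m D *m v) *m W)) _; exact: lerD d1 d2.
by apply: le_trans (opnorm_dist _ _ (u^t* *m D *m u)) _; exact: lerD d3 n1.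
Qed.

(** * Approximate unitary equivalence of diagonal maps *)

Section Uniqueness.
Variables (R : realType) (p q p' q' : nat) (i0 : 'I_p) (j0 : 'I_q).
Local Notation C := (complexes R).
Local Notation I := (unit_interval R).
Local Notation Z := (dimdrop R p q).
Local Notation Z' := (dimdrop R p' q').
Local Notation N := (p' * q')%N.
Hypotheses (pq : coprime p q) (p'0 : (0 < p')%N) (q'0 : (0 < q')%N).

(** With any finite type as index and no cast, the list of a composite can be indexed by a
    product. *)
Definition diagonal_by (T : finType) (xi : T -> I -> I) (Phi : Z -> Z') : Prop :=
  (forall t, continuous (xi t)) /\
  exists (sigma : 'I_N -> T * 'I_(p * q)) (u : I -> 'M[C]_N),
    [/\ bijective sigma, continuous u, forall x, u x \is unitarymx &
        forall f x, Phi f x = (u x)^t* *m dg sigma (fun t => f (xi t x)) *m u x].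

Lemma diagonalized_diagonal k (xi : 'I_k -> I -> I) (Phi : Z -> Z') :
  diagonalized_by Phi xi -> diagonal_by xi Phi.
Proof.
move=> [cxi [e [u [cu uu PhiE]]]]; split=> //.
have [sigma [bs sE]] := mxdiag_dg C e.
exists sigma, u; split; [exact: bs|exact: cu|exact: uu|].
by move=> f x; rewrite PhiE sE.
Qed.

Lemma diagonal_reindex (T T' : finType) (h : T -> T') (xi : T' -> I -> I) (Phi : Z -> Z') :
  bijective h -> diagonal_by xi Phi -> diagonal_by (fun t => xi (h t)) Phi.
Proof.
move=> bh [cxi [sigma [u [bs cu uu PhiE]]]]; split=> [t|]; first exact: cxi.
have [h' hK h'K] := bh; have [s' sK s'K] := bs.
pose sigma' i := (h' (sigma i).1, (sigma i).2).
have bs' : bijective sigma'.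
  exists (fun x => s' (h x.1, x.2)) => [i|[t a]]; rewrite /sigma' /=.
    by rewrite h'K -surjective_pairing sK.
  by rewrite s'K /= hK.
exists sigma', u; split; [exact: bs'|exact: cu|exact: uu|].
move=> f x; rewrite PhiE; congr (_ *m _ *m _).
apply/matrixP => i j; rewrite !mxE /sigma' /= !h'K.
by rewrite (inj_eq (can_inj h'K)).
Qed.

(** Values at 0 consist of s = q' equal blocks of size p', values at 1 of s = p' equal blocks of
    size q'. *)
Lemma endpoint_dg (x : I) : x = ui0 R \/ x = ui1 R -> exists s r (tau : 'I_N -> 'I_s * 'I_r),
  [/\ (0 < s)%N, bijective tau,
      forall F : Z', exists D, F x = dg tau (fun=> D) &
      forall D y, y = x -> admissible y (dg tau (fun=> D : 'M[C]_r))].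
Proof.
case=> ->.
  exists q', p', (fun i => ((mxtens_unindex i).2, (mxtens_unindex i).1)); split=> //.
  - exact: mxtens_swap_bij.
  - by move=> F; have [a ->] := (dimdrop_admissible F (ui0 R)).1 erefl; exists a; rewrite tensmx1_dg.
  - move=> D y ->; split=> [_|/ui01//]; exists D; by rewrite tensmx1_dg.
exists p', q', (@mxtens_unindex p' q'); split=> //.
- exact: mxtens_unindex_bij.
- by move=> F; have [a ->] := (dimdrop_admissible F (ui1 R)).2 erefl; exists a; rewrite tens1mx_dg.
- move=> D y ->; split=> [/esym/ui01//|_]; exists D; by rewrite tens1mx_dg.
Qed.

(** [G] is the permutation that sorts the second list at x. Since c is invariant under h, it
    commutes with diag(f o c) exactly, whereas [S] and [S'] commute with the lists at x, which are
    only e-close to this matrix. *)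
Lemma endpoint_data k (xi zeta : 'I_k -> I -> I) (c : 'I_k -> I)
    (sigma : 'I_N -> 'I_k * 'I_(p * q)) (Phi Psi : Z -> Z') (U V : 'M[C]_N)
    (h : 'I_k -> 'I_k) (F : set Z) e (x : I) :
  x = ui0 R \/ x = ui1 R -> bijective sigma -> U \is unitarymx -> V \is unitarymx ->
  (forall f, Phi f x = U^t* *m dg sigma (fun l => f (xi l x)) *m U) ->
  (forall f, Psi f x = V^t* *m dg sigma (fun l => f (zeta l x)) *m V) ->
  sorted_family (xi^~ x) -> bijective h -> sorted_family (fun l => zeta (h l) x) ->
  (forall l, c (h l) = c l) ->
  (forall f, F f -> forall l, opnorm (f (xi l x) - f (c l)) <= e) ->
  (forall f, F f -> forall l, opnorm (f (zeta l x) - f (c l)) <= e) -> 0 <= e ->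
  exists S S' G : 'M[C]_N, [/\ S \is unitarymx, S' \is unitarymx, G \is unitarymx,
    [/\ forall f, F f -> exists2 X, S *m X = X *m S & opnorm (X - dg sigma (f \o c)) <= e,
        forall f, F f -> exists2 X, S' *m X = X *m S' & opnorm (X - dg sigma (f \o c)) <= e &
        forall f : Z, G *m dg sigma (f \o c) = dg sigma (f \o c) *m G] &
    forall y, y = x -> admissible y ((S' *m (G *m V))^t* *m (S *m U))].
Proof.
move=> xE bs uU uV PhiE PsiE xis bh zetas ch nxi nzeta e0.
have [s [r [tau [s0 bt tauF tauA]]]] := endpoint_dg xE.
have /choice[Phi0 Phi0E] := fun f => tauF (Phi f).
have /choice[Psi0 Psi0E] := fun f => tauF (Psi f).
have [G [uG GE]] := dg_reindex C bs bs bh.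
have hU (f : Z) : U^t* *m dg sigma (f \o (xi^~ x)) *m U = dg tau (fun=> Phi0 f).
  by rewrite -Phi0E PhiE.
have GV (f : Z) : (G *m V)^t* *m dg sigma (f \o (fun l => zeta (h l) x)) *m (G *m V) =
    dg tau (fun=> Psi0 f).
  rewrite -Psi0E PsiE (GE (fun l => f (zeta l x))) adjmxM -!mulmxA.
  by rewrite (mulmxA (G^t*) G) (unitaryVmx uG) mul1mx (mulmxA (G^t*) G) (unitaryVmx uG) mul1mx.
have [S [S' [uS uS' Sc Sc' [W WE]]]] :=
  endpoint_align i0 j0 pq bs bt s0 xis zetas uU (mul_unitarymx uG uV) hU GV.
exists S, S', G; split => //.
- split.
  + move=> f Ff; exists (dg sigma (f \o (xi^~ x))); first exact: Sc.
    by rewrite -dgB; apply: opnorm_dg => // l; exact: nxi.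
  + move=> f Ff; exists (dg sigma (f \o (fun l => zeta (h l) x))); first exact: Sc'.
    by rewrite -dgB; apply: opnorm_dg => // l /=; rewrite -ch; exact: nzeta.
  + move=> f; have E := GE (f \o c).
    rewrite -[in RHS](eq_dg sigma (A := (f \o c) \o h)); last by move=> l /=; rewrite ch.
    by rewrite E -!mulmxA (unitaryVmx uG) mulmx1.
- by move=> y yx; rewrite WE; exact: tauA.
Qed.

(* At 0 and 1 the two maps are adjusted by unitaries commuting with their lists, hence
   almost commuting with D = diag(f o c); these are connected to 1 inside their
   bicommutants, so that the intertwining unitary lies in the dimension-drop algebra. *)
Lemma approx_unitary_equiv k (xi zeta : 'I_k -> I -> I) (c : 'I_k -> I)
    (Phi Psi : Z -> Z') (F : set Z) (e : R) :
  diagonal_by xi Phi -> diagonal_by zeta Psi -> 0 <= e ->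
  (forall x, sorted_family (xi^~ x)) ->
  (forall x, exists h : 'I_k -> 'I_k, [/\ bijective h,
     sorted_family (fun l => zeta (h l) x) & forall l, c (h l) = c l]) ->
  (forall f, F f -> forall l x, opnorm (f (xi l x) - f (c l)) <= e) ->
  (forall f, F f -> forall l x, opnorm (f (zeta l x) - f (c l)) <= e) ->
  exists w : Z', (forall x, w x \is unitarymx) /\
    forall f, F f -> forall x,
      opnorm ((w x)^t* *m Psi f x *m w x - Phi f x) <= 10 * e.
Proof.
move=> [_ [sigma [u [bs cu uu PhiE]]]] [_ [sigma' [v' [bs' cv' uv' PsiE']]]] e0.
move=> xis zetas nxi nzeta.
have bid : bijective (fun l : 'I_k => l) by exists id.
have [Q [uQ QE]] := dg_reindex C bs' bs bid.
(* The second map is rewritten with the indexing [sigma] of the first. *)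
pose v x := Q^t* *m v' x.
have uv x : v x \is unitarymx := mul_unitarymx (unitarymx_adj uQ) (uv' x).
have cv : continuous v by exact: (mulmx_continuous (@cst_continuous _ _ (Q^t*)) cv').
have PsiE f x : Psi f x = (v x)^t* *m dg sigma (fun l => f (zeta l x)) *m v x.
  rewrite PsiE' /v adjmxM trmxCK (QE (fun l => f (zeta l x))).
  by rewrite !mulmxA.
have data (x : I) (xe : x = ui0 R \/ x = ui1 R) :=
  let: ex_intro h (And3 bh hs ch) := zetas x in
  @endpoint_data k xi zeta c sigma Phi Psi (u x) (v x) h F e x xe bs (uu x) (uv x)
   (fun f => PhiE f x) (fun f => PsiE f x) (xis x) bh hs ch
   (fun f Ff l => nxi f Ff l x) (fun f Ff l => nzeta f Ff l x) e0.
have [S0 [S0' [G0 [uS0 uS0' uG0 [S0c S0c' G0c] A0]]]] := data _ (or_introl erefl).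
have [S1 [S1' [G1 [uS1 uS1' uG1 [S1c S1c' G1c] A1]]]] := data _ (or_intror erefl).
have [h0 [h00 h01 uh0 ch0 hh0]] := unitary_path uS0.
have [h1 [h10 h11 uh1 ch1 hh1]] := unitary_path uS1.
have [k0 [k00 k01 uk0 ck0 hk0]] := unitary_path uS0'.
have [k1 [k10 k11 uk1 ck1 hk1]] := unitary_path uS1'.
have [g0 [g00 g01 ug0 cg0 hg0]] := unitary_path uG0.
have [g1 [g10 g11 ug1 cg1 hg1]] := unitary_path uG1.
pose a (x : I) := set_val x; pose b (x : I) := 1 - set_val x.
have ai (x y : R) : `|x - y| = `|x - y| by [].
have bi (x y : R) : `|(1 - x) - (1 - y)| = `|x - y|.
  by rewrite opprB addrA addrAC (addrC 1) addrK -opprB addrC normrN; congr `|_|; ring.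
(* [T] is [S0] at 0 and [S1] at 1, because the other factor is 1 there; likewise [T'] is [S0' G0] at
   0 and [S1' G1] at 1. *)
pose T x := h0 (b x) *m h1 (a x).
pose T' x := k0 (b x) *m g0 (b x) *m (k1 (a x) *m g1 (a x)).
have uT x : T x \is unitarymx := mul_unitarymx (uh0 _) (uh1 _).
have uT' x : T' x \is unitarymx :=
  mul_unitarymx (mul_unitarymx (uk0 _) (ug0 _)) (mul_unitarymx (uk1 _) (ug1 _)).
have cT : continuous T.
  exact: mulmx_continuous (ui_path_continuous ch0 bi) (ui_path_continuous ch1 ai).
have cT' : continuous T'.
  apply: mulmx_continuous; apply: mulmx_continuous.
  - exact: ui_path_continuous ck0 bi.
  - exact: ui_path_continuous cg0 bi.
  - exact: (ui_path_continuous ck1 ai).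
  - exact: (ui_path_continuous cg1 ai).
pose W x := (T' x *m v x)^t* *m (T x *m u x).
have [|x|w wE] := @dimdrop_exists R p' q' W.
- exact: (mulmx_continuous (adjmx_continuous (mulmx_continuous cT' cv))
    (mulmx_continuous cT cu)).
- have W0 : W (ui0 R) = (S0' *m (G0 *m v (ui0 R)))^t* *m (S0 *m u (ui0 R)).
    by rewrite /W /T /T' /a /b /= subr0 h01 h10 k01 k10 g01 g10 !mulmx1 -mulmxA.
  have W1 : W (ui1 R) = (S1' *m (G1 *m v (ui1 R)))^t* *m (S1 *m u (ui1 R)).
    by rewrite /W /T /T' /a /b /= subrr h00 h11 k00 k11 g00 g11 !mul1mx -mulmxA.
  split=> xE.
    by rewrite xE W0; exact: (A0 _ erefl).1.
  by rewrite xE W1; exact: (A1 _ erefl).2.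
have uW x : W x \is unitarymx.
  exact: mul_unitarymx (unitarymx_adj (mul_unitarymx (uT' x) (uv x)))
    (mul_unitarymx (uT x) (uu x)).
exists w; split=> [x|f Ff x]; first by rewrite wE; exact: uW.
pose D := dg sigma (f \o c).
have n1 : opnorm ((u x)^t* *m D *m u x - Phi f x) <= e.
  rewrite PhiE -mulmxBl -mulmxBr (opnorm_conj _ (uu x)) -dgB.
  by apply: opnorm_dg => // l /=; rewrite opnormBC; exact: nxi.
have n2 : opnorm (Psi f x - (v x)^t* *m D *m v x) <= e.
  rewrite PsiE -mulmxBl -mulmxBr (opnorm_conj _ (uv x)) -dgB.
  by apply: opnorm_dg => // l; exact: nzeta.
have cm S h t : (forall X t, X *m S = S *m X -> X *m h t = h t *m X) ->
    (forall t : R, h t \is unitarymx) ->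
    (exists2 X, S *m X = X *m S & opnorm (X - D) <= e) ->
    opnorm (h t *m D - D *m h t) <= 2 * e.
  move=> hh uh [X XS XD]; apply: comm_near XD; first exact: uh.
  by apply/esym/hh; exact: esym.
have cm0 S h t : (forall X t, X *m S = S *m X -> X *m h t = h t *m X) ->
    S *m D = D *m S -> opnorm (h t *m D - D *m h t : 'M[C]_N) <= 0.
  by move=> hh SD; rewrite (hh D t (esym SD)) subrr opnorm0.
have c1 : opnorm (T x *m D - D *m T x) <= 2 * e + 2 * e :=
  comm_mulmx (uh0 _) (uh1 _) (cm _ _ _ hh0 uh0 (S0c f Ff)) (cm _ _ _ hh1 uh1 (S1c f Ff)).
have c2 : opnorm (T' x *m D - D *m T' x) <= 2 * e + 0 + (2 * e + 0) :=
  comm_mulmx (mul_unitarymx (uk0 _) (ug0 _)) (mul_unitarymx (uk1 _) (ug1 _))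
    (comm_mulmx (uk0 _) (ug0 _) (cm _ _ _ hk0 uk0 (S0c' f Ff)) (cm0 _ _ _ _ hg0 (G0c f)))
    (comm_mulmx (uk1 _) (ug1 _) (cm _ _ _ hk1 uk1 (S1c' f Ff)) (cm0 _ _ _ _ hg1 (G1c f))).
rewrite wE; apply: le_trans (conj_estimate (uu x) (uv x) (uT x) (uT' x) n1 n2 c1 c2) _.
(* Four paths cost 2 e each, the paths of the permutations nothing, the two approximations e
   each. *)
have -> : e + (2 * e + 0 + (2 * e + 0)) + (2 * e + 2 * e + e) = 10 * e by ring.
exact: lexx.
Qed.

End Uniqueness.

(** * Operations on diagonal maps *)

Section DiagonalMaps.
Variable R : realType.
Local Notation C := (complexes R).
Local Notation I := (unit_interval R).

Lemma diagonal_star_hom p q p' q' (T : finType) (xi : T -> I -> I)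
    (Phi : dimdrop R p q -> dimdrop R p' q') : diagonal_by xi Phi -> star_hom Phi.
Proof.
move=> [_ [sigma [u [bs cu uu PhiE]]]].
have UU x (A B : 'M[C]_(p' * q')) :
    ((u x)^t* *m A *m u x) *m ((u x)^t* *m B *m u x) = (u x)^t* *m (A *m B) *m u x.
  by rewrite -!mulmxA [u x *m ((u x)^t* *m _)]mulmxA (unitarymxV (uu x)) mul1mx.
split.
- move=> a f g; apply: dimdropP => x; rewrite dimdropDE dimdropZE !PhiE.
  have -> : dg sigma (fun t => (a *: f + g) (xi t x)) =
      a *: dg sigma (fun t => f (xi t x)) + dg sigma (fun t => g (xi t x)).
    by rewrite -dg_linear.
  by rewrite mulmxDr mulmxDl -scalemxAr -scalemxAl.
- move=> f g; apply: dimdropP => x.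
  transitivity (Phi f x *m Phi g x); last by [].
  rewrite !PhiE UU (dgM bs).
  by [].
- move=> f; apply: dimdropP => x.
  transitivity ((Phi f x)^t*); last by [].
  rewrite !PhiE !adjmxM trmxCK mulmxA dg_adj.
  by [].
Qed.

Lemma dg_continuous (T : finType) N d (sigma : 'I_N -> T * 'I_d) (A : T -> I -> 'M[C]_d) :
  (forall t, continuous (A t)) -> continuous (fun x => dg sigma (A^~ x)).
Proof.
move=> cA; apply/mx_continuousP => i j.
have -> : (fun x => dg sigma (A^~ x) i j) =
    if (sigma i).1 == (sigma j).1
    then (fun x => A (sigma i).1 x (sigma i).2 (sigma j).2) else (fun=> 0).
  by apply/funext => x; rewrite mxE; case: ifP.
case: ifP => _; last exact: cst_continuous.
by have /mx_continuousP := cA (sigma i).1; apply.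
Qed.

Lemma dimdrop_comp_continuous p q (f : dimdrop R p q) (g : I -> I) :
  continuous g -> continuous (fun x => f (g x)).
Proof.
move=> cg x; apply: (@continuous_comp _ _ _ g f); first exact: cg.
exact: dimdrop_continuous.
Qed.

Lemma diagonal_comp p q p' q' p'' q'' (T T' : finType) (xi : T -> I -> I)
    (zeta : T' -> I -> I) (Phi : dimdrop R p q -> dimdrop R p' q')
    (Psi : dimdrop R p' q' -> dimdrop R p'' q'') :
  diagonal_by xi Phi -> diagonal_by zeta Psi ->
  diagonal_by (fun (s : T' * T) x => xi s.2 (zeta s.1 x)) (Psi \o Phi).
Proof.
move=> [cxi [s1 [u [bs1 cu uu PhiE]]]] [czeta [s2 [v [bs2 cv uv PsiE]]]]; split.
  move=> [t' t] x /=; apply: (@continuous_comp _ _ _ (zeta t') (xi t)).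
    exact: czeta.
  exact: cxi.
exists (fun i => (((s2 i).1, (s1 (s2 i).2).1), (s1 (s2 i).2).2)).
exists (fun x => dg s2 (fun t => u (zeta t x)) *m v x).
have udu x : dg s2 (fun t => u (zeta t x)) \is unitarymx.
  by apply: dg_unitary; [exact: bs2|move=> t; exact: uu].
split.
- exact: dg_dg_bij.
- apply: mulmx_continuous; last exact: cv.
  apply: (dg_continuous (A := fun t x => u (zeta t x))) => t x.
  by apply: (@continuous_comp _ _ _ (zeta t) u); [exact: czeta|exact: cu].
- by move=> x; exact: mul_unitarymx (udu x) (uv x).
move=> f x; rewrite /= PsiE adjmxM.
rewrite -(dg_dg s2 s1 (fun t' t => f (xi t (zeta t' x)))) dg_adj.
have -> : dg s2 (fun t => Phi f (zeta t x)) = dg s2 (fun t => (u (zeta t x))^t*) *m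
    dg s2 (fun t' => dg s1 (fun t => f (xi t (zeta t' x)))) *m
    dg s2 (fun t => u (zeta t x)).
  by rewrite !(dgM bs2); apply: eq_dg => t; rewrite PhiE.
by rewrite !mulmxA.
Qed.

Definition conj_map p q p' q' (w : dimdrop R p' q') (Phi : dimdrop R p q -> dimdrop R p' q')
    (f : dimdrop R p q) : dimdrop R p' q' :=
  dimdrop_mul (dimdrop_mul (dimdrop_star w) (Phi f)) w.

Lemma diagonal_conj p q p' q' (T : finType) (xi : T -> I -> I) (w : dimdrop R p' q')
    (Phi : dimdrop R p q -> dimdrop R p' q') :
  (forall x, w x \is unitarymx) -> diagonal_by xi Phi -> diagonal_by xi (conj_map w Phi).
Proof.
move=> uw [cxi [sigma [u [bs cu uu PhiE]]]]; split; first exact: cxi.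
exists sigma, (fun x => u x *m w x); split.
- exact: bs.
- exact: (mulmx_continuous cu (@dimdrop_continuous _ _ _ w)).
- by move=> x; exact: mul_unitarymx (uu x) (uw x).
move=> f x; rewrite adjmxM.
transitivity ((w x)^t* *m Phi f x *m w x); first by [].
by rewrite PhiE !mulmxA.
Qed.

End DiagonalMaps.

(** * Existence of a diagonal map along a grid *)

Section Existence.
Variables (R : realType) (p q : nat).
Local Notation I := (unit_interval R).
Hypotheses (pq : coprime p q) (p0 : (0 < p)%N).

(** With p u = v q + 1, the pair a = k p u, b = k - k p u = - k v q solves the congruences, because
    s divides k p q. The remainders modulo s have a sum below 2 s, hence at most k. *)
Lemma block_params_exist s k : (0 < s)%N -> (2 * s <= k)%N -> (s %| k * (p * q))%N ->
  exists a b, [/\ (a < s)%N, (b < s)%N & block_params p q s k a b].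
Proof.
move=> s0 sk skpq.
have [u [v uv]] : exists u v, (p * u = v * q + 1)%N.
  case: (@egcdnP p q p0) => u v e _; exists u, v.
  by rewrite mulnC e (eqP pq).
(* In b, the factor [s.-1] stands for -1 modulo s and keeps the number natural. *)
pose a := (k * p * u)%N; pose b := (k * p * u * s.-1 + k)%N.
have ab : (a + b = k * p * u * s + k)%N.
  rewrite /a /b addnA; congr addn; rewrite -{2}(prednK s0) mulnS.
  by [].
have aq : (s %| a * q)%N.
  have -> : (a * q = k * (p * q) * u)%N by rewrite /a; ring.
  exact: dvdn_mulr.
have bp : (s %| b * p)%N.
  have -> : (b * p = k * (p * q) * (v * s.-1) + (k * p) * s)%N.
    transitivity (k * p * ((p * u) * s.-1 + 1))%N; first by rewrite /b; ring.
    have [s' ->] : exists s', s = s'.+1 by exists s.-1; rewrite prednK.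
    by rewrite uv /=; ring.
  by apply: dvdn_add; [exact: dvdn_mulr|exact: dvdn_mull].
have asb : (a %% s + b %% s <= k)%N.
  by apply: leq_trans sk; rewrite mul2n -addnn; apply: leq_add; apply: ltnW; rewrite ltn_mod.
exists (a %% s)%N, (b %% s)%N; rewrite !ltn_mod; split=> //; split=> //.
- by rewrite /dvdn modnMml.
- by rewrite /dvdn modnMml.
- by rewrite -eqn_mod_dvd // modnDm ab modnMDl.
Qed.

(** Each cell of the grid has m positions. As s <= m, giving a whole group the grid point of its
    last position moves at most to the right end of the cell; the zeros and ones split off lie in
    the first and the last cell. *)
Lemma grid_blocks s m S (c : nat -> I) : (0 < s)%N -> (0 < S)%N -> (2 * s <= m)%N ->
  (s %| (S * m) * (p * q))%N -> c 0%N = ui0 R -> c S = ui1 R ->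
  (forall i j, (i <= j <= S)%N -> set_val (c i) <= set_val (c j)) ->
  exists a b (y : 'I_(S * m) -> I),
    [/\ block_params p q s (S * m) a b, block_list s a b y, sorted_family y &
        forall l : 'I_(S * m), set_val (c (l %/ m)%N) <= set_val (y l) <= set_val (c (l %/ m).+1)].
Proof.
move=> s0 S0 sm sd c0 cS cm.
have m0 : (0 < m)%N by apply: leq_trans sm; rewrite muln_gt0.
have smk : (2 * s <= S * m)%N by apply: leq_trans sm _; rewrite leq_pmull.
have [a [b [a_s b_s par]]] := block_params_exist s0 smk sd.
have [abk aq bp kab] := par.
(* The last position of the group of l. *)
pose t l := (a + (l - a) %/ s * s + s.-1)%N.
pose y (l : 'I_(S * m)) : I := if (l < a)%N then ui0 R else
  if (S * m - b <= l)%N then ui1 R else c (t l %/ m)%N.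
have tl l : (a <= l)%N -> (l <= t l)%N.
  move=> al; rewrite /t -{1}(subnKC al) -addnA leq_add2l {1}(divn_eq (l - a) s).
  by rewrite leq_add2l -ltnS prednK // ltn_mod.
have tl' l : (a <= l)%N -> (t l < l + s)%N.
  move=> al; rewrite /t -{2}(subnKC al) -!addnA ltn_add2l.
  by rewrite (leq_ltn_trans (n := (l - a) + s.-1)) ?leq_add2r ?leq_divM // ltn_add2l prednK.
have tk l : (a <= l)%N -> (l < S * m - b)%N -> (t l < S * m)%N.
  move=> al lb; have d : ((l - a) %/ s < (S * m - (a + b)) %/ s)%N.
    rewrite ltn_divLR // divnK // subnDA subnAC ltn_sub2r //.
    exact: leq_ltn_trans al lb.
  have : ((l - a) %/ s * s + s <= S * m - (a + b))%N.
    by rewrite -mulSnr -(divnK kab) leq_mul2r d orbT.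
  rewrite /t; move: ((l - a) %/ s * s)%N s0 abk; clear; lia.
have divS l : (l < S * m)%N -> (l %/ m < S)%N by move=> lk; rewrite ltn_divLR.
have c01 i : (i <= S)%N -> set_val (ui0 R) <= set_val (c i) <= set_val (ui1 R).
  by move=> iS; rewrite /=; exact: ui_itv.
exists a, b, y; split=> //.
- split.
  + by move=> l la; rewrite /y la.
  + move=> l lb; rewrite /y lb; case: ifP => // la; exfalso.
    by move: la lb abk (ltn_ord l) smk a_s b_s; move: (S * m)%N (nat_of_ord l); clear; lia.
  + move=> l l' /andP[al lb] /andP[al' lb'] e.
    have nl (i : 'I_(S * m)) : (a <= i)%N -> (i < S * m - b)%N -> y i = c (t i %/ m)%N.
      by move=> ai ib; rewrite /y ltnNge ai leqNgt ib.
    by rewrite !nl // /t e.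
- move=> i j ij; rewrite /y.
  case: ifP => [_|/negbT]; first by have := ui_itv (if (j < a)%N then ui0 R else
    if (S * m - b <= j)%N then ui1 R else c (t j %/ m)%N) => /andP[].
  rewrite -leqNgt => ai; rewrite ltnNge (leq_trans ai ij) /=.
  case: ifP => [ib|/negbT]; first by rewrite (leq_trans ib ij).
  rewrite -ltnNge => ib; case: ifP => [_|/negbT].
    by have /andP[] := ui_itv (c (t i %/ m)%N).
  rewrite -ltnNge => jb; apply: cm; apply/andP; split.
    by apply: leq_div2r; rewrite /t leq_add2r leq_add2l leq_mul2r leq_div2r ?orbT // leq_sub2r.
  by apply/ltnW/divS/tk => //; exact: leq_trans ai ij.
- move=> l; rewrite /y; have lS := divS _ (ltn_ord l).
  case: ifP => [la|/negbT].
    have -> : (l %/ m = 0)%N.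
      by rewrite divn_small //; move: la a_s sm s0; move: (nat_of_ord l); clear; lia.
    by rewrite c0 lexx -c0 cm //= S0.
  rewrite -leqNgt => al; case: ifP => [lb|/negbT].
    have e : ((l %/ m).+1 = S)%N.
      have h : (S.-1 <= l %/ m)%N.
        rewrite leq_divRL //; apply: leq_trans lb.
        have -> : (S * m = m + S.-1 * m)%N by rewrite -mulSn prednK.
        by move: (S.-1 * m)%N b_s sm s0; clear; lia.
      by apply/eqP; rewrite eqn_leq lS /=; rewrite -ltnS prednK in h.
    rewrite e cS lexx andbT.
    by have /andP[] := ui_itv (c (l %/ m)%N).
  rewrite -ltnNge => lb; have tS := divS _ (tk _ al lb).
  apply/andP; split; apply: cm.
    by rewrite leq_div2r ?tl // ltnW.
  rewrite lS andbT -ltnS ltn_divLR // mulSn addnC.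
  apply: leq_trans (tl' _ al) _; rewrite {1}(divn_eq l m) mulSn.
  by have := ltn_pmod l m0; move: (l %/ m * m)%N (l %% m)%N sm; clear; lia.
Qed.

Variables p' q' : nat.
Hypotheses (p'0 : (0 < p')%N) (q'0 : (0 < q')%N).

(** The list at 0 is made of groups of q', the list at 1 of groups of p'; different permutation
    matrices [P0] and [P1] bring them into block form. The unitary u runs from one to the other, so
    the values at both ends are admissible, and by convexity the interpolated list stays in the
    cells. *)
Lemma diagonal_exists m S (c : nat -> I) :
  (0 < S)%N -> (2 * p' <= m)%N -> (2 * q' <= m)%N -> ((S * m) * (p * q) = p' * q')%N ->
  c 0%N = ui0 R -> c S = ui1 R ->
  (forall i j, (i <= j <= S)%N -> set_val (c i) <= set_val (c j)) ->
  exists (zeta : 'I_(S * m) -> I -> I) (alpha : dimdrop R p q -> dimdrop R p' q'),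
    diagonal_by zeta alpha /\
    forall (l : 'I_(S * m)) x, set_val (c (l %/ m)%N) <= set_val (zeta l x) <= set_val (c (l %/ m).+1).
Proof.
move=> S0 pm qm kN c0 cS cm.
have [|a0 [b0 [y0 [par0 bl0 s0 cy0]]]] := grid_blocks q'0 S0 qm _ c0 cS cm.
  by rewrite kN dvdn_mull.
have [|a1 [b1 [y1 [par1 bl1 s1 cy1]]]] := grid_blocks p'0 S0 pm _ c0 cS cm.
  by rewrite kN dvdn_mulr.
have [sigma bs] : exists sigma : 'I_(p' * q') -> 'I_(S * m) * 'I_(p * q), bijective sigma.
  by rewrite -kN; exists (@mxtens_unindex _ _); exact: mxtens_unindex_bij.
have [P0 [uP0 P0E]] := block_frame R bs (mxtens_swap_bij p' q') q'0 par0.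
have [P1 [uP1 P1E]] := block_frame R bs (mxtens_unindex_bij p' q') p'0 par1.
have [h [h0 h1 uh ch _]] := unitary_path (mul_unitarymx (unitarymx_adj uP0) uP1).
have /choice[zeta0 zeta0E] : forall lx : 'I_(S * m) * I, exists z : I,
    set_val z = (1 - set_val lx.2) * set_val (y0 lx.1) + set_val lx.2 * set_val (y1 lx.1).
  move=> [l x]; apply: ui_exists => /=.
  have /andP[x0 x1] := ui_itv x; have /andP[u0 u1] := ui_itv (y0 l).
  have /andP[v0 v1] := ui_itv (y1 l).
  by move: (set_val x) (set_val (y0 l)) (set_val (y1 l)) x0 x1 u0 u1 v0 v1 => *; nra.
pose zeta l x := zeta0 (l, x).
have zetaE l x : set_val (zeta l x) =
    (1 - set_val x) * set_val (y0 l) + set_val x * set_val (y1 l) by exact: zeta0E.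
have czeta l : continuous (zeta l).
  apply/ui_contP => x e e0; exists e => // y xy; rewrite !zetaE.
  apply: le_lt_trans xy.
  have -> : (1 - set_val x) * set_val (y0 l) + set_val x * set_val (y1 l) -
      ((1 - set_val y) * set_val (y0 l) + set_val y * set_val (y1 l)) =
      (set_val x - set_val y) * (set_val (y1 l) - set_val (y0 l)) by ring.
  rewrite normrM ler_piMr // ler_norml.
  have /andP[u0 u1] := ui_itv (y0 l); have /andP[v0 v1] := ui_itv (y1 l).
  by move: (set_val (y0 l)) (set_val (y1 l)) u0 u1 v0 v1 => *; apply/andP; split; lra.
pose u (x : I) := P0 *m h (set_val x).
have uu x : u x \is unitarymx := mul_unitarymx uP0 (uh _).
have cu : continuous u.
  apply: (mulmx_continuous (@cst_continuous _ _ P0)).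
  exact: (@ui_path_continuous R _ h id ch).
have z0 l : zeta l (ui0 R) = y0 l.
  by apply: ui_inj; rewrite zetaE /= subr0 mul1r mul0r addr0.
have z1 l : zeta l (ui1 R) = y1 l.
  by apply: ui_inj; rewrite zetaE /= subrr mul1r mul0r add0r.
have /choice[alpha alphaE] : forall f : dimdrop R p q, exists F : dimdrop R p' q',
    forall x, F x = (u x)^t* *m dg sigma (fun l => f (zeta l x)) *m u x.
  move=> f; apply: dimdrop_exists.
    apply: mulmx_continuous; last exact: cu.
    apply: mulmx_continuous; first exact: adjmx_continuous.
    apply: (dg_continuous (A := fun l x => f (zeta l x))) => l.
    exact: dimdrop_comp_continuous.
  move=> x; split=> xE.
    have [D DE] := P0E _ bl0 f; exists D; rewrite tensmx1_dg -DE xE /u h0 mulmx1.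
    by congr (_ *m _ *m _); apply: eq_dg => l /=; rewrite z0.
  have [D DE] := P1E _ bl1 f; exists D; rewrite tens1mx_dg -DE xE /u h1.
  have -> : P0 *m (P0^t* *m P1) = P1 by rewrite mulmxA (unitarymxV uP0) mul1mx.
  by congr (_ *m _ *m _); apply: eq_dg => l /=; rewrite z1.
exists zeta, alpha; split.
  split; first exact: czeta.
  by exists sigma, u; split; [exact: bs|exact: cu|exact: uu|exact: alphaE].
move=> l x; rewrite zetaE; have /andP[x0 x1] := ui_itv x.
have /andP[u0 u1] := cy0 l; have /andP[v0 v1] := cy1 l.
move: (set_val x) (set_val (y0 l)) (set_val (y1 l)) x0 x1 u0 u1 v0 v1.
move: (set_val (c (l %/ m)%N)) (set_val (c (l %/ m).+1)) => A B x' U V *.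
by apply/andP; split; nra.
Qed.

End Existence.

(** * The norm of a dimension-drop algebra *)

Section Norm.
Variables (R : realType) (p q : nat).
Local Notation C := (complexes R).
Local Notation Z := (dimdrop R p q).

Definition dnorm (f : Z) : R := sup (range (fun t => opnorm (f t))).

Lemma opnorm_le_dnorm (f : Z) x : opnorm (f x) <= dnorm f.
Proof.
apply: ub_le_sup; last by exists x.
have [M fM] := mx_cont_bounded (@dimdrop_continuous _ _ _ f).
by exists M => _ [t _ <-]; exact: fM.
Qed.

Lemma dnorm_le (f : Z) e : (forall x, opnorm (f x) <= e) -> dnorm f <= e.
Proof.
move=> fe; apply: ge_sup; first by exists (opnorm (f (ui0 R))), (ui0 R).
by move=> _ [t _ <-]; exact: fe.
Qed.

Lemma dnorm_nneg (f : Z) : 0 <= dnorm f.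
Proof. exact: le_trans (opnorm_ge0 _) (opnorm_le_dnorm f (ui0 R)). Qed.

Lemma dnormE (f : Z) : dimdrop_norm f = (dnorm f)%:C%C. Proof. by []. Qed.

Lemma dscalar_exists (g : R -> R) : continuous g ->
  exists f : Z, forall x, f x = ((g (set_val x))%:C%C : C) *: 1%:M.
Proof.
move=> cg; apply: dimdrop_exists; first exact: scalar_path_continuous.
move=> x; split=> _.
  by exists (((g (set_val x))%:C%C : C) *: 1%:M); rewrite tensmxZl tensmx11.
by exists (((g (set_val x))%:C%C : C) *: 1%:M); rewrite tensmxZr tensmx11.
Qed.

End Norm.

Definition diagonal (R : realType) p q p' q' (Phi : dimdrop R p q -> dimdrop R p' q') : Prop :=
  exists k (xi : 'I_k -> unit_interval R -> unit_interval R), diagonal_by xi Phi.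

Lemma diagonal_dnorm (R : realType) p q p' q' (T : finType)
    (xi : T -> unit_interval R -> unit_interval R)
    (Phi : dimdrop R p q -> dimdrop R p' q') f :
  diagonal_by xi Phi -> dnorm (Phi f) <= dnorm f.
Proof.
move=> [_ [sigma [u [bs _ uu PhiE]]]]; apply: dnorm_le => x.
rewrite PhiE (opnorm_conj _ (uu x)); apply: (opnorm_dg bs); first exact: dnorm_nneg.
by move=> t; exact: opnorm_le_dnorm.
Qed.

(** * What a diagonal map determines about its list *)

Section DiagonalLists.
Variables (R : realType) (p q p' q' : nat).
Local Notation C := (complexes R).
Local Notation I := (unit_interval R).
Local Notation Z := (dimdrop R p q).
Hypotheses (p0 : (0 < p)%N) (q0 : (0 < q)%N).
Local Notation Z' := (dimdrop R p' q').

(** Otherwise a nonzero scalar function supported near z would be in the kernel. *)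
Lemma dense_images (T : finType) (xi : T -> I -> I) (Phi : Z -> Z') :
  diagonal_by xi Phi -> injective Phi ->
  forall (z : I) (d : R), 0 < d -> exists t x, `|set_val (xi t x) - set_val z| < d.
Proof.
move=> xiPhi Phi_inj z d d0; apply: contrapT => nz.
(* Twice the positive part of d - |x - z|. *)
pose g (x : R) := (d - `|x - set_val z|) + `|d - `|x - set_val z| |.
have cg : continuous g.
  have cd : continuous (fun x : R => d - `|x - set_val z|).
    move=> x; apply: cvgB; first exact: cvg_cst.
    by apply: cvg_norm; apply: cvgB; [exact: cvg_id|exact: cvg_cst].
  by move=> x; apply: cvgD; [exact: cd|apply: cvg_norm; exact: cd].
have [f fE] := dscalar_exists p q cg.
have [_ [sigma [u [bs cu uu PhiE]]]] := xiPhi.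
have Phi0 : Phi f = Phi 0.
  apply: dimdropP => x; rewrite !PhiE; congr (_ *m _ *m _); apply: eq_dg => t.
  rewrite fE dimdrop0E /g; apply/eqP; rewrite scaler_eq0; apply/orP; left.
  apply/eqP; have h : d - `|set_val (xi t x) - set_val z| <= 0.
    by rewrite subr_le0 leNgt; apply/negP => h; apply: nz; exists t, x.
  by rewrite (ler0_norm h) subrr.
have /(congr1 (fun F : Z => F z)) := Phi_inj _ _ Phi0.
rewrite fE dimdrop0E /g subrr normr0 subr0 => /matrixP.
have i0 : 'I_(p * q) by exists 0%N; rewrite muln_gt0 p0.
move=> /(_ i0 i0); rewrite !mxE eqxx mulr1 => /eqP.
rewrite eq_complex /= => /andP[/eqP d00 _].
have d2 : d + d = 0 by rewrite -[X in _ + X](gtr0_norm d0).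
by move: (addr_gt0 d0 d0); rewrite d2 ltxx.
Qed.

(** The norm of [Phi f] at x is that of a block-diagonal matrix with blocks f(xi_t(x)), and the
    points xi_t(x) come arbitrarily close to any point. *)
Lemma diagonal_isometric (T : finType) (xi : T -> I -> I) (Phi : Z -> Z') :
  diagonal_by xi Phi -> injective Phi -> forall f, dnorm (Phi f) = dnorm f.
Proof.
move=> xiPhi Phi_inj f; have [_ [sigma [u [bs cu uu PhiE]]]] := xiPhi.
have nE x : opnorm (Phi f x) = opnorm (dg sigma (fun t => f (xi t x))).
  by rewrite PhiE (opnorm_conj _ (uu x)).
apply: le_anti; apply/andP; split; apply: dnorm_le => x.
  rewrite nE; apply: opnorm_dg; first exact: bs.
    exact: dnorm_nneg.
  by move=> t; exact: opnorm_le_dnorm.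
apply/ler_addgt0Pr => e e0.
have [d d0 fd] := mx_cont_unif (@dimdrop_continuous _ _ _ f) e0.
have [t [z zx]] := dense_images xiPhi Phi_inj x d0.
have h1 : opnorm (f (xi t z)) <= dnorm (Phi f).
  apply: le_trans (opnorm_le_dnorm _ z); rewrite nE.
  exact: (opnorm_dg_ge bs (fun t => f (xi t z))).
have h2 := opnormD (f x - f (xi t z)) (f (xi t z)).
rewrite subrK in h2; apply: le_trans h2 _.
rewrite addrC; apply: lerD; first exact: h1.
by apply: ltW; apply: fd; rewrite distrC.
Qed.

(** For a scalar f equal to 1 at z and to 0 at the other points of both lists, the trace of [Phi f]
    at x is p q times the number of occurrences of z. So the list at x is determined up to order,
    and a composite list may be compared with a sorted one. *)
Lemma scalar_card (T T' : finType) (xi : T -> I -> I) (eta : T' -> I -> I) (Phi : Z -> Z') :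
  diagonal_by xi Phi -> diagonal_by eta Phi ->
  forall x z, #|[pred t | xi t x == z]| = #|[pred t | eta t x == z]|.
Proof.
move=> xiPhi etaPhi x z.
have trE (S : finType) (y : S -> I -> I) (f : Z) : diagonal_by y Phi ->
    \tr (Phi f x) = \sum_t \tr (f (y t x)).
  move=> [_ [sigma [u [bs cu uu PhiE]]]].
  by rewrite PhiE mxtrace_mulC mulmxA (unitarymxV (uu x)) mul1mx (mxtrace_dg bs).
have [b [cb bz b0]] := bump_exists (set_val z)
  ([seq set_val (xi t x) | t : T] ++ [seq set_val (eta t x) | t : T']).
have [f fE] := dscalar_exists p q cb.
have cardE (S : finType) (y : S -> I -> I) : diagonal_by y Phi ->
    (forall t, set_val (y t x) \in [seq set_val (xi t x) | t : T] ++
       [seq set_val (eta t x) | t : T']) ->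
    \tr (Phi f x) = (#|[pred t | y t x == z]| * (p * q))%:R.
  move=> yPhi ym; rewrite (trE _ y) //.
  rewrite (eq_bigr (fun t => if y t x == z then (p * q)%:R else 0)); last first.
    move=> t _; rewrite fE; case: eqP => [->|yz].
      by rewrite bz scale1r mxtrace1.
    by rewrite b0 ?scale0r ?mxtrace0 //; apply/eqP => /ui_inj.
  by rewrite -big_mkcond sumr_const -mulrnA mulnC.
have h1 := cardE _ _ xiPhi; have h2 := cardE _ _ etaPhi.
have : (#|[pred t | xi t x == z]| * (p * q))%:R = (#|[pred t | eta t x == z]| * (p * q))%:R :> C.
  rewrite -h1 ?h2 // => t; rewrite mem_cat; apply/orP; [right|left];
    by apply/mapP; exists t; rewrite ?mem_enum.
by move=> /eqP; rewrite eqr_nat eqn_mul2r muln_eq0 !eqn0Ngt p0 q0 /= => /eqP.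
Qed.

End DiagonalLists.

(** * Rearranging and sorting lists *)

Section Rearrangement.

(** An element goes to the element of the same rank in the corresponding fibre. *)
Lemma equal_fibers_bij (T T' : finType) (V : eqType) (f : T -> V) (f' : T' -> V) :
  (forall z, #|[pred t | f t == z]| = #|[pred t | f' t == z]|) ->
  exists h : T -> T', bijective h /\ forall t, f t = f' (h t).
Proof.
have inj (U U' : finType) (g : U -> V) (g' : U' -> V) :
    (forall z, #|[pred t | g t == z]| = #|[pred t | g' t == z]|) ->
    exists h : U -> U', injective h /\ forall t, g t = g' (h t).
  move=> gg; have /choice[h hP] : forall t, exists t', g' t' = g t /\
      index t' (enum [pred s | g' s == g t]) = index t (enum [pred s | g s == g t]).
    move=> t; have tE : t \in enum [pred s | g s == g t] by rewrite mem_enum inE.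
    have iE : (index t (enum [pred s | g s == g t]) < size (enum [pred s | g' s == g t]))%N.
      by rewrite -cardE -gg cardE index_mem.
    have [t0 _] : exists t0 : U', True.
      by move: iE; case: (enum [pred s | g' s == g t]) => [|t0 s] //; exists t0.
    exists (nth t0 (enum [pred s | g' s == g t]) (index t (enum [pred s | g s == g t]))).
    split; last by rewrite index_uniq // enum_uniq.
    by have := mem_nth t0 iE; rewrite mem_enum inE => /eqP.
  exists h; split=> [t t' e|t]; last by have [->] := hP t.
  have [g1 i1] := hP t; have [g2 i2] := hP t'.
  have gt : g t = g t' by rewrite -g1 -g2 e.
  have tE : t \in enum [pred s | g s == g t'] by rewrite mem_enum inE gt.
  have tE' : t' \in enum [pred s | g s == g t'] by rewrite mem_enum inE.
  rewrite gt e in i1.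
  by rewrite -[LHS](nth_index t tE) -i1 i2 (nth_index t tE').
move=> ff; have [h [hi hE]] := inj _ _ _ _ ff.
have [h' [hi' _]] := inj _ _ f' f (fun z => esym (ff z)).
exists h; split=> //; apply: inj_card_bij => //.
by rewrite -(card_codom hi'); exact: max_card.
Qed.

(** Sorting by the pair (g, y): since g was already monotone, its sorted values are the original
    ones and every position keeps its group. *)
Lemma sort_groups d (V : orderType d) k (g : 'I_k -> nat) (y : 'I_k -> V) :
  (forall i j : 'I_k, (i <= j)%N -> (g i <= g j)%N) ->
  (forall i j, (g i < g j)%N -> (y i <= y j)%O) ->
  exists h : 'I_k -> 'I_k, [/\ bijective h,
    forall i j : 'I_k, (i <= j)%N -> (y (h i) <= y (h j))%O & forall i, g (h i) = g i].
Proof.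
move=> gm gy; pose le i j := (g i < g j)%N || ((g i == g j) && (y i <= y j)%O).
have le_tr : transitive le.
  move=> j i l /orP[ij|/andP[/eqP ij yij]] /orP[jl|/andP[/eqP jl yjl]]; apply/orP.
  - by left; exact: ltn_trans jl.
  - by left; rewrite -jl.
  - by left; rewrite ij.
  - by right; rewrite ij jl eqxx /=; exact: le_trans yjl.
have le_tot : total le.
  move=> i j; rewrite /le; case: (ltngtP (g i) (g j)) => //= _.
  exact: le_total.
have le_refl : reflexive le by move=> i; rewrite /le eqxx lexx orbT.
pose s := sort le (enum 'I_k).
have ss : size s = k by rewrite size_sort size_enum_ord.
have us : uniq s by rewrite sort_uniq enum_uniq.
have so : sorted le s by exact: sort_sorted.
pose h (i : 'I_k) := nth i s i.
have hE x0 (i : 'I_k) : h i = nth x0 s i by apply: set_nth_default; rewrite ss.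
have hle (i j : 'I_k) : (i <= j)%N -> le (h i) (h j).
  move=> ij; rewrite (hE i j); apply: (sorted_leq_nth le_tr le_refl _ so) => //; by rewrite inE ss.
have gh i : g (h i) = g i.
  have e : [seq g i | i <- s] = [seq g i | i <- enum 'I_k].
    apply: (sorted_eq leq_trans anti_leq).
    - rewrite sorted_map; apply: sub_sorted so => a b /orP[/ltnW //|/andP[/eqP e _]].
      by rewrite /= e.
    - have : sorted ltn [seq val i | i <- enum 'I_k] by rewrite val_enum_ord iota_ltn_sorted.
      rewrite !sorted_map; apply: sub_sorted => a b /= ab.
      by apply: gm; exact: ltnW.
    - by apply: perm_map; rewrite perm_sort.
  have ik : (i < size s)%N by rewrite ss.
  by rewrite /h -(nth_map i 0%N g ik) e (nth_map i) ?size_enum_ord // nth_ord_enum.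
exists h; split=> [|i j ij|//].
  apply: injF_bij => i j e; apply: ord_inj; apply/eqP.
  by rewrite -(nth_uniq i _ _ us) ?ss // -/(h i) e (hE i j).
have /orP[gij|/andP[_ //]] := hle i j ij.
exact: gy.
Qed.

End Rearrangement.

Section SortedNear.
Variables (R : realType) (S k : nat) (xi : 'I_(S * k) -> R) (eta : 'I_k * 'I_S -> R)
  (h : 'I_(S * k) -> 'I_k * 'I_S) (lo hi : 'I_S -> R).
Hypotheses (hI : injective h) (xiE : forall l, xi l = eta (h l))
  (xis : forall i j : 'I_(S * k), (i <= j)%N -> xi i <= xi j).

(** If entry l were below the bound of group g, the first l + 1 entries would all come from groups
    before g, which together hold only k g <= l entries. *)
Lemma sorted_near_lo : (forall i j : 'I_S, (i <= j)%N -> lo i <= lo j) ->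
  (forall s i, lo i <= eta (s, i)) ->
  forall (l : 'I_(S * k)) (g : 'I_S), nat_of_ord g = (l %/ k)%N -> lo g <= xi l.
Proof.
move=> lom loP l g gl; rewrite leNgt; apply/negP => lt.
have k0 : (0 < k)%N by case: (h l) => s _; exact: leq_ltn_trans (ltn_ord s).
have : (l.+1 <= k * g)%N.
  rewrite -(card_ord_lt (ltn_ord l)) -(fintype.card_image hI).
  have <- : #|[predX (@predT 'I_k) & [pred i : 'I_S | (i < g)%N]]| = (k * g)%N.
    by rewrite cardX card_ord card_ord_lt // ltnW.
  apply: subset_leq_card; apply/fintype.subsetP => _ /fintype.imageP[l' l'l ->].
  rewrite !inE /= ltnNge; apply/negP => gi; move: l'l; rewrite inE ltnS => /xis.
  rewrite xiE (surjective_pairing (h l')) => le.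
  have := loP (h l').1 (h l').2; have := lom _ _ gi.
  by move: lt le; lra.
by rewrite gl (mulnC k) ltnNge leq_divM.
Qed.

Lemma sorted_near_hi : (forall i j : 'I_S, (i <= j)%N -> hi i <= hi j) ->
  (forall s i, eta (s, i) <= hi i) ->
  forall (l : 'I_(S * k)) (g : 'I_S), nat_of_ord g = (l %/ k)%N -> xi l <= hi g.
Proof.
move=> him hiP l g gl; rewrite leNgt; apply/negP => lt.
have k0 : (0 < k)%N by case: (h l) => s _; exact: leq_ltn_trans (ltn_ord s).
have : (S * k - l <= k * (S - g.+1))%N.
  rewrite -(card_ord_ge (ltnW (ltn_ord l))) -(fintype.card_image hI) -(card_ord_ge (ltn_ord g)).
  have -> : (k * #|[pred i : 'I_S | (g < i)%N]| =
      #|[predX (@predT 'I_k) & [pred i : 'I_S | (g < i)%N]]|)%N by rewrite cardX card_ord.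
  apply: subset_leq_card; apply/fintype.subsetP => _ /fintype.imageP[l' l'l ->].
  rewrite !inE /= ltnNge; apply/negP => gi; move: l'l; rewrite inE => /xis.
  rewrite [X in _ <= X]xiE (surjective_pairing (h l')) => le.
  have := hiP (h l').1 (h l').2; have := him _ _ gi.
  by move: lt le; lra.
rewrite leqNgt => /negP; apply.
have lg : (l < g.+1 * k)%N by rewrite gl -ltn_divLR.
have gS : (g.+1 * k <= S * k)%N by rewrite leq_mul2r ltn_ord orbT.
by rewrite (mulnC k) mulnBl; move: (ltn_ord l) lg gS; lia.
Qed.

End SortedNear.

Lemma interior_bounds (R : realFieldType) (d i M : R) : 0 < d -> 1 <= i -> i + 1 <= M ->
  M * d = 1 / 2 -> ~ (2 * d * i < d) /\ ~ (1 - 2 * d * i < d).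
Proof. by move=> d0 i1 iM Md; split=> h; nra. Qed.

Lemma exp2_small (R : realType) (e : R) : 0 < e ->
  exists k0 : nat, forall k, (k0 <= k)%N -> 1 / 2 ^+ k <= e.
Proof.
move=> e0; have ie0 : 0 <= e^-1 by rewrite invr_ge0 ltW.
exists (Num.truncn e^-1) => k kk.
have /andP[_ h] := truncn_itv ie0.
have h2 : (Num.truncn e^-1).+1%:R <= 2 ^+ k :> R.
  rewrite -natrX ler_nat; apply: leq_ltn_trans kk _; exact: ltn_expl.
rewrite ler_pdivrMr ?exprn_gt0 // mulrC -ler_pdivrMr // mul1r.
exact: ltW (lt_le_trans h h2).
Qed.

Lemma diagonal_card (R : realType) p q p' q' (T : finType)
    (xi : T -> unit_interval R -> unit_interval R)
    (Phi : dimdrop R p q -> dimdrop R p' q') :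
  diagonal_by xi Phi -> (#|T| * (p * q) = p' * q')%N.
Proof.
move=> [_ [sigma [u [/bij_eq_card + _ _ _]]]].
by rewrite card_prod !card_ord.
Qed.

(** [Phi f] has q' equal blocks at 0 and p' at 1, so [point_rep_multiplicity] applies with s = q'
    and s = p'. *)
Lemma endpoint_multiplicity (R : realType) p q p' q' (T : finType)
    (xi : T -> unit_interval R -> unit_interval R)
    (Phi : dimdrop R p q -> dimdrop R p' q') :
  (0 < p)%N -> (0 < q)%N -> (0 < p')%N -> (0 < q')%N ->
  diagonal_by xi Phi -> forall z,
  (q' %| #|[pred t | xi t (ui0 R) == z]| * endpoint_weight p q z)%N /\
  (p' %| #|[pred t | xi t (ui1 R) == z]| * endpoint_weight p q z)%N.
Proof.
move=> p0 q0 p'0 q'0 [_ [sigma [u [bs cu uu PhiE]]]] z.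
pose i0 := Ordinal p0; pose j0 := Ordinal q0.
have E x s r (tau : 'I_(p' * q') -> 'I_s * 'I_r) : (0 < s)%N -> bijective tau ->
    (forall F : dimdrop R p' q', exists D, F x = dg tau (fun=> D)) ->
    (s %| #|[pred t | xi t x == z]| * endpoint_weight p q z)%N.
  move=> s0 bt tauF; have /choice[D DE] := fun f => tauF (Phi f).
  have h (f : dimdrop R p q) : (u x)^t* *m dg sigma (f \o (xi^~ x)) *m u x = dg tau (fun=> D f).
    by rewrite -DE PhiE.
  have [rep tr] := point_rep_descend s0 bs bt (uu x) h.
  exact: (point_rep_multiplicity i0 j0 rep tr).
split.
  apply: (E _ q' p' (fun i => ((mxtens_unindex i).2, (mxtens_unindex i).1))) => //.
    exact: mxtens_swap_bij.
  by move=> F; have [a ->] := (dimdrop_admissible F (ui0 R)).1 erefl; exists a; rewrite tensmx1_dg.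
apply: (E _ p' q' (@mxtens_unindex p' q')) => //; first exact: mxtens_unindex_bij.
by move=> F; have [a ->] := (dimdrop_admissible F (ui1 R)).2 erefl; exists a; rewrite tens1mx_dg.
Qed.

(** * Connecting maps and their grids *)

Section Sequence.
Variables (R : realType) (p q : nat -> nat).
Variable phi : forall n, dimdrop R (p n) (q n) -> dimdrop R (p n.+1) (q n.+1).
Local Notation A n := (dimdrop R (p n) (q n)).
Local Notation I := (unit_interval R).
Hypotheses (prm : prime_dimdrop_sequence phi) (dag : dagger phi).

(* The graph of the connecting maps, which avoids casts along k + n = m. *)
Inductive conn n : forall m, (A n -> A m) -> Prop :=
| conn_refl : conn id
| conn_step m (Phi : A n -> A m) : conn Phi -> conn (fun a => @phi m (Phi a)).

Lemma conn_connecting n k : conn (@connecting (fun n => A n) phi n k).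
Proof. by elim: k => [|k IH] /=; [exact: conn_refl|exact: conn_step IH]. Qed.

(** The quantification over P replaces an equation between [Phi] and the connecting map, whose types
    agree only through k + n = m. *)
Lemma connE n m (Phi : A n -> A m) : conn Phi ->
  exists k, forall P : forall m, (A n -> A m) -> Prop,
    P (k + n)%N (@connecting (fun n => A n) phi n k) -> P m Phi.
Proof.
elim=> [|{}m {}Phi _ [k kP]]; first by exists 0%N.
exists k.+1 => P Pk.
by apply: (kP (fun m Phi => P m.+1 (fun a => @phi m (Phi a)))).
Qed.

Lemma conn_exists n m : (n <= m)%N -> exists Phi : A n -> A m, conn Phi.
Proof.
elim: m => [|m IH]; first by case: n => // _; exists id; exact: conn_refl.
rewrite leq_eqVlt => /orP[/eqP <-|/IH[Phi cPhi]]; first by exists id; exact: conn_refl.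
by eexists; exact: conn_step cPhi.
Qed.

Lemma conn_leq n m (Phi : A n -> A m) : conn Phi -> (n <= m)%N.
Proof. by elim=> // {}m {}Phi _; exact: leqW. Qed.

Lemma conn_trans n m l (Phi : A n -> A m) (Psi : A m -> A l) :
  conn Phi -> conn Psi -> conn (fun a => Psi (Phi a)).
Proof.
move=> cPhi; elim=> [|{}l {}Psi _ IH]; first exact: cPhi.
exact: conn_step IH.
Qed.

Lemma conn_inj n m (Phi : A n -> A m) : (0 < n)%N -> conn Phi -> injective Phi.
Proof.
move=> n0; elim=> [|{}m {}Phi cPhi IH] //.
have m0 : (0 < m)%N := leq_trans n0 (conn_leq cPhi).
have [_ _ _ [_ _ phi_inj] _] := prm m0.
by move=> a b /phi_inj/IH.
Qed.

Lemma conn_dagger n m (Phi : A n -> A m) : (0 < n)%N -> conn Phi ->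
  exists r (xi : 'I_r -> I -> I), [/\ diagonal_by xi Phi,
    forall x, sorted_family (xi^~ x) &
    forall i x y, `|set_val (xi i x) - set_val (xi i y)| <= 1 / 2 ^+ (m - n)].
Proof.
move=> n0 cPhi; have [k kP] := connE cPhi.
apply: (kP (fun m Phi => exists r (xi : 'I_r -> I -> I), [/\ diagonal_by xi Phi,
    forall x, sorted_family (xi^~ x) &
    forall i x y, `|set_val (xi i x) - set_val (xi i y)| <= 1 / 2 ^+ (m - n)])).
have [r [xi [xid xis xidi]]] := dag k n0.
exists r, xi; split.
- exact: diagonalized_diagonal.
- by move=> x i j ij; exact: xis.
move=> i x y; rewrite addnK; apply: le_trans (xidi i); apply: ub_le_sup; last first.
  exists (set_val (xi i x), set_val (xi i y)); last by [].
  by split; [exists x|exists y].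
exists 1 => _ [[a b] [[z _ <-] [z' _ <-]] <-] /=.
have /andP[a0 a1] := ui_itv (xi i z); have /andP[b0 b1] := ui_itv (xi i z').
by rewrite ler_norml; apply/andP; split; lra.
Qed.

Lemma conn_dnorm n m (Phi : A n -> A m) : (0 < n)%N -> conn Phi ->
  forall f, dnorm (Phi f) = dnorm f.
Proof.
move=> n0 cPhi f; have [r [xi [xid _ _]]] := conn_dagger n0 cPhi.
have [p0 q0 _ _ _] := prm n0.
exact: (diagonal_isometric p0 q0 xid (conn_inj n0 cPhi)).
Qed.

(* Distinct interior points of the list at an endpoint have multiplicity at
   least q_m (resp. p_m), and there are many such points. *)
Lemma sizes_unbounded M : exists m0, forall m, (m0 <= m)%N -> (M <= p m)%N /\ (M <= q m)%N.
Proof.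
have M0 : 0 < M.+1%:R :> R by [].
(* Half the spacing of the points (i + 1) / (M + 1): entries closer than d to different such points
   are distinct from each other and from 0 and 1. *)
pose d : R := (2 * M.+1%:R)^-1.
have d0 : 0 < d by rewrite invr_gt0 mulr_gt0.
have dE : M.+1%:R * d = 1 / 2 by rewrite /d invfM mulrCA mulfV ?gt_eqF // mulr1 mul1r.
have [k0 k0P] := exp2_small (divr_gt0 d0 (ltr0Sn R 1)).
exists k0.+1 => m km; have m0 : (0 < m)%N by apply: leq_trans km.
have [Phi cPhi] := conn_exists m0.
have [r [xi [xid xis xidi]]] := conn_dagger (ltn0Sn 0) cPhi.
have [p10 q10 _ _ _] := prm (ltn0Sn 0); have [pm0 qm0 _ _ _] := prm m0.
have rE := diagonal_card xid; rewrite card_ord in rE.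
have main x s : (forall z, (s %| #|[pred t | xi t x == z]| * endpoint_weight (p 1) (q 1) z)%N) ->
    (M * s <= r)%N.
  move=> sd.
  have /choice[v vP] : forall i : 'I_M, exists t : 'I_r,
      `|set_val (xi t x) - i.+1%:R / M.+1%:R| < d.
    move=> i; have [z zE] : exists z : I, set_val z = i.+1%:R / M.+1%:R.
      apply: ui_exists; rewrite divr_ge0 //= ler_pdivrMr // mul1r ler_nat.
      by rewrite ltnS ltnW.
    have [t [y ty]] := dense_images p10 q10 xid (conn_inj (ltn0Sn 0) cPhi) z
      (divr_gt0 d0 (ltr0Sn R 1)).
    exists t; rewrite -zE; have := xidi t x y => h.
    have := k0P (m - 1)%N; rewrite leq_subRL ?add1n // => /(_ km) h'.
    by have := ler_distD (set_val (xi t y)) (set_val (xi t x)) (set_val z); lra.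
  have iE (i : 'I_M) : i.+1%:R / M.+1%:R = 2 * d * i.+1%:R.
    by rewrite /d invfM mulrA mulfV ?mul1r ?pnatr_eq0 // mulrC.
  have vi i j : xi (v i) x = xi (v j) x -> i = j.
    move=> e; apply: val_inj; apply/eqP; rewrite -eqSS -(eqr_nat R).
    have := vP i; have := vP j; rewrite e; set a := set_val _.
    rewrite !iE => hj hi; rewrite eqr_nat; apply/negPn/negP => ij.
    have : 1 <= `|i.+1%:R - j.+1%:R| :> R.
      have gap (a' b' : nat) : (a' < b')%N -> 1 <= `|b'%:R - a'%:R| :> R.
        move=> mn; rewrite ger0_norm ?subr_ge0 ?ler_nat ?(ltnW mn) //.
        by rewrite lerBrDl natr1 ler_nat.
      move: ij; rewrite neq_ltn => /orP[/gap|/gap //].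
      by rewrite distrC.
    have := ler_distD a (2 * d * i.+1%:R) (2 * d * j.+1%:R).
    rewrite -mulrBr normrM (gtr0_norm (mulr_gt0 (ltr0Sn R 1) d0)) (distrC _ a) => h h'.
    by move: (ler_wpM2l (ltW d0) h'); lra.
  have vin i : endpoint_weight (p 1) (q 1) (xi (v i) x) = 1%N.
    have hi := vP i.
    have i1 : 1 <= i.+1%:R :> R by rewrite ler1n.
    have i2 : i.+1%:R + 1 <= M.+1%:R :> R by rewrite natr1 ler_nat ltnS.
    have [b1 b2] := interior_bounds d0 i1 i2 dE.
    rewrite /endpoint_weight; case: eqP => [e|_].
      move: hi; rewrite e iE /= sub0r normrN ltr_norml => /andP[_ hi].
      by case: b1.
    case: eqP => [e|//]; move: hi; rewrite e iE /= ltr_norml => /andP[_ hi].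
    by case: b2.
  rewrite -[X in (_ <= X)%N](card_ord r) -sum1_card.
  apply: (@leq_trans (\sum_(i < M) \sum_(t < r | xi t x == xi (v i) x) 1)%N).
    rewrite -[X in (X * _)%N](card_ord M) -sum_nat_const; apply: leq_sum => i _.
    rewrite sum1_card; apply: dvdn_leq.
      by apply/card_gt0P; exists (v i); exact: eqxx.
    by have := sd (xi (v i) x); rewrite vin muln1.
  rewrite (exchange_big_dep predT) //=; apply: leq_sum => t _.
  case: (pickP [pred i : 'I_M | xi t x == xi (v i) x]) => [i /= ti|h]; last by rewrite big_pred0.
  rewrite (big_pred1 i) // => j; rewrite (eqP ti); apply/eqP/eqP => [|->//].
  by move/vi.
have em := endpoint_multiplicity p10 q10 pm0 qm0 xid.
have pq1 : (0 < p 1 * q 1)%N by rewrite muln_gt0 p10.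
have rle : (r <= p m * q m)%N by rewrite -rE leq_pmulr.
(* Counting at 0 gives M q_m <= r <= p_m q_m, counting at 1 gives M p_m <= r <= p_m q_m. *)
split.
- by rewrite -(leq_pmul2r qm0); apply: leq_trans rle; apply: main => z; exact: (em z).1.
- rewrite -(leq_pmul2r pm0) (mulnC (q m)); apply: leq_trans rle.
  by apply: main => z; exact: (em z).2.
Qed.

(** Each of c_0, ..., c_(S-1) has k consecutive entries of a late list near it, with the same S for
    all k; c_S = 1 only closes the last cell. *)
Definition grid_of n (d : R) S (c : nat -> I) n0 (Phi1 : A n -> A n0) : Prop :=
  [/\ (0 < S)%N, c 0%N = ui0 R, c S = ui1 R,
      forall i j, (i <= j <= S)%N -> set_val (c i) <= set_val (c j) &
  [/\ conn Phi1,
      forall i, (i < S)%N -> set_val (c i.+1) - set_val (c i) <= d &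
      forall m (Phi2 : A n0 -> A m), conn Phi2 -> exists k (xi : 'I_(S * k) -> I -> I),
        [/\ diagonal_by xi (fun a => Phi2 (Phi1 a)), forall x, sorted_family (xi^~ x) &
            forall (l : 'I_(S * k)) x, `|set_val (xi l x) - set_val (c (l %/ k)%N)| <= d]]].

(** The grid is the list of [Phi1] at 0 with its ends moved to 0 and 1. A later connecting map
    factors through [Phi1], whose entries oscillate by at most e; up to order, its list has k
    entries e-close to each entry of [Phi1] at 0, and sorting keeps them close. *)
Lemma grid_exists n d : (0 < n)%N -> 0 < d ->
  exists S c n0 (Phi1 : A n -> A n0), grid_of d S c Phi1.
Proof.
(* Gaps in the list of [Phi1] are at most 4 e, and moving an end adds at most 2 e. *)
move=> n0 d0; have [e [d60 dE]] : exists e : R, 0 < e /\ d = 6 * e.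
  by exists (d / 6); split; [rewrite divr_gt0|lra].
have [k0 k0P] := exp2_small d60.
have [Phi1 c1] := conn_exists (leq_addl k0 n).
have [S [eta [etad etas etai]]] := conn_dagger n0 c1.
rewrite addnK in etai.
have {k0P}etae i x y : `|set_val (eta i x) - set_val (eta i y)| <= e.
  exact: le_trans (etai i x y) (k0P k0 (leqnn _)).
have [pn qn _ _ _] := prm n0.
have m0 : (0 < k0 + n)%N by rewrite ltn_addl.
have [pm qm _ _ _] := prm m0.
have S0 : (0 < S)%N.
  have := diagonal_card etad; rewrite card_ord => SE.
  have : (0 < p (k0 + n) * q (k0 + n))%N by rewrite muln_gt0 pm.
  by rewrite -SE muln_gt0 => /andP[].
pose o := ui0 R; pose E (i : nat) := set_val (eta (insubd (Ordinal S0) i) o).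
have EE (i : 'I_S) : E i = set_val (eta i o) by rewrite /E valKd.
have EO l (lS : (l < S)%N) : E l = set_val (eta (Ordinal lS) o) := EE (Ordinal lS).
have Em i j : (i <= j < S)%N -> E i <= E j.
  move=> /andP[ij jS]; have iS := leq_ltn_trans ij jS.
  by rewrite (EO _ iS) (EO _ jS); exact: etas.
have dense (z : I) : exists t : 'I_S, `|set_val (eta t o) - set_val z| < 2 * e.
  have [t [x tx]] := dense_images pn qn etad (conn_inj n0 c1) z d60.
  exists t; have := etae t o x.
  by have := ler_distD (set_val (eta t x)) (set_val (eta t o)) (set_val z); lra.
have v0 : set_val (ui0 R) = 0 by [].
have v1 : set_val (ui1 R) = 1 by [].
have E0 : 0 <= E 0%N <= 2 * e.
  apply/andP; split; first by rewrite (EO _ S0); have /andP[] := ui_itv (eta (Ordinal S0) o).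
  have [t] := dense (ui0 R); rewrite v0 subr0 ltr_norml => /andP[_ h].
  by apply: ltW; apply: le_lt_trans h; rewrite -EE; apply: Em; rewrite leq0n ltn_ord.
have ES : 1 - 2 * e <= E S.-1.
  have [t] := dense (ui1 R); rewrite /= ltr_norml => /andP[h _].
  have : E t <= E S.-1 by apply: Em; rewrite -ltnS prednK // ltn_ord leqnn.
  by rewrite EE; move: h; rewrite v1; lra.
have Egap i : (i.+1 < S)%N -> E i.+1 - E i <= 4 * e.
  move=> iS; rewrite leNgt; apply/negP => h.
  have iS' : (i < S)%N := ltnW iS.
  (* An entry within 2 e of the middle of a gap longer than 4 e would lie inside the gap. *)
  have [z zE] : exists z : I, set_val z = (E i + E i.+1) / 2.
    apply: ui_exists; rewrite (EO _ iS') (EO _ iS).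
    have /andP[a0 a1] := ui_itv (eta (Ordinal iS') o).
    by have /andP[b0 b1] := ui_itv (eta (Ordinal iS) o); lra.
  have [t] := dense z; rewrite zE -EE ltr_norml => /andP[h1 h2].
  case: (leqP t i) => ti.
    by have : E t <= E i by [apply: Em; rewrite ti iS']; lra.
  by have : E i.+1 <= E t by [apply: Em; rewrite ti ltn_ord]; lra.
pose c (i : nat) : I := if i == 0%N then ui0 R else if (S <= i)%N then ui1 R
  else eta (insubd (Ordinal S0) i) o.
have c0 : c 0%N = ui0 R by [].
have cS : c S = ui1 R by rewrite /c leqnn eqn0Ngt S0.
have cE i : (0 < i < S)%N -> set_val (c i) = E i.
  by move=> /andP[i0 iS]; rewrite /c eqn0Ngt i0 leqNgt iS.
have cn i : (i < S)%N -> E i - 2 * e <= set_val (c i) <= E i.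
  move=> iS; have [->|i0] := posnP i; first by rewrite c0 v0; move: E0 d60 => /andP[]; move: (E 0%N) => *; apply/andP; split; lra.
  by rewrite cE ?i0 // lexx andbT; lra.
exists S, c, (k0 + n)%N, Phi1; split=> //.
- move=> i j /andP[ij jS]; have [->|i0] := posnP i.
    by rewrite c0; have /andP[] := ui_itv (c j).
  move: jS; rewrite leq_eqVlt => /orP[/eqP ->|jS].
    by rewrite cS; have /andP[] := ui_itv (c i).
  rewrite !cE ?i0 ?(leq_ltn_trans ij jS) ?(leq_trans i0 ij) //.
  by apply: Em; rewrite ij.
split => //.
- move=> i iS.
  have /andP[h1 h2] := cn i iS.
  move: (iS); rewrite leq_eqVlt => /orP[/eqP e1|iS1].
    have e2 : i = S.-1 by rewrite -e1.
    by rewrite e1 cS v1; move: ES; rewrite -e2; lra.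
  by rewrite (cE i.+1) ?iS1 //; have := Egap i iS1; lra.
move=> m Phi2 c2; have [k [zeta [zetad _ _]]] := conn_dagger m0 c2.
have [r [xi [xid xis _]]] := conn_dagger n0 (conn_trans c1 c2).
(* The composite list and the sorted list belong to the same map: they have the same length and
   agree up to order at each x. *)
have compd := diagonal_comp etad zetad.
have rE : r = (S * k)%N.
  have := diagonal_card xid; rewrite -(diagonal_card compd) card_prod !card_ord => /eqP.
  by rewrite eqn_pmul2r ?muln_gt0 ?pn // mulnC => /eqP.
case: _ / (esym rE) xi xid xis => xi xid xis; exists k, xi.
split=> // l x.
have [h [bh hE]] := equal_fibers_bij (scalar_card pn qn xid compd x).
have k0' : (0 < k)%N by have := leq_ltn_trans (leq0n _) (ltn_ord l); rewrite muln_gt0 => /andP[].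
have gS : (l %/ k < S)%N by rewrite ltn_divLR.
pose Eta (a : 'I_k * 'I_S) := set_val (eta a.2 (zeta a.1 x)).
have xiE t : set_val (xi t x) = Eta (h t) by rewrite hE.
have etaE s (i : 'I_S) : E i - e <= Eta (s, i) <= E i + e.
  by have := etae i o (zeta s x); rewrite EE ler_norml /Eta /= => /andP[h1 h2]; apply/andP; split; lra.
have Emo (b : R) (i j : 'I_S) : (i <= j)%N -> E i + b <= E j + b.
  by move=> ij; rewrite lerD2r; apply: Em; rewrite ij ltn_ord.
have h1 := @sorted_near_lo R S k (fun t => set_val (xi t x)) Eta h (fun i => E i - e)
  (bij_inj bh) xiE (xis x) (Emo _) (fun s i => proj1 (andP (etaE s i))) l (Ordinal gS) erefl.
have h2 := @sorted_near_hi R S k (fun t => set_val (xi t x)) Eta h (fun i => E i + e)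
  (bij_inj bh) xiE (xis x) (Emo _) (fun s i => proj2 (andP (etaE s i))) l (Ordinal gS) erefl.
have /andP[h3 h4] := cn _ gS;
rewrite dE ler_norml; move: h1 h2 h3 h4 d60 => /=.
move: (set_val (xi l x)) (set_val _) (E _) => *; apply/andP; split; lra.
Qed.

End Sequence.

(** * Bounded equicontinuous sets *)

Section Tame.
Variables (R : realType) (p q : nat).
Local Notation I := (unit_interval R).

(** Such sets take the place of the finite sets of the classical argument: they can hold all
    elements with a given bound and Lipschitz constant at once, so no dense sequence has to be
    enumerated. *)
Definition tame (F : set (dimdrop R p q)) : Prop :=
  (exists M, forall f, F f -> dnorm f <= M) /\
  forall e : R, 0 < e -> exists2 d : R, 0 < d & forall f, F f -> forall x y : I,
    `|set_val x - set_val y| < d -> opnorm (f x - f y) <= e.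

Lemma tame0 : tame set0.
Proof. by split; [exists 0|move=> e e0; exists 1]. Qed.

Lemma tameU F G : tame F -> tame G -> tame (F `|` G).
Proof.
move=> [[M FM] Fe] [[M' GM] Ge]; split.
  exists (Num.max M M') => f [/FM|/GM] h; apply: le_trans h _; rewrite le_max lexx //.
  exact: orbT.
move=> e e0; have [d d0 Fd] := Fe e e0; have [d' d'0 Gd] := Ge e e0.
exists (Num.min d d'); first by rewrite lt_min d0.
by move=> f [/Fd|/Gd] h x y; rewrite lt_min => /andP[xd xd']; apply: h.
Qed.

End Tame.

Lemma finite_lower_bound (R : realDomainType) (T : finType) (f : T -> R) :
  (forall t, 0 < f t) -> exists2 d, 0 < d & forall t, d <= f t.
Proof.
move=> f0; have [d d0 dP] : exists2 d, 0 < d & forall t, t \in enum T -> d <= f t.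
  elim: (enum T) => [|t s [d d0 dP]]; first by exists 1.
  exists (Num.min d (f t)); first by rewrite lt_min d0 f0.
  by move=> t'; rewrite inE ge_min => /orP[/eqP ->|/dP ->] //; rewrite lexx orbT.
by exists d => // t; apply: dP; rewrite mem_enum.
Qed.

Lemma mulmx_dist (R : realType) n (A B D A' B' D' : 'M[complexes R]_n) :
  A *m B *m D - A' *m B' *m D' =
  (A - A') *m B *m D + A' *m (B - B') *m D + A' *m B' *m (D - D').
Proof. by rewrite !(mulmxBl, mulmxBr) !addrA !subrK. Qed.

(** The variation of u^* diag(f o xi) u splits into those of u^*, of the diagonal and of u; the
    bound of [F] controls the outer two, its equicontinuity the middle one. *)
Lemma tame_image (R : realType) p q p' q' (T : finType)
    (xi : T -> unit_interval R -> unit_interval R)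
    (Phi : dimdrop R p q -> dimdrop R p' q') F :
  diagonal_by xi Phi -> tame F -> tame (Phi @` F).
Proof.
move=> [cxi [sigma [u [bs cu uu PhiE]]]] [[M FM] Fe].
have nD (f : dimdrop R p q) x : opnorm (dg sigma (fun t => f (xi t x))) <= dnorm f.
  by apply: opnorm_dg; [exact: bs|exact: dnorm_nneg|move=> t; exact: opnorm_le_dnorm].
split.
  exists M => _ [f Ff <-]; apply: dnorm_le => x.
  rewrite PhiE (opnorm_conj _ (uu x)); exact: le_trans (nD f x) (FM f Ff).
(* A positive bound, whatever the sign of M. *)
move=> e e0; pose K := Num.max M 0 + 1.
have K0 : 0 < K by rewrite ltr_wpDl // le_max lexx orbT.
have MK : M <= K by rewrite /K ler_wpDr // le_max lexx.
have e1 : 0 < e / (3 * K) by rewrite divr_gt0 // mulr_gt0.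
have [d1 d10 ud] := mx_cont_unif cu e1.
have [d2 d20 ud'] := mx_cont_unif (adjmx_continuous cu) e1.
have [d3 d30 Fd] := Fe (e / 3) (divr_gt0 e0 (ltr0Sn R 2)).
have /choice[d4 d4P] : forall t, exists d : R, 0 < d /\ forall x y,
    `|set_val x - set_val y| < d -> `|set_val (xi t x) - set_val (xi t y)| < d3.
  by move=> t; have [d d0 h] := ui_cont_unif (cxi t) d30; exists d.
have [d5 d50 d5P] := finite_lower_bound (fun t => proj1 (d4P t)).
exists (Num.min d1 (Num.min d2 d5)); first by rewrite !lt_min d10 d20.
move=> _ [f Ff <-] x y; rewrite !lt_min => /and3P[xy1 xy2 xy5].
have fK : dnorm f <= K := le_trans (FM f Ff) MK.
have eK (a b : R) : 0 <= a -> a <= e / (3 * K) -> 0 <= b -> b <= K -> a * b <= e / 3.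
  move=> a0 ae b0 bK; apply: le_trans (ler_pM a0 b0 ae bK) _.
  by rewrite invfM mulrA mulfVK ?gt_eqF.
rewrite !PhiE mulmx_dist.
have h1 : opnorm (((u x)^t* - (u y)^t*) *m dg sigma (fun t => f (xi t x)) *m u x) <= e / 3.
  rewrite (opnormM_unitary _ (uu x)); apply: le_trans (opnormM _ _) _.
  apply: eK; [exact: opnorm_ge0|exact: ltW (ud' _ _ xy2)|exact: opnorm_ge0|].
  exact: le_trans (nD f x) fK.
have h2 : opnorm ((u y)^t* *m (dg sigma (fun t => f (xi t x)) -
    dg sigma (fun t => f (xi t y))) *m u x) <= e / 3.
  rewrite (opnormM_unitary _ (uu x)) (opnorm_unitaryM _ (unitarymx_adj (uu y))) -dgB.
  apply: opnorm_dg; [exact: bs|exact: ltW (divr_gt0 e0 (ltr0Sn R 2))|].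
  move=> t; apply: Fd => //; have [_] := d4P t; apply.
  exact: lt_le_trans xy5 (d5P t).
have h3 : opnorm ((u y)^t* *m dg sigma (fun t => f (xi t y)) *m (u x - u y)) <= e / 3.
  apply: le_trans (opnormM _ _) _; rewrite mulrC.
  apply: eK; [exact: opnorm_ge0|exact: ltW (ud _ _ xy1)|exact: opnorm_ge0|].
  rewrite (opnorm_unitaryM _ (unitarymx_adj (uu y))); exact: le_trans (nD f y) fK.
apply: le_trans (opnormD _ _) _; apply: le_trans (lerD (opnormD _ _) (lexx _)) _.
apply: le_trans (lerD (lerD h1 h2) h3) _.
have -> : e / 3 + e / 3 + e / 3 = e by field.
exact: lexx.
Qed.

Lemma card_div_fiber S k g :
  #|[pred l : 'I_(S * k) | (l %/ k == g)%N]| = if (g < S)%N then k else 0%N.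
Proof.
rewrite -sum1_card (reindex (@mxtens_index S k)) /=; last first.
  by apply: onW_bij; exists (@mxtens_unindex S k); [exact: mxtens_indexK|exact: mxtens_unindexK].
rewrite (eq_bigl (fun x : 'I_S * 'I_k => (nat_of_ord x.1 == g) && true)); last first.
  move=> [i j] /=; rewrite andbT inE; congr (_ == _).
  by rewrite divnMDl ?divn_small ?addn0 // (leq_ltn_trans (leq0n j)).
have -> : (\sum_(x : 'I_S * 'I_k | (nat_of_ord x.1 == g) && true) 1 =
    #|[predX [pred i : 'I_S | nat_of_ord i == g] & (@predT 'I_k)]|)%N.
  by rewrite -sum1_card; apply: eq_bigl.
rewrite cardX card_ord; case: ltnP => gS.
  have -> : #|[pred i : 'I_S | nat_of_ord i == g]| = #|pred1 (Ordinal gS)|.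
    by apply: eq_card => i; rewrite !inE; apply/eqP/eqP => [ig|->] //; exact: val_inj.
  by rewrite card1 mul1n.
have -> : #|[pred i : 'I_S | nat_of_ord i == g]| = #|@pred0 'I_S|; last by rewrite card0.
apply: eq_card => i; rewrite !inE; apply/eqP => /= ig.
by have := ltn_ord i; rewrite ig ltnNge gS.
Qed.

(** * Maps whose lists follow a grid *)

Section Tight.
Variables (R : realType) (p q : nat -> nat).
Variable phi : forall n, dimdrop R (p n) (q n) -> dimdrop R (p n.+1) (q n.+1).
Local Notation A n := (dimdrop R (p n) (q n)).
Local Notation I := (unit_interval R).

(* The list of alpha follows a grid which the lists of all the late connecting
   maps out of A_n follow too. *)
Definition tight n p' q' (alpha : A n -> dimdrop R p' q') (F : set (A n)) (e : R) : Prop :=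
  exists S c n0 (Phi1 : A n -> A n0) d k (zeta : 'I_(S * k) -> I -> I),
  [/\ grid_of phi d S c Phi1, diagonal_by zeta alpha,
      forall (l : 'I_(S * k)) x,
        set_val (c (l %/ k)%N) <= set_val (zeta l x) <= set_val (c (l %/ k).+1) &
      0 <= e /\ forall f, F f -> forall x y : I, `|set_val x - set_val y| <= d ->
        opnorm (f x - f y) <= e].

Lemma tight_diagonal n p' q' (alpha : A n -> dimdrop R p' q') F e :
  tight alpha F e -> diagonal alpha.
Proof. by move=> [S [c [n0 [Phi1 [d [k [zeta [_ zd _ _]]]]]]]]; exists (S * k)%N, zeta. Qed.

Definition good_sequence : Prop :=
  [/\ prime_dimdrop_sequence phi, dagger phi & double_dagger p q].

End Tight.

(** * One step forth and one step back *)

Section Steps.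
Variables (R : realType) (p q p' q' : nat -> nat).
Variable phi : forall n, dimdrop R (p n) (q n) -> dimdrop R (p n.+1) (q n.+1).
Variable psi : forall n, dimdrop R (p' n) (q' n) -> dimdrop R (p' n.+1) (q' n.+1).
Local Notation A n := (dimdrop R (p n) (q n)).
Local Notation B n := (dimdrop R (p' n) (q' n)).
Hypotheses (gphi : good_sequence phi) (gpsi : good_sequence psi).

(** m is a multiple of K = S p_n q_n, so K divides p'_m q'_m by (double dagger), and the quotient k
    is the number of entries per cell. Sizes of at least 2 K give k >= 2 p'_m and k >= 2 q'_m. *)
Lemma tight_exists n (F : set (A n)) e m0 : (0 < n)%N -> tame F -> 0 < e ->
  exists m (alpha : A n -> B m), [/\ (m0 <= m)%N, (0 < m)%N & tight phi alpha F e].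
Proof.
move=> n0 [_ Fe] e0; have [d d0 Fd] := Fe e e0.
have [prm dag _] := gphi; have [prm' dag' ddag'] := gpsi.
have [S [c [n1 [Phi1 G]]]] := grid_exists prm dag n0 (divr_gt0 d0 (ltr0Sn R 1)).
have [pn qn pq _ _] := prm n n0.
have [S0 c0 cS cm _] := G.
pose K := (S * (p n * q n))%N.
have K0 : (0 < K)%N by rewrite !muln_gt0 S0 pn.
have [m1 m1P] := sizes_unbounded prm' dag' (2 * K).
pose m := ((maxn m0 m1).+1 * K)%N.
have mm : (maxn m0 m1 <= m)%N by rewrite -[X in (X <= _)%N]muln1 leq_mul.
have m_gt0 : (0 < m)%N by rewrite muln_gt0.
have [pm qm _ _ _] := prm' m m_gt0.
have [pK qK] := m1P m (leq_trans (leq_maxr m0 m1) mm).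
have /dvdnP[k kE] : (K %| p' m * q' m)%N.
  by apply: dvdn_trans (ddag' m m_gt0); exact: dvdn_mull.
have kN : ((S * k) * (p n * q n) = p' m * q' m)%N by rewrite kE /K; ring.
have pk : (2 * p' m <= k)%N.
  rewrite -(leq_pmul2r K0) -kE; have -> : (2 * p' m * K = p' m * (2 * K))%N by ring.
  by rewrite leq_mul2l qK orbT.
have qk : (2 * q' m <= k)%N.
  rewrite -(leq_pmul2r K0) -kE; have -> : (2 * q' m * K = (2 * K) * q' m)%N by ring.
  by rewrite leq_mul2r pK orbT.
have [zeta [alpha [zd zc]]] := diagonal_exists pq pn pm qm S0 pk qk kN c0 cS cm.
exists m, alpha; split; [exact: leq_trans (leq_maxl m0 m1) mm|exact: m_gt0|].
(* [tight] allows equality in the distance while tameness is strict, hence the half. *)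
exists S, c, n1, Phi1, (d / 2), k, zeta; split; [exact: G|exact: zd|exact: zc|].
split; first exact: ltW.
move=> f Ff x y xy; apply: Fd => //; apply: le_lt_trans xy _.
by rewrite ltr_pdivrMr // mulr_natr mulr2n ltrDl.
Qed.

End Steps.

Section Reverse.
Variables (R : realType) (p q p' q' : nat -> nat).
Variable phi : forall n, dimdrop R (p n) (q n) -> dimdrop R (p n.+1) (q n.+1).
Variable psi : forall n, dimdrop R (p' n) (q' n) -> dimdrop R (p' n.+1) (q' n.+1).
Local Notation A n := (dimdrop R (p n) (q n)).
Local Notation B n := (dimdrop R (p' n) (q' n)).
Hypotheses (gphi : good_sequence phi) (gpsi : good_sequence psi).

(** The grid of alpha survives composition: an entry of beta0 o alpha is an entry of alpha evaluated
    elsewhere, so it stays in its cell, and all cells have equally many entries, as for a late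
    connecting map. Conjugating beta0 by the resulting unitary does not change its list, so beta is
    tight as well. *)
Lemma tight_reverse n m (alpha : A n -> B m) (F : set (A n)) (G : set (B m)) e e' l0 :
  (0 < n)%N -> (0 < m)%N -> tight phi alpha F e -> tame G -> 0 < e' ->
  exists l (beta : B m -> A l) (Phi : A n -> A l),
    [/\ (l0 <= l)%N, (0 < l)%N, conn phi Phi, tight psi beta G e' &
        forall f, F f -> dnorm (beta (alpha f) - Phi f) <= 10 * e].
Proof.
move=> n0 m0 [S [c [n1 [Phi1 [d [k [zeta [Gr zd zc [e0 Fe]]]]]]]]] tG e'0.
have [prm dag _] := gphi; have [pn qn pq _ _] := prm n n0.
have [S0 c0 cS cm [c1 cgap Gr2]] := Gr.
have [l [beta0 [ll l_gt0 tb]]] := tight_exists gpsi gphi (maxn l0 n1) m0 tG e'0.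
have [Phi2 c2] := conn_exists phi (leq_trans (leq_maxr l0 n1) ll).
have [k2 [xi [xid xis xic]]] := Gr2 l Phi2 c2.
have [S' [c' [n1' [Phi1' [d' [k' [zeta' [Gr' zd' zc' Ge]]]]]]]] := tb.
have [pl ql _ _ _] := prm l l_gt0.
have compd := diagonal_comp zd zd'.
have k2E : (k2 = (S' * k') * k)%N.
  have := diagonal_card xid; rewrite -(diagonal_card compd) card_prod !card_ord => /eqP.
  rewrite eqn_pmul2r ?muln_gt0 ?pn // => /eqP h.
  by apply/eqP; rewrite -(eqn_pmul2l S0) h; apply/eqP; ring.
(* Matches the positions of the two lists cell by cell. *)
have [h [bh hE]] : exists h : 'I_(S * k2) -> 'I_(S' * k') * 'I_(S * k),
    bijective h /\ forall i : 'I_(S * k2), (i %/ k2)%N = ((h i).2 %/ k)%N.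
  apply: (@equal_fibers_bij _ _ _ (fun i : 'I_(S * k2) => (i %/ k2)%N)
    (fun x : 'I_(S' * k') * 'I_(S * k) => (x.2 %/ k)%N)) => g.
  rewrite card_div_fiber.
  have -> : #|[pred x : 'I_(S' * k') * 'I_(S * k) | (x.2 %/ k == g)%N]| =
      #|[predX (@predT 'I_(S' * k')) & [pred i : 'I_(S * k) | (i %/ k == g)%N]]|.
    by apply: eq_card.
  by rewrite cardX card_ord card_div_fiber k2E; case: ifP; rewrite ?muln0.
have zd2 := diagonal_reindex bh compd.
pose z (i : 'I_(S * k2)) x := zeta (h i).2 (zeta' (h i).1 x).
have zb (i : 'I_(S * k2)) x : set_val (c (i %/ k2)%N) <= set_val (z i x) <= set_val (c (i %/ k2).+1).
  by rewrite hE; exact: zc.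
have k20 : (0 < S * k2)%N -> (0 < k2)%N by rewrite muln_gt0 => /andP[].
have iS (i : 'I_(S * k2)) : (i %/ k2 < S)%N.
  by rewrite ltn_divLR ?ltn_ord // k20 // (leq_ltn_trans (leq0n i)).
have [|||w [uw wP]] := @approx_unitary_equiv R (p n) (q n) (p l) (q l) (Ordinal pn)
  (Ordinal qn) pq pl ql _ xi z (fun i : 'I_(S * k2) => c (i %/ k2)%N)
  (fun a => Phi2 (Phi1 a)) (beta0 \o alpha) F e xid zd2 e0 xis.
- move=> x.
  (* Sorting inside the cells is enough: entries of different cells are already in order. *)
  have [|i j ij|g [bg gs gE]] := @sort_groups _ R (S * k2) (fun i : 'I_(S * k2) => (i %/ k2)%N)
    (fun i => set_val (z i x)).
  + by move=> i j ij; exact: leq_div2r.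
  + have /andP[_ h1] := zb i x; have /andP[h2 _] := zb j x.
    apply: le_trans h1 (le_trans _ h2); apply: cm.
    by rewrite ij ltnW.
  exists g; split; [exact: bg|exact: gs|by move=> i; rewrite gE].
- by move=> f Ff i x; apply: Fe => //; exact: xic.
- move=> f Ff i x; apply: Fe => //; have /andP[h1 h2] := zb i x.
  rewrite ger0_norm ?subr_ge0 //; apply: le_trans (cgap _ (iS i)).
  by rewrite lerD2r.
exists l, (conj_map w beta0), (fun a => Phi2 (Phi1 a)); split.
- exact: leq_trans (leq_maxl l0 n1) ll.
- exact: l_gt0.
- exact: conn_trans c1 c2.
- exists S', c', n1', Phi1', d', k', zeta'; split; [exact: Gr'| |exact: zc'|exact: Ge].
  exact: diagonal_conj uw zd'.
- by move=> f Ff; apply: dnorm_le => x; exact: wP.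
Qed.

End Reverse.

(** * Density of Lipschitz elements *)

Section Density.
Variables (R : realType) (p q : nat).
Local Notation C := (complexes R).
Local Notation I := (unit_interval R).
Local Notation Z := (dimdrop R p q).

Definition lipschitz_class (j : nat) : set Z := [set f |
  dnorm f <= j%:R /\
  forall x y, opnorm (f x - f y) <= j%:R * `|set_val x - set_val y|].

Lemma lipschitz_class_tame j : tame (lipschitz_class j).
Proof.
split; first by exists j%:R => f [].
move=> e e0; exists (e / j.+1%:R); first by rewrite divr_gt0.
move=> f [_ fL] x y xy; apply: le_trans (fL x y) _.
apply: (@le_trans _ _ (j.+1%:R * `|set_val x - set_val y|)).
  by rewrite ler_wpM2r // ler_nat.
by rewrite mulrC -ler_pdivlMr // ltW.
Qed.

Lemma lipschitz_class_le j j' : (j <= j')%N -> lipschitz_class j `<=` lipschitz_class j'.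
Proof.
move=> jj f [fj fL]; split; first by apply: le_trans fj _; rewrite ler_nat.
by move=> x y; apply: le_trans (fL x y) _; rewrite ler_wpM2r // ler_nat.
Qed.

Definition clamp (t : R) : R := if t <= 0 then 0 else if 1 <= t then 1 else t.

Lemma clamp_itv t : 0 <= clamp t <= 1.
Proof.
rewrite /clamp; case: (leP t 0) => t0; first by rewrite lexx ler01.
by case: (leP 1 t) => t1; [rewrite ler01 lexx|rewrite !ltW].
Qed.

Lemma clamp_ge1 t : 1 <= t -> clamp t = 1.
Proof. by move=> t1; rewrite /clamp t1 leNgt (lt_le_trans ltr01 t1). Qed.

Lemma clamp_le0 t : t <= 0 -> clamp t = 0.
Proof. by move=> t0; rewrite /clamp t0. Qed.

Lemma clamp_lipschitz s t : `|clamp s - clamp t| <= `|s - t|.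
Proof.
rewrite /clamp; case: (leP 0 (s - t)) => h; [rewrite (ger0_norm h)|rewrite (ltr0_norm h)];
  case: (leP s 0) => s0; case: (leP t 0) => t0; case: (leP 1 s) => s1; case: (leP 1 t) => t1;
  rewrite ler_norml; apply/andP; split; lra.
Qed.

Lemma grid_cell r (x : R) : (0 < r)%N -> 0 <= x <= 1 ->
  exists2 m : nat, (m < r)%N & m%:R <= r%:R * x <= m.+1%:R.
Proof.
move=> r0 /andP[x0 x1]; have rx : 0 <= r%:R * x by rewrite mulr_ge0.
have /andP[m1 m2] := truncn_itv rx.
have [mr|mr] := ltnP (Num.truncn (r%:R * x)) r.
  by exists (Num.truncn (r%:R * x)) => //; rewrite m1 ltW.
exists r.-1; first by rewrite prednK.
rewrite prednK //; apply/andP; split; last by rewrite -[leRHS]mulr1 ler_wpM2l.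
apply: le_trans m1; rewrite ler_nat; apply: leq_trans mr; exact: leq_pred.
Qed.

Lemma lipschitz_continuous (g : I -> 'M[C]_(p * q)) L : 0 <= L ->
  (forall x y, opnorm (g x - g y) <= L * `|set_val x - set_val y|) -> continuous g.
Proof.
move=> L0 gL; apply/mx_contP => a e e0; have L1 : 0 < L + 1 by rewrite ltr_wpDl.
exists (e / (L + 1)); first by rewrite divr_gt0.
move=> y ay; apply: le_lt_trans (gL a y) _.
apply: (@le_lt_trans _ _ ((L + 1) * `|set_val a - set_val y|)).
  by rewrite ler_wpM2r // lerDl.
by rewrite mulrC -ltr_pdivlMr.
Qed.

(** Piecewise linear interpolation of f at the points i / r keeps the values at 0 and 1, hence stays
    in the algebra. *)
Lemma lipschitz_dense (f : Z) e : 0 < e ->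
  exists j, exists2 g, lipschitz_class j g & dnorm (f - g) <= e.
Proof.
move=> e0; have [d d0 fd] := mx_cont_unif (@dimdrop_continuous _ _ _ f) (divr_gt0 e0 (ltr0Sn R 1)).
have [r r0 rd] : exists2 r : nat, (0 < r)%N & r%:R^-1 < d.
  exists (Num.truncn d^-1).+1 => //.
  have /andP[_ h] := truncn_itv (ltW (eq_ind_r (fun b => is_true b) d0 (invr_gt0 d))).
  by rewrite -[ltRHS]invrK ltf_pV2 ?posrE ?invr_gt0.
have rR : 0 < r%:R :> R by rewrite ltr0n.
have /choice[pt ptE] : forall i : nat, exists z : I, (i <= r)%N -> set_val z = i%:R / r%:R.
  move=> i; have [ir|ir] := leqP i r; last by exists (ui0 R).
  have [z zE] : exists z : I, set_val z = i%:R / r%:R.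
    by apply: ui_exists; rewrite divr_ge0 //= ler_pdivrMr // mul1r ler_nat.
  by exists z.
pose D i := f (pt i.+1) - f (pt i).
pose cl i (x : I) : C := (clamp (r%:R * set_val x - i%:R))%:C%C.
(* A sum of ramps, the i-th rising from 0 to 1 on the i-th cell; inside a cell only its own ramp is
   incomplete. *)
pose g (x : I) := f (pt 0%N) + \sum_(0 <= i < r) cl i x *: D i.
pose L := r%:R * \sum_(0 <= i < r) opnorm (D i).
have L0 : 0 <= L by rewrite mulr_ge0 // sumr_ge0 // => i _; exact: opnorm_ge0.
have gL x y : opnorm (g x - g y) <= L * `|set_val x - set_val y|.
  have -> : g x - g y = \sum_(0 <= i < r) (cl i x - cl i y) *: D i.
    rewrite /g opprD addrACA subrr add0r -sumrB; apply: eq_bigr => i _.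
    by rewrite scalerBl.
  have osum s (F : nat -> 'M[C]_(p * q)) : opnorm (\sum_(i <- s) F i) <= \sum_(i <- s) opnorm (F i).
    elim: s => [|i s IH]; first by rewrite !big_nil opnorm0.
    by rewrite !big_cons; apply: le_trans (opnormD _ _) _; rewrite lerD2l.
  apply: le_trans (osum _ _) _; rewrite /L mulrAC mulr_sumr; apply: ler_sum => i _.
  apply: le_trans (opnormZ _ _) _; rewrite ler_wpM2r ?opnorm_ge0 //.
  rewrite -rmorphB modulusR; apply: le_trans (clamp_lipschitz _ _) _.
  by rewrite opprB addrA subrK -mulrBr normrM gtr0_norm.
have tele m : \sum_(0 <= i < m) D i = f (pt m) - f (pt 0%N).
  by rewrite (telescope_sumr (fun i => f (pt i))).
have cell x m : (m < r)%N -> m%:R <= r%:R * set_val x <= m.+1%:R ->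
    g x = f (pt m) + cl m x *: D m.
  move=> mr /andP[h1 h2]; rewrite /g (big_cat_nat (n := m)) ?(ltnW mr) //= (big_ltn mr).
  rewrite (eq_big_nat _ _ (F2 := D)) => [|i /andP[_ im]]; last first.
    rewrite /cl clamp_ge1 ?scale1r // lerBrDr; apply: le_trans h1.
    by rewrite addrC natr1 ler_nat.
  rewrite tele (addrA (f (pt 0%N))) (addrC (f (pt 0%N))) subrK big_nat big1 ?addr0 // => i /andP[mi _].
  rewrite /cl clamp_le0 ?scale0r // subr_le0; apply: le_trans h2 _.
  by rewrite ler_nat.
have fpt (a b : I) : `|set_val a - set_val b| <= r%:R^-1 -> opnorm (f a - f b) <= e / 2.
  by move=> ab; apply/ltW/fd; exact: le_lt_trans rd.
have gf x : opnorm (f x - g x) <= e.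
  have [m mr mx] := grid_cell r0 (ui_itv x).
  rewrite (cell x m mr mx) opprD addrA; apply: le_trans (opnormD _ _) _.
  have /andP[m1 m2] := mx; rewrite [e]splitr opnormN; apply: lerD.
    apply: fpt; rewrite (ptE _ (ltnW mr)) ger0_norm.
      by rewrite lerBlDr -[X in X + _]mul1r -mulrDl ler_pdivlMr // mulrC addrC natr1.
    by rewrite subr_ge0 ler_pdivrMr // mulrC.
  apply: le_trans (opnormZ _ _) _; rewrite modulusR.
  have /andP[c0 c1] := clamp_itv (r%:R * set_val x - m%:R).
  rewrite (ger0_norm c0); apply: le_trans (ler_wpM2r (opnorm_ge0 _) c1) _.
  rewrite mul1r; apply: fpt; rewrite (ptE _ (ltnW mr)) (ptE _ mr) -mulrBl -natr1.
  by rewrite addrC addKr mul1r ger0_norm // invr_ge0 ler0n.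
have pt0 : pt 0%N = ui0 R by apply: ui_inj; rewrite ptE // mul0r.
have ptr : pt r = ui1 R by apply: ui_inj; rewrite ptE // mulfV ?gt_eqF.
have g0 : g (ui0 R) = f (ui0 R).
  rewrite (cell _ 0%N r0) ?pt0 /=; last by rewrite mulr0 lexx ler01.
  by rewrite /cl /= mulr0 subrr clamp_le0 // scale0r addr0.
have g1 : g (ui1 R) = f (ui1 R).
  rewrite (cell _ r.-1) ?prednK //=; last by rewrite mulr1 ler_nat leq_pred lexx.
  rewrite /cl /= mulr1 clamp_ge1; last first.
    by rewrite lerBrDr addrC natr1 prednK.
  by rewrite scale1r /D prednK // addrCA subrr addr0 ptr.
have [|x|G GE] := @dimdrop_exists R p q g.
- exact: lipschitz_continuous L0 gL.
- split=> xE; rewrite xE.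
    by rewrite g0; exact: (dimdrop_admissible f (ui0 R)).1.
  by rewrite g1; exact: (dimdrop_admissible f (ui1 R)).2.
have gn x : opnorm (g x) <= dnorm f + e.
  rewrite -[g x](subKr (f x)); apply: le_trans (opnormD _ _) _.
  by rewrite opnormN; apply: lerD; [exact: opnorm_le_dnorm|exact: gf].
pose j := (Num.truncn (dnorm f + e + L)).+1.
have jP : dnorm f + e + L <= j%:R.
  have h0 : 0 <= dnorm f + e + L by rewrite !addr_ge0 ?dnorm_nneg // ltW.
  by have /andP[_ h] := truncn_itv h0; exact: ltW h.
exists j, G; last by apply: dnorm_le => x; rewrite dimdropBE GE; exact: gf.
split.
  apply: dnorm_le => x; rewrite GE; apply: le_trans (gn x) (le_trans _ jP).
  by rewrite lerDl.
move=> x y; rewrite !GE; apply: le_trans (gL x y) _; rewrite ler_wpM2r //.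
by apply: le_trans jP; rewrite lerDr addr_ge0 ?dnorm_nneg // ltW.
Qed.

End Density.

(** * Convergence in normed spaces and C*-algebras *)

Section NormFacts.
Variable R : realType.
Local Notation C := (complexes R).

Lemma complex_pos (e : C) : 0 < e -> exists2 r : R, 0 < r & e = (r%:C)%C.
Proof.
move=> e0; have eE : e = ((complex.Re e)%:C)%C by rewrite RRe_real // ger0_real // ltW.
by exists (complex.Re e); rewrite // -ltcR -eE.
Qed.

Lemma complex_exp2_small (e : C) : 0 < e ->
  exists k0 : nat, forall k, (k0 <= k)%N -> 2^-1 ^+ k <= e.
Proof.
move=> /complex_pos[r r0 ->]; have [k0 k0P] := exp2_small r0.
exists k0 => k /k0P; rewrite -lecR rmorphM rmorph1 mul1r fmorphV rmorphXn rmorph_nat /=.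
by rewrite exprVn.
Qed.

(** The order of C is partial, but |x| and y are real and hence comparable. *)
Lemma norm_le_eps (V : normedModType C) (x : V) (y : C) : 0 <= y ->
  (forall e : C, 0 < e -> `|x| <= y + e) -> `|x| <= y.
Proof.
move=> y0 h; have xy : `|x| - y \is Num.real by rewrite rpredB ?normr_real ?ger0_real.
rewrite -subr_le0 (real_leNgt xy (real0 _)); apply/negP => d0.
have := h ((`|x| - y) / 2) (divr_gt0 d0 (ltr0Sn _ 1)).
rewrite -lerBlDl ler_pdivlMr // mulr_natr mulr2n gerDl => hh.
by move: (lt_le_trans d0 hh); rewrite ltxx.
Qed.

Lemma geometric_cvg (V : completeNormedModType C) (x : nat -> V) J :
  (forall j, (J <= j)%N -> `|x j.+1 - x j| <= 2 * 2^-1 ^+ j) ->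
  exists b, forall e : C, 0 < e -> exists J', forall j, (J' <= j)%N -> `|x j - b| <= e.
Proof.
move=> xc.
(* The 4 is that of the tail: the terms 2 * 2^-j with j >= m add up to 4 * 2^-m. *)
have xd m k : (J <= m)%N -> `|x (m + k)%N - x m| <= 4 * 2^-1 ^+ m - 4 * 2^-1 ^+ (m + k)%N.
  move=> Jm; elim: k => [|k IH]; first by rewrite addn0 !subrr normr0.
  rewrite addnS; apply: le_trans (ler_distD (x (m + k)%N) _ _) _.
  apply: le_trans (lerD (xc _ (leq_trans Jm (leq_addr _ _))) IH) _.
  rewrite exprS; set t := 2^-1 ^+ (m + k).
  have -> : 4 * (2^-1 * t) = 2 * t :> C by field.
  rewrite addrCA lerD2l.
  have -> : 2 * t - 4 * t = - (2 * t) :> C by ring.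
  exact: lexx.
have : cauchy (x @ \oo).
  apply: cauchy_exP => e e0.
  have [k0 k0P] := complex_exp2_small (divr_gt0 e0 (ltr0Sn C 4)).
  exists (x (maxn J k0)), (maxn J k0) => // j /= jJ; rewrite -ball_normE /= distrC.
  rewrite -(subnKC jJ); apply: le_lt_trans (xd _ _ (leq_maxl J k0)) _.
  apply: (@le_lt_trans _ _ (4 * 2^-1 ^+ maxn J k0)).
    by rewrite lerBlDr lerDl mulr_ge0 ?exprn_ge0 ?invr_ge0 ?ler0n.
  apply: (@le_lt_trans _ _ (4 * (e / 5))).
    by rewrite ler_wpM2l ?ler0n // k0P ?leq_maxr.
  by rewrite mulrCA -[ltRHS]mulr1 ltr_pM2l // ltr_pdivrMr // mul1r ltr_nat.
move=> /cauchy_cvg xb; exists (lim (x @ \oo)) => e e0.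
move/cvgrPdist_le : xb => /(_ e e0)[J' _ JP].
by exists J' => j jJ; rewrite distrC; apply: JP.
Qed.

End NormFacts.

Section CStarFacts.
Variables (C : numClosedFieldType) (A : cstarAlgType C).

Lemma cstar_norm_star (x : A) : `|star x| = `|x|.
Proof.
have h (y : A) : `|y| <= `|star y|.
  have [->|y0] := eqVneq y 0; first by rewrite normr0.
  rewrite -(@ler_pM2r _ `|y|) ?normr_gt0 // -expr2 -cstar_norm_starM.
  exact: cstar_normM.
by apply: le_anti; rewrite h andbT -{2}(starK x) h.
Qed.

Lemma smulBl (x y z : A) : smul (x - y) z = smul x z - smul y z.
Proof. by rewrite smulDl -scaleN1r smulZl scaleN1r. Qed.

Lemma smulBr (x y z : A) : smul x (y - z) = smul x y - smul x z.
Proof. by rewrite smulDr -scaleN1r smulZr scaleN1r. Qed.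

Lemma starB (x y : A) : star (x - y) = star x - star y.
Proof. by rewrite starD -scaleN1r starZ rmorphN rmorph1 scaleN1r. Qed.

Lemma smul_dist (x y x' y' : A) :
  `|smul x y - smul x' y'| <= `|x - x'| * `|y| + `|x'| * `|y - y'|.
Proof.
have -> : smul x y - smul x' y' = smul (x - x') y + smul x' (y - y').
  by rewrite smulBl smulBr addrA subrK.
by apply: le_trans (ler_normD _ _) _; apply: lerD; exact: cstar_normM.
Qed.

End CStarFacts.

(** * The homomorphism defined by an asymptotic graph *)

Section HalfIntertwining.
Variables (R : realType).
Local Notation C := (complexes R).
Variables (L M : cstarAlgType C) (E G : nat -> starAlgType C).
Variables (lam : forall j, E j -> L) (rho : forall j, G j -> M) (alpha : forall j, E j -> G j).
Hypotheses (hlam : forall j, star_hom (@lam j)) (hrho : forall j, star_hom (@rho j))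
  (halpha : forall j, star_hom (@alpha j)).
Hypothesis contr : forall j (f : E j), `|rho (alpha f)| <= `|lam f|.

Local Notation ra f := (rho (alpha f)).

(* The limit homomorphism is obtained from its graph, since an element of L has no
   preferred representatives in the E_j. *)
Definition asymptotic_graph (a : L) (b : M) : Prop :=
  forall e : C, 0 < e -> exists J : nat, forall j, (J <= j)%N ->
    exists f : E j, `|lam f - a| <= e /\ `|ra f - b| <= e.

Local Notation Theta := asymptotic_graph.

Lemma ra_linear j k (f g : E j) : ra (k *: f + g) = k *: ra f + ra g.
Proof. by have [hl _ _] := hrho j; have [hl' _ _] := halpha j; rewrite hl' hl. Qed.

Lemma lam_linear j k (f g : E j) : lam (k *: f + g) = k *: lam f + lam g.
Proof. by have [hl _ _] := hlam j; rewrite hl. Qed.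

Lemma contr_dist j (f g : E j) : `|ra f - ra g| <= `|lam f - lam g|.
Proof.
have -> : ra f - ra g = ra (-1 *: g + f) by rewrite ra_linear scaleN1r addrC.
have -> : lam f - lam g = lam (-1 *: g + f) by rewrite lam_linear scaleN1r addrC.
exact: contr.
Qed.

(** Contractivity of the alpha_j passes to the graph; the limit map is single-valued and contractive
    for this reason. *)
Lemma graph_dist a b a' b' : Theta a b -> Theta a' b' -> `|b - b'| <= `|a - a'|.
Proof.
move=> ab ab'; apply: norm_le_eps => // e e0.
have e4 : 0 < e / 4 by rewrite divr_gt0.
have [J JP] := ab _ e4; have [J' JP'] := ab' _ e4.
have [f [f1 f2]] := JP _ (leq_maxl J J'); have [g [g1 g2]] := JP' _ (leq_maxr J J').
have h1 : `|b - b'| <= e / 4 + (`|ra f - ra g| + e / 4).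
  apply: le_trans (ler_distD (ra f) _ _) _; apply: lerD; first by rewrite distrC.
  apply: le_trans (ler_distD (ra g) _ _) _; exact: lerD.
have h2 : `|lam f - lam g| <= e / 4 + (`|a - a'| + e / 4).
  apply: le_trans (ler_distD a _ _) _; apply: lerD; first by [].
  by apply: le_trans (ler_distD a' _ _) _; apply: lerD => //; rewrite distrC.
apply: le_trans h1 _.
have h3 : `|ra f - ra g| <= e / 4 + (`|a - a'| + e / 4) := le_trans (contr_dist f g) h2.
apply: (@le_trans _ _ (e / 4 + ((e / 4 + (`|a - a'| + e / 4)) + e / 4))).
  by rewrite lerD2l lerD2r.
have -> : e / 4 + ((e / 4 + (`|a - a'| + e / 4)) + e / 4) = `|a - a'| + e.
  by field.
exact: lexx.
Qed.

Lemma graph_fun a b b' : Theta a b -> Theta a b' -> b = b'.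
Proof.
move=> ab ab'; apply/eqP; rewrite -subr_eq0 -normr_le0.
by apply: le_trans (graph_dist ab ab') _; rewrite subrr normr0.
Qed.

Lemma graph_linear k a b a' b' : Theta a b -> Theta a' b' ->
  Theta (k *: a + a') (k *: b + b').
Proof.
move=> ab ab' e e0; have k1 : 0 < `|k| + 1 by rewrite ltr_wpDl.
have e2 : 0 < e / (`|k| + 1) by rewrite divr_gt0.
have [J JP] := ab _ e2; have [J' JP'] := ab' _ e2.
exists (maxn J J') => j; rewrite geq_max => /andP[/JP[f [f1 f2]] /JP'[g [g1 g2]]].
have main (V : normedModType C) (x x' y y' : V) : `|x - y| <= e / (`|k| + 1) ->
    `|x' - y'| <= e / (`|k| + 1) -> `|k *: x + x' - (k *: y + y')| <= e.
  move=> h1 h2; rewrite opprD addrACA -scalerBr.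
  apply: le_trans (ler_normD _ _) _; rewrite normrZ.
  apply: le_trans (lerD (ler_wpM2l (normr_ge0 k) h1) h2) _.
  by rewrite -[X in _ + X]mul1r -mulrDl mulrC divfK ?gt_eqF.
by exists (k *: f + g); rewrite ra_linear lam_linear; split; exact: main.
Qed.

Lemma graph_mul a b a' b' : Theta a b -> Theta a' b' -> Theta (smul a a') (smul b b').
Proof.
(* Bounds the norms of the two factors, in L and in M, with 1 to spare for the perturbation; the
   summand e makes e / K at most 1. *)
move=> ab ab' e e0; pose K := `|a| + `|a'| + (`|b| + `|b'|) + 1 + e.
have ab0 : 0 <= `|a| + `|a'| + (`|b| + `|b'|) by rewrite !addr_ge0.
have K0 : 0 < K by rewrite /K ltr_wpDl // addr_ge0.
have e2 : 0 < e / K by rewrite divr_gt0.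
have eK1 : e / K <= 1.
  by rewrite ler_pdivrMr // mul1r /K lerDr addr_ge0.
have [J JP] := ab _ e2; have [J' JP'] := ab' _ e2.
exists (maxn J J') => j; rewrite geq_max => /andP[/JP[f [f1 f2]] /JP'[g [g1 g2]]].
have main (V : cstarAlgType C) (x x' y y' : V) : `|y| + `|y'| <= `|a| + `|a'| + (`|b| + `|b'|) ->
    `|x - y| <= e / K -> `|x' - y'| <= e / K -> `|smul x x' - smul y y'| <= e.
  move=> yy h1 h2; apply: le_trans (smul_dist _ _ _ _) _.
  have x'1 : `|x'| <= `|y'| + 1.
    rewrite -{1}(subrK y' x') addrC; apply: le_trans (ler_normD _ _) _.
    by rewrite lerD2l; apply: le_trans h2 _.
  apply: (@le_trans _ _ (e / K * (`|y'| + 1) + `|y| * (e / K))).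
    by apply: lerD; [apply: ler_pM|apply: ler_wpM2l].
  rewrite [`|y| * _]mulrC -mulrDr mulrAC ler_pdivrMr // ler_pM2l //.
  rewrite addrC addrA /K; apply: (@le_trans _ _ (`|a| + `|a'| + (`|b| + `|b'|) + 1)).
    by rewrite lerD2r.
  by rewrite lerDl ltW.
have [_ lm _] := hlam j; have [_ rm _] := hrho j; have [_ am _] := halpha j.
exists (smul f g); rewrite lm am rm; split; apply: main => //.
  by rewrite lerDl addr_ge0.
by rewrite lerDr addr_ge0.
Qed.

Lemma graph_star a b : Theta a b -> Theta (star a) (star b).
Proof.
move=> ab e e0; have [J JP] := ab _ e0; exists J => j /JP[f [f1 f2]].
have [_ _ ls] := hlam j; have [_ _ rs] := hrho j; have [_ _ as_] := halpha j.
by exists (star f); rewrite ls as_ rs -!starB !cstar_norm_star.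
Qed.

Lemma graph_closed a b : (forall e : C, 0 < e -> exists a' b',
    [/\ Theta a' b', `|a' - a| <= e & `|b' - b| <= e]) -> Theta a b.
Proof.
move=> h e e0; have e2 : 0 < e / 2 by rewrite divr_gt0.
have [a' [b' [ab ha hb]]] := h _ e2; have [J JP] := ab _ e2.
exists J => j /JP[f [f1 f2]]; exists f; split.
  by apply: le_trans (ler_distD a' _ _) _; rewrite [e]splitr lerD.
by apply: le_trans (ler_distD b' _ _) _; rewrite [e]splitr lerD.
Qed.

Variable D : set L.
Hypothesis Ddense : forall a (e : C), 0 < e -> exists2 a', D a' & `|a' - a| <= e.
Hypothesis Dtotal : forall a, D a -> exists b, Theta a b.

(** Approximants within 2^-j of a have, by contractivity, images forming a Cauchy sequence; its
    limit is related to a because the graph is closed. *)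
Lemma graph_total a : exists b, Theta a b.
Proof.
have /choice[x xP] : forall j, exists ab : L * M,
    Theta ab.1 ab.2 /\ `|ab.1 - a| <= 2^-1 ^+ j.
  move=> j; have [|a' Da' ha] := Ddense a (e := 2^-1 ^+ j).
    by rewrite exprn_gt0 // invr_gt0.
  by have [b ab] := Dtotal Da'; exists (a', b).
have [|b bP] := @geometric_cvg R M (fun j => (x j).2) 0.
  move=> j _; have [t1 d1] := xP j; have [t2 d2] := xP j.+1.
  apply: le_trans (graph_dist t2 t1) _; apply: le_trans (ler_distD a _ _) _.
  rewrite mulr_natl mulr2n; apply: lerD; last by rewrite distrC.
  apply: le_trans d2 _; rewrite exprS ler_piMl ?exprn_ge0 ?invr_ge0 ?ler0n //.
  by rewrite invf_le1 // ler1n.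
exists b; apply: graph_closed => e e0.
have [k0 k0P] := complex_exp2_small e0; have [J JP] := bP e e0.
exists (x (maxn k0 J)).1, (x (maxn k0 J)).2; have [t d] := xP (maxn k0 J).
split; [exact: t|exact: le_trans d (k0P _ (leq_maxl _ _))|exact: JP (leq_maxr _ _)].
Qed.

Lemma half_intertwining : exists T : L -> M, [/\ star_hom T,
  forall a b, Theta a b -> T a = b, forall a, Theta a (T a) &
  forall a a', `|T a - T a'| <= `|a - a'|].
Proof.
have /choice[T TP] := graph_total; exists T.
have TE a b : Theta a b -> T a = b by move=> ab; exact: graph_fun (TP a) ab.
split=> //; last by move=> a a'; exact: graph_dist.
split.
- by move=> k a a'; apply: TE; exact: graph_linear.
- by move=> a a'; apply: TE; exact: graph_mul.
- by move=> a; apply: TE; exact: graph_star.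
Qed.

End HalfIntertwining.

(** * Approximate intertwining *)

Section Intertwining.
Variable R : realType.
Local Notation C := (complexes R).
Variables (L M : cstarAlgType C) (E G : nat -> starAlgType C).
Variables (lam : forall j, E j -> L) (rho : forall j, G j -> M)
  (alpha : forall j, E j -> G j) (beta : forall j, G j -> E j.+1).
Hypotheses (hlam : forall j, star_hom (@lam j)) (hrho : forall j, star_hom (@rho j))
  (halpha : forall j, star_hom (@alpha j)) (hbeta : forall j, star_hom (@beta j)).
Hypothesis contra : forall j (f : E j), `|rho (alpha f)| <= `|lam f|.
Hypothesis contrb : forall j (g : G j), `|lam (beta g)| <= `|rho g|.
Hypothesis Ldense : forall a (e : C), 0 < e -> exists a' (f : forall j, E j) J,
  `|a' - a| <= e /\ forall j, (J <= j)%N ->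
  [/\ lam (f j) = a', `|lam (beta (alpha (f j))) - a'| <= 2^-1 ^+ j &
      `|rho (alpha (beta (alpha (f j)))) - rho (alpha (f j))| <= 2^-1 ^+ j].
Hypothesis Mdense : forall b (e : C), 0 < e -> exists b' (g : forall j, G j) J,
  `|b' - b| <= e /\ forall j, (J <= j)%N ->
  [/\ rho (g j) = b', `|rho (alpha (beta (g j))) - b'| <= 2^-1 ^+ j &
      `|lam (beta (alpha (beta (g j)))) - lam (beta (g j))| <= 2^-1 ^+ j].

(** For a in the dense set, rho(alpha_j f_j) converges to some b: contractivity and the round trips
    bound its steps. The images alpha_j f_j also represent b on the other side, so a and b are
    related in both graphs. Hence the two limit maps are inverse to each other on dense sets, and
    everywhere by contractivity. *)
Lemma approximate_intertwining : star_isomorphic L M.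
Proof.
have geo (V : completeNormedModType C) (x : nat -> V) (y : nat -> V) J :
    (forall j, (J <= j)%N -> `|x j.+1 - y j| <= 2^-1 ^+ j) ->
    (forall j, (J <= j)%N -> `|y j - x j| <= 2^-1 ^+ j) ->
    exists b, forall e : C, 0 < e -> exists J', forall j, (J' <= j)%N -> `|x j - b| <= e.
  move=> h1 h2; apply: (@geometric_cvg R V x J) => j Jj.
  apply: le_trans (ler_distD (y j) _ _) _; rewrite mulr_natl mulr2n.
  by apply: lerD; [exact: h1|exact: h2].
pose DL := [set a' | exists (f : forall j, E j) J, forall j, (J <= j)%N ->
  [/\ lam (f j) = a', `|lam (beta (alpha (f j))) - a'| <= 2^-1 ^+ j &
      `|rho (alpha (beta (alpha (f j)))) - rho (alpha (f j))| <= 2^-1 ^+ j]].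
pose DM := [set b' | exists (g : forall j, G j) J, forall j, (J <= j)%N ->
  [/\ rho (g j) = b', `|rho (alpha (beta (g j))) - b'| <= 2^-1 ^+ j &
      `|lam (beta (alpha (beta (g j)))) - lam (beta (g j))| <= 2^-1 ^+ j]].
have DLd a (e : C) : 0 < e -> exists2 a', DL a' & `|a' - a| <= e.
  by move=> /(Ldense a)[a' [f [J [h h']]]]; exists a' => //; exists f, J.
have DMd b (e : C) : 0 < e -> exists2 b', DM b' & `|b' - b| <= e.
  by move=> /(Mdense b)[b' [g [J [h h']]]]; exists b' => //; exists g, J.
have small := @complex_exp2_small R.
pose Th := asymptotic_graph lam rho alpha.
pose Th' := asymptotic_graph rho (fun j => @lam j.+1) beta.
have hlam' j : star_hom (@lam j.+1) := hlam j.+1.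
have DLt a : DL a -> exists b, Th a b /\ Th' b a.
  move=> [f [J fP]].
  have [||b bP] := geo M (fun j => rho (alpha (f j))) (fun j => rho (alpha (beta (alpha (f j))))) J.
  - move=> j Jj; have [l1 l2 _] := fP j Jj; have [l1' _ _] := fP j.+1 (leqW Jj).
    apply: le_trans (contr_dist hlam hrho halpha contra _ _) _.
    by rewrite l1' distrC.
  - by move=> j Jj; have [] := fP j Jj.
  exists b; split=> e e0; have [J' JP'] := bP e e0.
    exists (maxn J J') => j; rewrite geq_max => /andP[/fP[l1 _ _] /JP' h].
    by exists (f j); rewrite l1 subrr normr0 (ltW e0).
  have [k0 k0P] := small e e0.
  exists (maxn k0 (maxn J J')) => j; rewrite !geq_max => /and3P[/k0P hk /fP[_ l2 _] /JP' h].
  by exists (alpha (f j)); split=> //; exact: le_trans l2 hk.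
have DMt b : DM b -> exists a, Th' b a /\ Th a b.
  move=> [g [J gP]].
  have [||a aP] := geo L (fun j => lam (beta (g j))) (fun j => lam (beta (alpha (beta (g j))))) J.
  - move=> j Jj; have [l1 l2 _] := gP j Jj; have [l1' _ _] := gP j.+1 (leqW Jj).
    apply: le_trans (contr_dist hrho hlam' hbeta contrb _ _) _.
    by rewrite l1' distrC.
  - by move=> j Jj; have [] := gP j Jj.
  exists a; split=> e e0; have [J' JP'] := aP e e0.
    exists (maxn J J') => j; rewrite geq_max => /andP[/gP[l1 _ _] /JP' h].
    by exists (g j); rewrite l1 subrr normr0 (ltW e0).
  have [k0 k0P] := small e e0.
  (* [beta (g j)] lives in [E j.+1]: the index is shifted by one and 0 is excluded. *)
  exists (maxn k0 (maxn J J')).+1 => -[//|j]; rewrite ltnS !geq_max.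
  move=> /and3P[/k0P hk /gP[_ l2 _] /JP' h].
  by exists (beta (g j)); split=> //; exact: le_trans l2 hk.
have [T [hT TE _ Td]] := half_intertwining hlam hrho halpha contra DLd
  (fun a Da => let: ex_intro b (conj t _) := DLt a Da in ex_intro _ b t).
have [T' [hT' TE' _ Td']] := half_intertwining hrho hlam' hbeta contrb DMd
  (fun b Db => let: ex_intro a (conj t _) := DMt b Db in ex_intro _ a t).
have cancel_dense (V W : normedModType C) (S : V -> W) (S' : W -> V) (D : set V) :
    (forall a a', `|S a - S a'| <= `|a - a'|) ->
    (forall a a', `|S' a - S' a'| <= `|a - a'|) ->
    (forall a (e : C), 0 < e -> exists2 a', D a' & `|a' - a| <= e) ->
    (forall a, D a -> S' (S a) = a) -> cancel S S'.
  move=> Sd Sd' Dd SS a; apply/eqP; rewrite -subr_eq0 -normr_le0.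
  apply: norm_le_eps => // e e0; rewrite add0r.
  have [a' Da' h] := Dd a _ (divr_gt0 e0 (ltr0Sn _ 1)).
  apply: le_trans (ler_distD (S' (S a')) _ _) _; rewrite [e]splitr; apply: lerD.
    by apply: le_trans (Sd' _ _) _; apply: le_trans (Sd _ _) _; rewrite distrC.
  by rewrite SS.
exists T; split => //; exists T'.
- apply: (cancel_dense _ _ _ _ _ Td Td' DLd) => a Da.
  by have [b [t t']] := DLt a Da; rewrite (TE _ _ t) (TE' _ _ t').
- apply: (cancel_dense _ _ _ _ _ Td' Td DMd) => b Db.
  by have [a [t t']] := DMt b Db; rewrite (TE' _ _ t) (TE _ _ t').
Qed.

End Intertwining.

(** * Elements followed along a sequence *)

Section Reach.
Variables (R : realType) (p q : nat -> nat).
Variable phi : forall n, dimdrop R (p n) (q n) -> dimdrop R (p n.+1) (q n.+1).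
Local Notation C := (complexes R).
Local Notation A n := (dimdrop R (p n) (q n)).
Hypothesis prm : prime_dimdrop_sequence phi.

Definition follows n m (X : A n -> A m) D (e : R) : Prop :=
  exists2 Phi, conn phi Phi & forall f, D f -> dnorm (X f - Phi f) <= e.

(* The elements of A_n that come from j-Lipschitz elements of some A_i, i <= n. *)
Fixpoint reach (j n : nat) : set (A n) :=
  match n with
  | 0 => set0
  | n'.+1 => ((@phi n') @` @reach j n') `|` @lipschitz_class R (p n'.+1) (q n'.+1) j
  end.

Arguments reach : clear implicits.

Lemma reach_tame j n : tame (reach j n).
Proof.
elim: n => [|n IH] /=; first exact: tame0.
apply: tameU; last exact: lipschitz_class_tame.
(* The index 0 is outside the sequence; its set is empty. *)
have [n0|n0] := posnP n.
  suff -> : (@phi n) @` reach j n = set0 by exact: tame0.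
  by rewrite n0 /= image_set0.
have [_ _ _ _ [k [xi phixi]]] := prm n0.
exact: tame_image (diagonalized_diagonal phixi) IH.
Qed.

Lemma lipschitz_reach j n (f : A n) : (0 < n)%N -> lipschitz_class j f -> reach j n f.
Proof. by case: n f => // n f _ fj; right. Qed.

Lemma reach_conn j0 j n m (Phi : A n -> A m) f : (0 < n)%N -> (j0 <= j)%N ->
  conn phi Phi -> lipschitz_class j0 f -> reach j m (Phi f).
Proof.
move=> n0 jj; elim=> [|{}m {}Phi _ IH] fj.
  exact/lipschitz_reach/(lipschitz_class_le jj fj).
by left; exists (Phi f); first exact: IH.
Qed.

Variables (L : cstarAlgType C) (mu : forall n, A n -> L).
Hypothesis lim : is_inductive_limit (fun n => @dimdrop_norm R (p n) (q n)) phi mu.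
Hypothesis dag : dagger phi.

(** Connecting maps are isometric, so the sequence of norms that defines the limit norm is
    constant. *)
Lemma limit_dnorm n (f : A n) : (0 < n)%N -> `|mu f| = ((dnorm f)%:C)%C.
Proof.
move=> n0; have := @limit_norm _ _ _ _ _ _ lim n n0 f.
have -> : (fun k => dimdrop_norm (@connecting (fun n => A n) phi n k f)) =
    fun=> ((dnorm f)%:C)%C.
  apply/funext => k; rewrite dnormE.
  by rewrite (conn_dnorm prm dag n0 (conn_connecting phi n k)).
move=> h; apply/esym; apply: (cvg_unique _ _ h); first exact: norm_hausdorff.
exact: cvg_cst.
Qed.

Lemma limit_conn n m (Phi : A n -> A m) f : (0 < n)%N -> conn phi Phi -> mu (Phi f) = mu f.
Proof.
move=> n0; elim=> [//|{}m {}Phi cPhi <-].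
have m0 : (0 < m)%N := leq_trans n0 (conn_leq cPhi).
exact: (limit_compat lim m0).
Qed.

Lemma limit_dist n (f g : A n) : (0 < n)%N -> `|mu f - mu g| = ((dnorm (f - g))%:C)%C.
Proof.
move=> n0; have [hl _ _] := limit_hom lim n0.
rewrite -limit_dnorm //; congr `|_|.
have := hl (-1) g f; rewrite !scaleN1r => e.
by rewrite addrC -e addrC.
Qed.

Lemma follows_limit n m (X : A n -> A m) D j f :
  (0 < n)%N -> (0 < m)%N -> follows X D (2^-1 ^+ j) -> D f ->
  `|mu (X f) - mu f| <= 2^-1 ^+ j.
Proof.
move=> n0 m0 [Phi cPhi XP] Df; rewrite -(limit_conn f n0 cPhi).
rewrite limit_dist //.
have -> : 2^-1 ^+ j = ((2^-1 ^+ j)%:C)%C :> C.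
  by rewrite rmorphXn fmorphV rmorph_nat.
by rewrite lecR; exact: XP.
Qed.

Lemma limit_lipschitz_dense a (e : C) : 0 < e -> exists n j (f : A n),
  [/\ (0 < n)%N, lipschitz_class j f & `|mu f - a| <= e].
Proof.
move=> e0; have [r r0 rE] := complex_pos (divr_gt0 e0 (ltr0Sn _ 1)).
have e2 : 0 < e / 2 by rewrite divr_gt0.
have B0 : ball a (e / 2) !=set0 by exists a; exact: ballxx.
have [x [xB [n n0 [f _ fx]]]] := limit_dense lim B0 (ball_open a (e / 2)).
have [j [g gj fg]] := lipschitz_dense f r0.
exists n, j, g; split=> //; apply: le_trans (ler_distD x _ _) _.
rewrite [e]splitr; apply: lerD; last first.
  by move: xB; rewrite -ball_normE /= distrC => /ltW.
by rewrite -fx distrC limit_dist // rE lecR.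
Qed.

Lemma limit_reach_dense (N : nat -> nat) a (e : C) : (forall j, (j <= N j)%N) -> 0 < e ->
  exists a' (f : forall j, A (N j)) J, `|a' - a| <= e /\
    forall j, (J <= j)%N -> mu (f j) = a' /\ reach j _ (f j).
Proof.
move=> jN /(limit_lipschitz_dense a)[n [j0 [g [n0 gj ga]]]].
have H j : exists f : A (N j), (maxn n j0 <= j)%N -> mu f = mu g /\ reach j _ f.
  (* 0 is a placeholder for the finitely many small j. *)
  have [|_] := boolP (maxn n j0 <= j)%N; last by exists 0.
  rewrite geq_max => /andP[nj jj]; have [Phi cPhi] := conn_exists phi (leq_trans nj (jN j)).
  by exists (Phi g) => _; split; [exact: limit_conn|exact: reach_conn jj cPhi gj].
exists (mu g), (fun j => sval (cid (H j))), (maxn n j0); split=> // j Jj.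
exact: (svalP (cid (H j)) Jj).
Qed.

End Reach.

(** * The back-and-forth construction *)

Section Stages.
Variables (R : realType) (p q p' q' : nat -> nat).
Variable phi : forall n, dimdrop R (p n) (q n) -> dimdrop R (p n.+1) (q n.+1).
Variable psi : forall n, dimdrop R (p' n) (q' n) -> dimdrop R (p' n.+1) (q' n.+1).
Local Notation A n := (dimdrop R (p n) (q n)).
Local Notation B n := (dimdrop R (p' n) (q' n)).
Hypotheses (gphi : good_sequence phi) (gpsi : good_sequence psi).

Record stage := Stage {
  src : nat;
  tgt : nat;
  forth : A src -> B tgt;
  dom : set (A src)
}.

(** The 10 cancels the constant of [approx_unitary_equiv], so that round trips are correct up to
    2^-j. *)
Definition stage_at j (st : stage) : Prop :=
  [/\ (0 < src st)%N /\ (0 < tgt st)%N, (j <= src st)%N /\ (j <= tgt st)%N,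
      tight phi (@forth st) (@dom st) (2^-1 ^+ j / 10), tame (@dom st) &
      @reach R p q phi j (src st) `<=` @dom st].

(** The second round trip is controlled also on the images of [dom], because the intertwining
    estimates alpha beta alpha f; the last clause plays the same part for beta alpha beta g at the
    following stage. *)
Definition next_stage j (st st' : stage) (back : B (tgt st) -> A (src st')) : Prop :=
  [/\ diagonal back, follows phi (fun f => back (forth f)) (@dom st) (2^-1 ^+ j),
      follows psi (fun g => forth (back g))
        (@forth st @` @dom st `|` @reach R p' q' psi j (tgt st)) (2^-1 ^+ j) &
      back @` @reach R p' q' psi j (tgt st) `<=` @dom st'].

Let exp2_gt0 j : 0 < 2^-1 ^+ j / 10 :> R.
Proof. by rewrite divr_gt0 // exprn_gt0 // invr_gt0. Qed.

Lemma stage_exists : exists st, stage_at 0 st.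
Proof.
have [prm _ _] := gphi.
have tF := reach_tame prm 0 1.
have [m [alpha [_ m0 ta]]] := tight_exists gphi gpsi 0 (ltn0Sn 0) tF (exp2_gt0 0).
exists (Stage alpha (@reach R p q phi 0 1)); split.
- split; [exact: ltn0Sn|exact: m0].
- by [].
- exact: ta.
- exact: tF.
- by [].
Qed.

Lemma next_stage_exists j st : stage_at j st ->
  exists st', stage_at j.+1 st' /\ exists back, @next_stage j st st' back.
Proof.
case: st => n m alpha F [] /= [n0 m0] [jn jm] ta tF rF.
have [prm _ _] := gphi; have [prm' _ _] := gpsi.
have [k [xi axi]] := tight_diagonal ta.
pose G := alpha @` F `|` @reach R p' q' psi j m.
have tG : tame G := tameU (tame_image axi tF) (reach_tame prm' j m).
(* [beta] nearly inverts [alpha] on F, and [alpha'] below nearly inverts [beta] on G, which contains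
   the image of F. *)
have [l [beta [Phi [jl l0 cPhi tb bP]]]] :=
  tight_reverse gphi gpsi j.+1 n0 m0 ta tG (exp2_gt0 j).
have [k' [xi' bxi]] := tight_diagonal tb.
pose F' := beta @` G `|` @reach R p q phi j.+1 l.
have tF' : tame F' := tameU (tame_image bxi tG) (reach_tame prm j.+1 l).
have [m' [alpha' [Psi [jm' m'0 cPsi ta' aP]]]] :=
  tight_reverse gpsi gphi j.+1 m0 l0 tb tF' (exp2_gt0 j.+1).
have e10 : 10 * (2^-1 ^+ j / 10) = 2^-1 ^+ j :> R by rewrite mulrC divfK.
exists (Stage alpha' F'); split.
  by split=> //= f rf; right.
exists beta; split.
- by exists k', xi'.
- by exists Phi => // f Ff; rewrite -e10; exact: bP.
- by exists Psi => // g Gg; rewrite -e10; exact: aP.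
- by move=> _ [g rg <-]; left; exists g => //; right.
Qed.

Lemma stages_exist : exists s : nat -> stage,
  forall j, stage_at j (s j) /\ exists back, @next_stage j (s j) (s j.+1) back.
Proof.
have [st0 st0P] := stage_exists.
(* Away from valid stages the successor is arbitrary, so that it can be chosen as a total
   function. *)
have step (js : nat * stage) : exists st', stage_at js.1 js.2 ->
    stage_at js.1.+1 st' /\ exists back, @next_stage js.1 js.2 st' back.
  have [/next_stage_exists[st' h]|h] := pselect (stage_at js.1 js.2).
    by exists st' => _.
  by exists js.2.
have [next nextP] := choice step.
pose s := fix s j := if j is i.+1 then next (i, s i) else st0.
have sP j : stage_at j (s j).
  by elim: j => [//|j IH]; have [] := nextP (j, s j) IH.
exists s => j; split; first exact: sP.
by have [] := nextP (j, s j) (sP j).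
Qed.

End Stages.

(** * The isomorphism of the limits *)

Theorem theorem4p6 (R : realType) (p q p' q' : nat -> nat)
    (phi : forall n, dimdrop R (p n) (q n) -> dimdrop R (p n.+1) (q n.+1))
    (psi : forall n, dimdrop R (p' n) (q' n) -> dimdrop R (p' n.+1) (q' n.+1))
    (A B : cstarAlgType (complexes R)) :
  prime_dimdrop_sequence phi -> dagger phi -> double_dagger p q ->
  prime_dimdrop_sequence psi -> dagger psi -> double_dagger p' q' ->
  is_dimdrop_limit phi A -> is_dimdrop_limit psi B ->
  star_isomorphic A B.
Proof.
move=> prm dag ddag prm' dag' ddag' [mu limA] [nu limB].
have [s sP] := stages_exist (And3 prm dag ddag) (And3 prm' dag' ddag').
pose n j := src (s j); pose m j := tgt (s j).
pose beta j := sval (cid (sP j).2).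
have betaP j : next_stage phi psi j (beta j) := svalP (cid (sP j).2).
have n0 j : (0 < n j)%N by have [[[]]] := sP j.
have m0 j : (0 < m j)%N by have [[[]]] := sP j.
have jn j : (j <= n j)%N by have [[_ []]] := sP j.
have jm j : (j <= m j)%N by have [[_ []]] := sP j.
have da j : diagonal (@forth _ _ _ _ _ (s j)).
  by have [[_ _ ta _ _] _] := sP j; exact: tight_diagonal ta.
have db j : diagonal (beta j) by have [] := betaP j.
apply: (@approximate_intertwining R A B (fun j => dimdrop R (p (n j)) (q (n j)))
  (fun j => dimdrop R (p' (m j)) (q' (m j))) (fun j => mu (n j)) (fun j => nu (m j))
  (fun j => @forth _ _ _ _ _ (s j)) beta).
- by move=> j; exact: (limit_hom limA (n0 j)).
- by move=> j; exact: (limit_hom limB (m0 j)).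
- by move=> j; have [k [xi xid]] := da j; exact: diagonal_star_hom xid.
- by move=> j; have [k [xi xid]] := db j; exact: diagonal_star_hom xid.
- move=> j f; have [k [xi xid]] := da j.
  by rewrite (limit_dnorm prm' limB) // (limit_dnorm prm limA) // lecR (diagonal_dnorm _ xid).
- move=> j g; have [k [xi xid]] := db j.
  by rewrite (limit_dnorm prm' limB) // (limit_dnorm prm limA) // lecR (diagonal_dnorm _ xid).
- move=> a e /(limit_reach_dense prm limA dag a jn)[a' [f [J [a'a fP]]]].
  exists a', f, J; split=> // j /fP[fj rf]; have [_ h1 h2 _] := betaP j.
  have [[_ _ _ _ rF] _] := sP j; split=> //.
    have := follows_limit prm limA dag (n0 j) (n0 j.+1) h1 (rF _ rf).
    by rewrite /= fj.
  apply: (follows_limit prm' limB dag' (m0 j) (m0 j.+1) h2).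
  by left; exists (f j); first exact: rF.
- move=> b e /(limit_reach_dense prm' limB dag' b jm)[b' [g [J [b'b gP]]]].
  exists b', g, J; split=> // j /gP[gj rg]; have [_ _ h1 h2] := betaP j.
  have [_ h3 _ _] := betaP j.+1; split=> //.
    have := follows_limit prm' limB dag' (m0 j) (m0 j.+1) h1 (or_intror rg).
    by rewrite /= gj.
  (* The image of a tracked element lies in the domain of the next stage, whose round trip is
     controlled there. *)
  have /h2 bg : (beta j @` @reach R p' q' psi j (m j)) (beta j (g j)) by exists (g j).
  apply: le_trans (follows_limit prm limA dag (n0 j.+1) (n0 j.+2) h3 bg) _.
  (* The error of stage j + 1 is half of what is allowed. *)
  by rewrite exprS ler_piMl // ?exprn_ge0 ?invr_ge0 // invf_le1 ?ler1n.
Qed.
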